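(* Let $0<\alpha<n$, $1\le p<\frac n\alpha$, define $q$ by $\frac1p-\frac1q=\frac\alpha n$, and let $d\ge1$. There is a constant $C=C(n,d,\alpha,p)$ such that for every $d\times d$ matrix weight $W\in\mathcal{A}_{p,q}$ on $\mathbb{R}^n$, every $f\in L^p(\mathbb{R}^n,\mathbb{R}^d)$ and every $\lambda>0$, $$\big|\{x\in\mathbb{R}^n: |W(x)I_\alpha(W^{-1}f)(x)|>\lambda\}\big|\le C\,[W]_{\mathcal{A}_{p,q}}\,[W^q]_{A_\infty^{\mathrm{sc}}}^q\,\frac1{\lambda^q}\left(\int_{\mathbb{R}^n}|f|^p\,dx\right)^{q/p}.$$ The same inequality holds if $|W I_\alpha(W^{-1}f)|$ is replaced by $M_{W,\alpha}f$, where $M_{W,\alpha}$ is the fractional Christ–Goldberg maximal operator.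
   Context: Cubes in $\mathbb{R}^n$ have sides parallel to the coordinate axes. $|\cdot|$ is the Euclidean norm on $\mathbb{R}^d$, and $|A|_{\mathrm{op}}=\sup\{|Av|:|v|=1\}$ for a $d\times d$ matrix $A$. A matrix weight is a function $W$ on $\mathbb{R}^n$ with values in the symmetric positive definite $d\times d$ real matrices whose entries are measurable. Fractional integral: $I_\alpha g(x)=\int_{\mathbb{R}^n}\frac{g(y)}{|x-y|^{n-\alpha}}\,dy$, acting componentwise on vector-valued functions. Fractional Christ–Goldberg maximal operator: $M_{W,\alpha}f(x)=\sup_{Q\ni x}|Q|^{\alpha/n}\frac1{|Q|}\int_Q|W(x)W^{-1}(y)f(y)|\,dy$, supremum over cubes containing $x$. For $1<p<\frac n\alpha$, with $\frac1p+\frac1{p'}=1$, $W\in\mathcal{A}_{p,q}$ means $[W]_{\mathcal{A}_{p,q}}=\sup_Q\frac1{|Q|}\int_Q\left(\frac1{|Q|}\int_Q|W(x)W^{-1}(y)|_{\mathrm{op}}^{p'}\,dy\right)^{q/p'}dx<\infty$. For $p=1$, $W\in\mathcal{A}_{1,q}$ means $[W]_{\mathcal{A}_{1,q}}=\sup_Q\operatorname{ess\,sup}_{x\in Q}\frac1{|Q|}\int_Q|W(y)W^{-1}(x)|_{\mathrm{op}}^q\,dy<\infty$. For a scalar weight $u$, $[u]_{A_\infty}=\sup_Q\frac1{\int_Q u\,dx}\int_Q M(u\chi_Q)\,dx$ (Fujii–Wilson characteristic), with $Mg(x)=\sup_{Q\ni x}|Q|^{-1}\int_Q|g|$. For $W\in\mathcal{A}_{p,q}$,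 set $w_v(x)=|W(x)v|^q$ for $v\in\mathbb{R}^d\setminus\{0\}$ and $[W^q]_{A_\infty^{\mathrm{sc}}}=\sup\{[w_v]_{A_\infty}: v\in\mathbb{R}^d\setminus\{0\}\}$ (which is finite). *)

(* Defs.v *)
From HB Require Import structures.
From mathcomp Require Import all_boot all_order all_algebra.
From mathcomp Require Import all_classical all_reals all_analysis.

Set Implicit Arguments.
Unset Strict Implicit.
Unset Printing Implicit Defensive.
Import Order.TTheory GRing.Theory Num.Def Num.Theory.
Import numFieldNormedType.Exports.
Local Open Scope classical_set_scope.
Local Open Scope ring_scope.

Section lebesgue_tuple.
Context {R : realType}.
Local Notation R1 := (measurableTypeR R).

Definition cons_pair n (z : R1 * n.-tuple R1) : n.+1.-tuple R1 :=
  [the n.+1.-tuple R1 of z.1 :: z.2].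

Lemma measurable_cons_pair n : measurable_fun [set: R1 * n.-tuple R1] (@cons_pair n).
Proof. exact: (measurable_cons measurable_fst measurable_snd). Qed.

Section step.
Variables (n : nat) (m : {sigma_finite_measure set (n.-tuple R1) -> \bar R}).

Definition lebesgue_step : set (n.+1.-tuple R1) -> \bar R :=
  pushforward (@lebesgue_measure R \x m)%E (@cons_pair n).

Let step0 : lebesgue_step set0 = 0%E.
Proof. by rewrite /lebesgue_step /pushforward preimage_set0 measure0. Qed.

Let step_ge0 A : (0 <= lebesgue_step A)%E.
Proof. by rewrite /lebesgue_step /pushforward measure_ge0. Qed.

Let step_sigma_additive : semi_sigma_additive lebesgue_step.
Proof.
move=> F mF tF mUF; rewrite /lebesgue_step /pushforward preimage_bigcup.
apply: measure_semi_sigma_additive.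
- by move=> i; rewrite -[X in measurable X]setTI; exact: measurable_cons_pair.
- apply/trivIsetP => /= i j _ _ ij; rewrite -preimage_setI.
  by move/trivIsetP : tF => /(_ _ _ _ _ ij) ->//; rewrite preimage_set0.
- rewrite -preimage_bigcup -[X in measurable X]setTI.
  exact: measurable_cons_pair.
Qed.

HB.instance Definition _ := isMeasure.Build _ _ _ lebesgue_step
  step0 step_ge0 step_sigma_additive.

Let step_sigma_finite : sigma_finite setT lebesgue_step.
Proof.
have [F TF Foo] : sigma_finite setT (@lebesgue_measure R \x m)%E.
  have /sigma_finiteP[F [TF ndF Foo]] := sigma_finiteT (@lebesgue_measure R).
  have /sigma_finiteP[G [TG ndG Goo]] := sigma_finiteT m.
  exists (fun k => F k `*` G k).
    rewrite -setXTT TF TG predeqE => -[x y]; split.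
      move=> [/= [i _ Fix] [k _ Gky]]; exists (maxn i k) => //; split.
      - by move: x Fix; exact/subsetPset/ndF/leq_maxl.
      - by move: y Gky; exact/subsetPset/ndG/leq_maxr.
    by move=> [k _ []/= ? ?]; split; exists k.
  move=> k; have [? ?] := Foo k; have [? ?] := Goo k.
  split; first exact: measurableX.
  by rewrite product_measure1E// lte_mul_pinfty// ge0_fin_numE.
pose uncons (t : n.+1.-tuple R1) : R1 * n.-tuple R1 :=
  (thead t, [tuple of behead t]).
have consK : cancel (@cons_pair n) uncons.
  by case=> x t; congr pair; apply: val_inj.
have munc : measurable_fun setT uncons.
  apply/measurable_fun_pairP; split.
    exact: (measurable_tnth ord0).
  exact: measurable_behead.
exists (fun i => uncons @^-1` F i).
  by rewrite -preimage_bigcup -TF preimage_setT.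
move=> i; have [mFi Fioo] := Foo i; split.
  by rewrite -[X in measurable X]setTI; exact: munc.
rewrite /lebesgue_step /pushforward -comp_preimage.
by rewrite (_ : _ \o _ = id) //; apply/funext => z /=; exact: consK.
Qed.

HB.instance Definition _ := Measure_isSigmaFinite.Build _ _ _ lebesgue_step
  step_sigma_finite.

End step.

(* n-fold product of the Lebesgue measure of the line, on the Borel sets *)
Fixpoint borel_lebesgue (n : nat) :
    {sigma_finite_measure set (n.-tuple R1) -> \bar R} :=
  if n is k.+1 then [the {sigma_finite_measure set _ -> \bar R} of
    lebesgue_step (borel_lebesgue k)]
  else [the {sigma_finite_measure set _ -> \bar R} of \d_([tuple] : 0.-tuple R1)].

End lebesgue_tuple.

Section setting.
Context {R : realType} (n : nat).

(* R^n with its Lebesgue sigma-algebra: [(borel_lebesgue n)^*] is the Lebesgue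
   outer measure, and its Caratheodory-measurable sets are exactly the
   Lebesgue-measurable ones. *)
Definition Rn : measurableType _ :=
  caratheodory_type ((@borel_lebesgue R n)^*)%mu.

Definition leb : {measure set Rn -> \bar R} :=
  @completed_measure_extension _ _ _ (@borel_lebesgue R n).

Definition coordinate (x : Rn) (i : 'I_n) : R := tnth (x : n.-tuple R) i.

(* Euclidean distance |x - y| *)
Definition eucl_dist (x y : Rn) : R := sqrtr (\sum_(i < n) (coordinate x i - coordinate y i) ^+ 2).

(* closed cubes with sides parallel to the axes and positive side length *)
Definition is_cube (Q : set Rn) : Prop :=
  exists (a : 'I_n -> R) (l : R), 0 < l /\
    Q = [set x | forall i, a i <= coordinate x i <= a i + l].

Definition vol (Q : set Rn) : R := fine (leb Q).

Definition avg (Q : set Rn) (g : Rn -> \bar R) : \bar R :=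
  ((vol Q)^-1%:E * \int[leb]_(y in Q) g y)%E.

Definition sup_cubes (F : set Rn -> \bar R) : \bar R :=
  ereal_sup [set F Q | Q in is_cube].

Definition sup_cubes_at (x : Rn) (F : set Rn -> \bar R) : \bar R :=
  ereal_sup [set F Q | Q in [set Q | is_cube Q /\ Q x]].

(* [ess_sup] for the restriction of [leb] to [Q] *)
Definition ess_sup_in (Q : set Rn) (g : Rn -> \bar R) : \bar R :=
  ereal_inf [set y | \forall x \ae leb, Q x -> (g x <= y)%E].

Definition maximal (g : Rn -> R) (x : Rn) : \bar R :=
  sup_cubes_at x (fun Q => avg Q (fun y => `|g y|%:E)).

(* Fujii-Wilson characteristic *)
Definition Ainfty_char (u : Rn -> R) : \bar R :=
  sup_cubes (fun Q => (\int[leb]_(x in Q) maximal (fun y => u y * \1_Q y)%R x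
                       / \int[leb]_(x in Q) (u x)%:E)%E).

Section vector_valued.
Context (d : nat).
Implicit Types (W : Rn -> 'M[R]_d) (f g : Rn -> 'cV[R]_d) (p q alpha : R).

Definition enorm (v : 'cV[R]_d) : R := sqrtr (\sum_(i < d) v i 0 ^+ 2).

Definition opnorm (A : 'M[R]_d) : R := sup [set enorm (A *m v) | v in [set v | enorm v = 1]].

Definition posdef_sym (A : 'M[R]_d) : Prop :=
  A^T = A /\ forall v : 'cV[R]_d, v != 0 -> 0 < (v^T *m A *m v) 0 0.

Definition matrix_weight W : Prop :=
  (forall x, posdef_sym (W x)) /\
  (forall i j, measurable_fun [set: Rn] (fun x => W x i j)).

Definition Lp p f : Prop :=
  (forall i, measurable_fun [set: Rn] (fun x => f x i 0)) /\
  (\int[leb]_x (enorm (f x) `^ p)%:E < +oo)%E.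

(* Only meaningful where the integrals converge absolutely; elsewhere, as well
   as at the single point y = x, the integral and the integrand take library
   default values. *)
Definition riesz alpha g (x : Rn) : 'cV[R]_d :=
  \col_i (\int[leb]_y (g y i 0 / eucl_dist x y `^ (n%:R - alpha)))%R.

Definition W_riesz W alpha f (x : Rn) : 'cV[R]_d :=
  W x *m riesz alpha (fun y => invmx (W y) *m f y) x.

Definition christ_goldberg W alpha f (x : Rn) : \bar R :=
  sup_cubes_at x (fun Q => ((vol Q `^ (alpha / n%:R))%:E *
    avg Q (fun y => (enorm (W x *m (invmx (W y) *m f y)))%:E))%E).

Definition Apq_char p q W : \bar R :=
  if p == 1 then
    sup_cubes (fun Q => ess_sup_in Q (fun x =>
      avg Q (fun y => (opnorm (W y *m invmx (W x)) `^ q)%:E)))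
  else
    let p' := (1 - p^-1)^-1 in
    sup_cubes (fun Q => avg Q (fun x =>
      (avg Q (fun y => (opnorm (W x *m invmx (W y)) `^ p')%:E) `^ (q / p'))%E)).

Definition Apq p q W : Prop := (Apq_char p q W < +oo)%E.

Definition sc_Ainfty_char q W : \bar R :=
  ereal_sup [set Ainfty_char (fun x => enorm (W x *m v) `^ q)
            | v in [set v : 'cV[R]_d | v != 0]].

End vector_valued.
End setting.
Arguments Rn R n : clear implicits.
Arguments leb {R n}.

(* Main.v *)
(** Both operators are dominated pointwise, for every L > 0, by a sum over the
    scales l = L * 2^k (k an integer) of l^(alpha - n) times integrals over the
    neighbourhoods of the grid cells of side l, which have side 3l.  On such a
    cube a reducing matrix (a basis of near-maximal determinant, with Cramer's
    rule) separates the variables x and y of |W(x) W(y)^-1 f(y)|, and Hoelder's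
    inequality bounds the integral in y.  For w_v = |W v|^q a dyadic stopping
    argument gives w_v(E) <= 4 (|E|/|Q|)^delta w_v(Q) with 1/delta comparable
    to the Fujii-Wilson characteristic; sets are approximated by unions of
    dyadic cubes, so that Lebesgue differentiation is not needed.  Hence the
    integral over E of the term of scale l is at most
    C [W]^(1/q) |f|_p |E|^(1 - 1/p) l^(- n delta/q) min(l^n, |E|)^(alpha/n + delta/q),
    and the geometric series on both sides of l = L, with L^n at most |E|, sum to a
    bound on the level set with a loss of q/delta only; its q-th power is the
    factor [W^q]_Ainf^q. *)

(* Neither the operators nor their level sets are shown to be measurable. [leb] is an outer measure,
   hence monotone on all sets, so it suffices to enclose both level sets, for one well chosen [L],
   in a superlevel set of a measurable majorant [G] of the sum over the scales. Let X be the claimed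
   bound and take L^n = X. If the enclosing set had measure above X, it would contain a set E of
   finite measure e > X; integrating [G] over E then gives lambda <= lambda / 2. The decay of w_v is
   what sums the large scales: with delta = 0 each of them has the same bound |E|^(alpha/n), and the
   series diverges. The small scales converge through l^alpha alone. The case p = 1 is singled out
   only where the reducing matrix is built; elsewhere it is the value 0 of the exponent 1 - 1/p. *)
Require Import Defs.
From HB Require Import structures.
From mathcomp Require Import all_boot all_order all_algebra.
From mathcomp Require Import all_classical all_reals all_analysis.
From mathcomp Require Import perm measurable_realfun zify ring lra.
Import Order.TTheory GRing.Theory Num.Theory.
Import numFieldNormedType.Exports.
Import HBNNSimple.
Local Open Scope classical_set_scope.
Local Open Scope ring_scope.
Set Implicit Arguments.
Unset Strict Implicit.
Unset Printing Implicit Defensive.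

(** * Integration of nonnegative functions *)

Section general.
Context d (T : measurableType d) (R : realType) (mu : {measure set T -> \bar R}).
Local Open Scope ereal_scope.

(** The integral of a nonnegative function is a supremum over the simple functions below it, so
    enlarging the function only adds competitors. It serves for integrands such as [maximal] and
    [opnorm], whose measurability is never established. *)
Lemma ge0_le_integral_nomeas (D : set T) (f g : T -> \bar R) :
  (forall x, D x -> 0 <= f x) -> (forall x, D x -> f x <= g x) ->
  \int[mu]_(x in D) f x <= \int[mu]_(x in D) g x.
Proof.
move=> f0 fg.
have g0 x : D x -> 0 <= g x by move=> Dx; exact: le_trans (f0 _ Dx) (fg _ Dx).
rewrite !ge0_integralE//; apply: ereal_sup_le => _ /= [h hf <-].
exists h => // x.
apply: (le_trans (hf x)); rewrite /patch; case: ifPn => // /set_mem.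
exact: fg.
Qed.

Lemma ge0_integral_null_setD (A B : set T) (u : T -> \bar R) :
  measurable A -> measurable B -> A `<=` B -> mu (B `\` A) = 0 ->
  measurable_fun B u -> (forall x, 0 <= u x) ->
  \int[mu]_(x in B) u x = \int[mu]_(x in A) u x.
Proof.
move=> mA mB AB m0 mu_ u0; have mD := measurableD mB mA.
have EB : A `|` (B `\` A) = B by rewrite setDUK.
rewrite -{1}EB ge0_integral_setU//.
- rewrite [X in _ + X](_ : _ = 0) ?adde0//.
  by apply: null_set_integral => //; apply: measurable_funS mu_.
- by rewrite EB.
- by rewrite disj_set2E setDIK.
Qed.

Lemma integral_step (D : set T) (k : nat) (c : nat -> R) (S : nat -> set T) :
  measurable D -> (forall i, (0 <= c i)%R) -> (forall i, measurable (S i)) ->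
  (forall i, S i `<=` D) ->
  \int[mu]_(x in D) (\sum_(i < k) c i * \1_(S i) x)%R%:E =
  \sum_(i < k) (c i)%:E * mu (S i).
Proof.
move=> mD c0 mS SD; under eq_integral do rewrite -sumEFin.
rewrite ge0_integral_sum//; last 2 first.
- move=> i; apply/measurable_EFinP.
  by apply: measurable_funM; [exact: measurable_cst|exact: measurable_indic].
- by move=> i x _; rewrite lee_fin mulr_ge0.
apply: eq_bigr => i _.
under eq_integral do rewrite EFinM.
rewrite ge0_integralZl ?lee_fin//; last first.
  by apply/measurable_EFinP; exact: measurable_indic.
by rewrite integral_indic// setIidl.
Qed.

Lemma ge0_subset_integral_EFin (A B : set T) (u : T -> R) :
  measurable A -> measurable B -> measurable_fun setT u ->
  (forall x, (0 <= u x)%R) -> A `<=` B ->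
  \int[mu]_(x in A) (u x)%:E <= \int[mu]_(x in B) (u x)%:E.
Proof.
move=> mA mB mu_ u0 AB; apply: ge0_subset_integral => //.
- by apply/measurable_EFinP; exact: measurable_funTS.
- by move=> x _; rewrite lee_fin.
Qed.

Lemma ge0_integral_scale (D : set T) (u : T -> R) (c : R) :
  measurable D -> measurable_fun setT u -> (forall x, (0 <= u x)%R) ->
  (0 <= c)%R ->
  \int[mu]_(x in D) (c * u x)%:E = c%:E * \int[mu]_(x in D) (u x)%:E.
Proof.
move=> mD mu_ u0 c0; under eq_integral do rewrite EFinM.
apply: ge0_integralZl => //.
- by apply/measurable_EFinP; exact: measurable_funTS.
- by move=> x _; rewrite lee_fin.
Qed.

Lemma measure_bigsetU_le (I : Type) (s : seq I) (F : I -> set T) :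
  (forall i, measurable (F i)) ->
  mu (\big[setU/set0]_(i <- s) F i) <= \sum_(i <- s) mu (F i).
Proof.
move=> mF; elim: s => [|i s IH]; first by rewrite !big_nil measure0.
rewrite !big_cons; apply: le_trans (measureU2 _ _ _) _ => //.
  exact: bigsetU_measurable.
by rewrite leeD2l.
Qed.

Lemma integral_sum_EFin (I : finType) (D : set T) (u : I -> T -> R) :
  measurable D -> (forall i, measurable_fun setT (u i)) ->
  (forall i x, (0 <= u i x)%R) ->
  \int[mu]_(x in D) (\sum_i u i x)%R%:E = \sum_i \int[mu]_(x in D) (u i x)%:E.
Proof.
move=> mD mu_ u0; under eq_integral do rewrite -sumEFin.
rewrite ge0_integral_sum//; last 2 first.
- by move=> i; apply/measurable_EFinP; exact: measurable_funTS.
- by move=> i x _; rewrite lee_fin.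
Qed.

End general.

Section density.
Context d (T : measurableType d) (R : realType) (mu : {measure set T -> \bar R}).
Variables (u : T -> R).

(** The two proofs are arguments so that the measure structure declared below attaches to the term
    itself. *)
Definition density (mu_u : measurable_fun setT u) (u_ge0 : forall x, 0 <= u x)
  (A : set T) : \bar R := \int[mu]_(x in A) (u x)%:E.

Hypotheses (mu_u : measurable_fun setT u) (u_ge0 : forall x, 0 <= u x).

Let density0 : density mu_u u_ge0 set0 = 0%E.
Proof. by rewrite /density integral_set0. Qed.

Let density_ge0 A : (0 <= density mu_u u_ge0 A)%E.
Proof. by apply: integral_ge0 => x _; rewrite lee_fin. Qed.

Let density_sigma_additive : semi_sigma_additive (density mu_u u_ge0).
Proof.
move=> F mF tF mUF; rewrite /density ge0_integral_bigcup//; last first.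
- by move=> x _; rewrite lee_fin.
- by apply/measurable_EFinP; exact: measurable_funTS.
by apply: is_cvg_ereal_nneg_natsum => i _; apply: integral_ge0 => x _; rewrite lee_fin.
Qed.

HB.instance Definition _ := isMeasure.Build _ _ _ (density mu_u u_ge0)
  density0 density_ge0 density_sigma_additive.

Lemma density_null (N : set T) : measurable N -> mu N = 0%E ->
  density mu_u u_ge0 N = 0%E.
Proof.
move=> mN N0; apply: null_set_integral => //.
by apply/measurable_EFinP; exact: measurable_funTS.
Qed.

End density.

(** * Hoelder's inequality up to a factor 2 *)

Section interpolation.
Context (R : realType).

(** If m is the larger of [x] and [y], the product is at most m^t m^(1-t) = m. This crude form of
    Young's inequality is what costs the factor 2 below. *)
Lemma powR_interp_le (x y t : R) : 0 <= x -> 0 <= y -> 0 <= t <= 1 ->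
  x `^ t * y `^ (1 - t) <= x + y.
Proof.
move=> x0 y0 /andP[t0 t1].
have key (m : R) : 0 <= m -> m `^ t * m `^ (1 - t) = m.
  move=> m0; rewrite -powRD; last by rewrite addrC subrK oner_eq0.
  by rewrite addrC subrK powRr1.
have [xy|yx] := leP x y.
- apply: (@le_trans _ _ (y `^ t * y `^ (1 - t))).
    rewrite ler_wpM2r ?powR_ge0// ge0_ler_powR//.
  by rewrite key// lerDr.
- apply: (@le_trans _ _ (x `^ t * x `^ (1 - t))).
    by rewrite ler_wpM2l ?powR_ge0// ge0_ler_powR// ?subr_ge0//; exact: ltW.
  by rewrite key// lerDl.
Qed.

(** Dividing by [a] and [b] normalises the two factors: when [x] and [y] have integrals at most [a]
    and [b], each term on the right integrates to at most a^t b^(1-t). *)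
Lemma powR_interp_scale (x y t a b : R) : 0 <= x -> 0 <= y -> 0 <= t <= 1 ->
  0 < a -> 0 < b ->
  x `^ t * y `^ (1 - t) <=
  a `^ t * b `^ (1 - t) * (a^-1 * x) + a `^ t * b `^ (1 - t) * (b^-1 * y).
Proof.
move=> x0 y0 t01 a0 b0.
rewrite -mulrDr.
have ai : 0 <= a^-1 by rewrite invr_ge0 ltW.
have bi : 0 <= b^-1 by rewrite invr_ge0 ltW.
have -> : x `^ t * y `^ (1 - t) =
    a `^ t * b `^ (1 - t) * ((a^-1 * x) `^ t * (b^-1 * y) `^ (1 - t)).
  rewrite mulrACA -!powRM ?mulr_ge0// ?(ltW a0)// ?(ltW b0)//.
  by rewrite !mulrA !divff ?mul1r ?gt_eqF.
rewrite ler_wpM2l ?mulr_ge0 ?powR_ge0//.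
by apply: powR_interp_le => //; rewrite mulr_ge0.
Qed.

Section integral.
Context d (T : measurableType d) (mu : {measure set T -> \bar R}).
Local Open Scope ereal_scope.

Lemma integral_interp_le (D : set T) (u v : T -> R) (t a b : R) :
  measurable D -> measurable_fun D u -> measurable_fun D v ->
  (forall x, D x -> (0 <= u x)%R) -> (forall x, D x -> (0 <= v x)%R) ->
  (0 <= t <= 1)%R -> (0 < a)%R -> (0 < b)%R ->
  \int[mu]_(x in D) (u x)%:E <= a%:E -> \int[mu]_(x in D) (v x)%:E <= b%:E ->
  \int[mu]_(x in D) (u x `^ t * v x `^ (1 - t))%:E <=
    (2 * (a `^ t * b `^ (1 - t)))%:E.
Proof.
move=> mD mu_ mv u0 v0 t01 a0 b0 ua vb.
set c := (a `^ t * b `^ (1 - t))%R.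
have c0 : (0 <= c)%R by rewrite mulr_ge0 ?powR_ge0.
have ca : (0 <= c / a)%R by apply: divr_ge0 => //; exact: ltW.
have cb : (0 <= c / b)%R by apply: divr_ge0 => //; exact: ltW.
have -> : (2 * c)%:E = (c * (a^-1))%:E * a%:E + (c * b^-1)%:E * b%:E.
  rewrite -!EFinM -EFinD -!mulrA !mulVf ?gt_eqF// mulr1.
  by congr EFin; rewrite mulr2n mulrDl mul1r.
apply: (@le_trans _ _ (\int[mu]_(x in D)
   ((c * a^-1)%:E * (u x)%:E + (c * b^-1)%:E * (v x)%:E))).
  apply: ge0_le_integral_nomeas => x Dx.
    by rewrite lee_fin mulr_ge0 ?powR_ge0.
  rewrite -!EFinM -EFinD lee_fin -!(mulrA c).
  exact: powR_interp_scale (u0 _ Dx) (v0 _ Dx) t01 a0 b0.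
have cu x : D x -> 0 <= (c * a^-1)%:E * (u x)%:E.
  by move=> Dx; rewrite -EFinM lee_fin; apply: mulr_ge0 => //; exact: u0.
have cv x : D x -> 0 <= (c * b^-1)%:E * (v x)%:E.
  by move=> Dx; rewrite -EFinM lee_fin; apply: mulr_ge0 => //; exact: v0.
rewrite ge0_integralD//; [|by apply: measurable_funeM; exact/measurable_EFinP..].
rewrite !ge0_integralZl//; [|exact/measurable_EFinP..].
by apply: leeD; apply: lee_wpmul2l.
Qed.

(** The value [t = 0] is allowed: it occurs as 1 - 1/p for p = 1, so that the summation over the
    cells treats the endpoint with the other cases. *)
Lemma nneseries_interp_le (u v : nat -> R) (t a b : R) :
  (forall j, (0 <= u j)%R) -> (forall j, (0 <= v j)%R) ->
  (0 <= t <= 1)%R -> (0 < a)%R -> (0 < b)%R ->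
  \sum_(0 <= j <oo) (u j)%:E <= a%:E -> \sum_(0 <= j <oo) (v j)%:E <= b%:E ->
  \sum_(0 <= j <oo) (u j `^ t * v j `^ (1 - t))%:E <=
    (2 * (a `^ t * b `^ (1 - t)))%:E.
Proof.
move=> u0 v0 t01 a0 b0 ua vb.
set c := (a `^ t * b `^ (1 - t))%R.
have c0 : (0 <= c)%R by rewrite mulr_ge0 ?powR_ge0.
have ca : (0 <= c / a)%R by apply: divr_ge0 => //; exact: ltW.
have cb : (0 <= c / b)%R by apply: divr_ge0 => //; exact: ltW.
have -> : (2 * c)%:E = (c * (a^-1))%:E * a%:E + (c * b^-1)%:E * b%:E.
  rewrite -!EFinM -EFinD -!mulrA !mulVf ?gt_eqF// mulr1.
  by congr EFin; rewrite mulr2n mulrDl mul1r.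
apply: (@le_trans _ _ (\sum_(0 <= j <oo)
   ((c * a^-1)%:E * (u j)%:E + (c * b^-1)%:E * (v j)%:E))).
  apply: lee_nneseries => j _.
    by rewrite lee_fin mulr_ge0 ?powR_ge0.
  rewrite -!EFinM -EFinD lee_fin -!(mulrA c).
  exact: powR_interp_scale (u0 j) (v0 j) t01 a0 b0.
rewrite nneseriesD//; last 2 first.
- by move=> i _ _; rewrite -EFinM lee_fin; exact: mulr_ge0.
- by move=> i _ _; rewrite -EFinM lee_fin; exact: mulr_ge0.
rewrite !nneseriesZl//; last 2 first.
- by move=> i _; rewrite lee_fin.
- by move=> i _; rewrite lee_fin.
by apply: leeD; apply: lee_wpmul2l.
Qed.

End integral.
End interpolation.

(** * Geometric series and dyadic scales *)

Section series.
Context (R : realType).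

Lemma nneseries_geometric_le (c r : R) : 0 <= c -> 0 <= r -> r < 1 ->
  (\sum_(0 <= i <oo) (c * r ^+ i)%:E <= (c / (1 - r))%:E)%E.
Proof.
move=> c0 r0 r1; have r10 : 0 < 1 - r by rewrite subr_gt0.
apply: lime_le.
  by apply: is_cvg_nneseries => i _ _; rewrite lee_fin mulr_ge0// exprn_ge0.
apply: nearW => k; rewrite sumEFin lee_fin ler_pdivlMr//.
suff -> : (\sum_(0 <= i < k) c * r ^+ i) * (1 - r) = c * (1 - r ^+ k).
  by rewrite ler_piMr// lerBlDr lerDl exprn_ge0.
elim: k => [|k IH]; first by rewrite big_nil expr0 subrr mulr0 mul0r.
by rewrite big_nat_recr//= mulrDl IH exprS; ring.
Qed.

Lemma nneseries_ge_term (u : nat -> \bar R) (j : nat) :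
  (forall i, 0 <= u i)%E -> (u j <= \sum_(0 <= i <oo) u i)%E.
Proof.
move=> u0; apply: (@le_trans _ _ (\sum_(0 <= i < j.+1) u i)%E).
  by rewrite big_nat_recr//= leeDr// sume_ge0.
by apply: nneseries_lim_ge => i _ _.
Qed.

(** From ln 2 >= 1/2 one gets 2^t >= 1 + t/2. The geometric series of ratio 2^(-t) therefore costs
    at most 3/t, which is the linear loss in the inverse decay exponent. *)
Lemma one_sub_powR2N_ge (t : R) : 0 < t <= 1 -> t / 3 <= 1 - 2 `^ (- t).
Proof.
move=> /andP[t0 t1].
have ln2 : 2^-1 <= ln 2 :> R.
  have := @le_ln1Dx R (- 2^-1) _.
  have -> : 1 + - 2^-1 = 2^-1 :> R by lra.
  by rewrite lnV ?posrE//; lra.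
have h : 1 + t / 2 <= 2 `^ t.
  rewrite /powR (_ : (2 == 0 :> R) = false); last by apply/negbTE.
  apply: le_trans (expR_ge1Dx _); rewrite lerD2l ler_wpM2l ?(ltW t0)//.
have p0 : 0 < 1 + t / 2 by lra.
have : 2 `^ (- t) <= (1 + t / 2)^-1.
  by rewrite powRN lef_pV2 ?posrE// powR_gt0.
suff : (1 + t / 2)^-1 <= 1 - t / 3 by lra.
by rewrite -div1r ler_pdivrMr//; nra.
Qed.

Lemma powR_exprn (x t : R) i : 0 <= x -> (x ^+ i) `^ t = (x `^ t) ^+ i.
Proof.
by move=> x0; rewrite -[RHS]powR_mulrn ?powR_ge0// -powR_mulrn// -!powRrM mulrC.
Qed.

Lemma powRV (x t : R) : 0 <= x -> x^-1 `^ t = (x `^ t)^-1.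
Proof. by move=> x0; rewrite -powR_inv1// -powRrM mulN1r powRN. Qed.

(** Upward scales start at exponent 0 and downward ones at 1, so that the two families together list
    every L * 2^k, k an integer, exactly once. *)
Lemma dyadic_scale (L D : R) : 0 < L -> 0 < D -> exists i : nat,
  (L * 2 ^+ i / 2 < D <= L * 2 ^+ i) \/ (L / 2 ^+ i.+1 / 2 < D <= L / 2 ^+ i.+1).
Proof.
move=> L0 D0.
have big (x y : R) : 0 < x -> exists i : nat, y < x * 2 ^+ i.
  move=> x0; exists (Num.truncn (y / x)).+1.
  rewrite mulrC -ltr_pdivrMr//; apply: lt_trans (truncnS_gt _) _.
  by rewrite -natrX ltr_nat ltn_expl.
have p2 i : 0 < 2 ^+ i :> R by rewrite exprn_gt0.
have [DL|LD] := leP D L.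
- have ex : exists i, L < D * 2 ^+ i.+1.
    have [i hi] := big D L D0; exists i; apply: lt_trans hi _.
    by rewrite ltr_pM2l// exprS ltr_pMl// ltr1n.
  have [[|i] hi imin] := ex_minnP ex.
    exists 0%N; left; rewrite expr0 mulr1 DL andbT ltr_pdivrMr//.
  exists i; right; apply/andP; split.
    by rewrite -mulrA -invfM -exprSr ltr_pdivrMr.
  by rewrite ler_pdivlMr// leNgt; apply/negP => /imin; rewrite ltnn.
- have ex : exists i, D <= L * 2 ^+ i.
    by have [i hi] := big L D L0; exists i; exact: ltW.
  have [[|i] hi imin] := ex_minnP ex.
    by move: hi; rewrite expr0 mulr1 leNgt LD.
  exists i.+1; left; rewrite hi andbT exprSr mulrA mulfK//.
  by rewrite ltNge; apply/negP => /imin; rewrite ltnn.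
Qed.

(** The dominating index depends on [y]; bounding that one term by the whole sum avoids choosing the
    index measurably. *)
Lemma integral_le_two_series d (T : measurableType d) (mu : {measure set T -> \bar R})
    (phi : T -> R) (h h' : nat -> T -> R) :
  (forall y, 0 <= phi y) ->
  (forall i, measurable_fun setT (h i)) -> (forall i y, 0 <= h i y) ->
  (forall i, measurable_fun setT (h' i)) -> (forall i y, 0 <= h' i y) ->
  (forall y, exists i, phi y <= h i y \/ phi y <= h' i y) ->
  (\int[mu]_y (phi y)%:E <=
   \sum_(0 <= i <oo) (\int[mu]_y (h i y)%:E + \int[mu]_y (h' i y)%:E))%E.
Proof.
move=> phi0 mh h0 mh' h0' dom.
have mhE i : measurable_fun setT (fun y => (h i y)%:E) by exact/measurable_EFinP.
have mhE' i : measurable_fun setT (fun y => (h' i y)%:E) by exact/measurable_EFinP.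
have s0 i y : (0 <= (h i y)%:E + (h' i y)%:E)%E by rewrite adde_ge0// lee_fin.
apply: (@le_trans _ _ (\int[mu]_y (\sum_(0 <= i <oo) ((h i y)%:E + (h' i y)%:E)))%E).
  apply: ge0_le_integral_nomeas => y _; first by rewrite lee_fin.
  have [i hi] := dom y.
  apply: le_trans (nneseries_ge_term i (s0 ^~ y)).
  rewrite -EFinD lee_fin; case: hi => hi; apply: le_trans hi _.
    by rewrite lerDl.
  by rewrite lerDr.
rewrite integral_nneseries//; last by move=> i; exact: emeasurable_funD.
apply: lee_nneseries => i _; first by move=> _; apply: integral_ge0 => y _.
by rewrite ge0_integralD// => y _; rewrite lee_fin.
Qed.

Lemma integral_indicM d (T : measurableType d) (mu : {measure set T -> \bar R})
    (N : set T) (k : T -> R) :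
  (\int[mu]_y (\1_N y * k y)%:E = \int[mu]_(y in N) (k y)%:E)%E.
Proof.
rewrite [RHS]integral_mkcond; apply: eq_integral => y _.
by rewrite /patch indicE; case: ifP => _; rewrite ?mul1r ?mul0r.
Qed.

End series.

(** * Boxes, cubes and grids *)

Section boxes.
Context (R : realType).
Local Notation R1 := (measurableTypeR R).

Definition box n (I : 'I_n -> set R) : set (Rn R n) :=
  [set x | forall i, I i (coordinate x i)].

Lemma measurable_tuple_box n (I : 'I_n -> set R) :
  (forall i, measurable (I i : set R1)) ->
  measurable (box I : set (n.-tuple R1)).
Proof.
move=> mI.
rewrite (_ : (box I : set (n.-tuple R1)) =
   \bigcap_(i in [set: 'I_n]) ((fun t : n.-tuple R1 => tnth t i) @^-1` I i)).
  apply: fin_bigcap_measurable => // i _.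
  rewrite -[X in measurable X]setTI.
  exact: (measurable_tnth i).
by apply/seteqP; split => [x /= h i _|x /= h i]; [exact: h|exact: h].
Qed.

Lemma borel_lebesgue_box n (I : 'I_n -> set R) (l : 'I_n -> R) :
  (forall i, measurable (I i : set R1)) ->
  (forall i, @lebesgue_measure R (I i) = (l i)%:E) ->
  borel_lebesgue n (box I) = (\prod_(i < n) l i)%:E.
Proof.
elim: n I l => [|n IH] I l mI lI.
  rewrite big_ord0 /= diracE mem_set//.
  by case.
rewrite big_ord_recl /= /lebesgue_step /pushforward.
pose J (i : 'I_n) := I (lift ord0 i).
have -> : @cons_pair R n @^-1` box I = I ord0 `*` (box J : set (n.-tuple R1)).
  apply/seteqP; split=> -[x t] /=.
  - move=> h; split; first by have := h ord0; rewrite /coordinate (tnth_nth 0).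
    move=> i; have := h (lift ord0 i).
    by rewrite /coordinate !(tnth_nth 0) /=.
  - move=> [h1 h2] i; case: (unliftP ord0 i) => [j ->|->].
      by have := h2 j; rewrite /coordinate !(tnth_nth 0) /=.
    by rewrite /coordinate (tnth_nth 0).
rewrite product_measure1E//; last by apply: measurable_tuple_box => i; exact: mI.
rewrite (IH J (fun i => l (lift ord0 i)))//; last 2 first.
- by move=> i; exact: mI.
- by move=> i; exact: lI.
by rewrite EFinM; congr (_ * _)%E; exact: lI.
Qed.

Section fixed_dim.
Context (n : nat).
Implicit Types (a : 'I_n -> R) (l : R) (x : Rn R n).
Local Notation Rn := (Rn R n).

(** Half-open cubes tile space and split into disjoint children, whereas the cubes of the statement
    are closed. By [leb_ccubeD] the two kinds differ by a null set. *)
Definition hcube a l : set Rn := box (fun i => `[a i, a i + l[%classic).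
Definition ccube a l : set Rn := box (fun i => `[a i, a i + l]%classic).

Lemma borel_measurable_Rn (A : set (n.-tuple R1)) : measurable A ->
  measurable (A : set Rn).
Proof. by move=> mA; apply: (@sub_caratheodory _ _ _ (@borel_lebesgue R n) A); apply: sub_sigma_algebra. Qed.

Lemma leb_borel (A : set (n.-tuple R1)) : measurable A ->
  leb (A : set Rn) = borel_lebesgue n A.
Proof. by move=> mA; exact: measurable_mu_extE. Qed.

(** [leb] is the outer measure itself, so it is monotone on arbitrary sets. This gives access to the
    level sets of the two operators. *)
Lemma le_leb (A B : set Rn) : A `<=` B -> (leb A <= leb B)%E.
Proof. by move=> AB; apply: le_outer_measure. Qed.

Lemma measurable_hcube a l : measurable (hcube a l).
Proof.
by apply: borel_measurable_Rn; apply: measurable_tuple_box => i.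
Qed.

Lemma measurable_ccube a l : measurable (ccube a l).
Proof.
by apply: borel_measurable_Rn; apply: measurable_tuple_box => i.
Qed.

Lemma leb_hcube a l : 0 <= l -> leb (hcube a l) = (l ^+ n)%:E.
Proof.
move=> l0; rewrite leb_borel; last by apply: measurable_tuple_box => i.
rewrite (@borel_lebesgue_box _ _ (fun=> l))//.
  by rewrite prodr_const card_ord.
move=> i; apply: etrans; [exact: lebesgue_measure_itv|].
rewrite /= lte_fin ltrDl lt_neqAle l0 andbT; case: eqVneq => [<-|_] //=.
by rewrite -EFinD addrAC subrr add0r.
Qed.

Lemma leb_ccube a l : 0 <= l -> leb (ccube a l) = (l ^+ n)%:E.
Proof.
move=> l0; rewrite leb_borel; last by apply: measurable_tuple_box => i.
rewrite (@borel_lebesgue_box _ _ (fun=> l))//.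
  by rewrite prodr_const card_ord.
move=> i; apply: etrans; [exact: lebesgue_measure_itv|].
rewrite /= lte_fin ltrDl lt_neqAle l0 andbT; case: eqVneq => [<-|_] //=.
by rewrite -EFinD addrAC subrr add0r.
Qed.

Lemma is_cubeP (Q : set Rn) :
  is_cube Q <-> exists a l, 0 < l /\ Q = ccube a l.
Proof.
by split=> -[a [l [l0 ->]]]; exists a, l; split => //; apply/seteqP;
  split => x /= h i; have := h i; rewrite /= in_itv.
Qed.

Lemma is_cube_ccube a l : 0 < l -> is_cube (ccube a l).
Proof. by move=> l0; apply/is_cubeP; exists a, l. Qed.

Lemma vol_ccube a l : 0 <= l -> vol (ccube a l) = l ^+ n.
Proof. by move=> l0; rewrite /vol leb_ccube. Qed.

Lemma hcube_sub_ccube a l : hcube a l `<=` ccube a l.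
Proof.
by move=> x h i; have := h i; rewrite /= !in_itv/= => /andP[-> /ltW].
Qed.

Lemma leb_ccubeD a l : 0 <= l -> leb (ccube a l `\` hcube a l) = 0%E.
Proof.
move=> l0; have fin : (leb (ccube a l) < +oo)%E by rewrite leb_ccube// ltry.
apply: etrans.
  exact: (measureD (measurable_ccube a l) (measurable_hcube a l) fin).
rewrite setIidr; last exact: hcube_sub_ccube.
by rewrite [X in (X - _)%E]leb_ccube// [X in (_ - X)%E]leb_hcube// subee.
Qed.

End fixed_dim.
End boxes.

Section grid.
Context (R : realType) (n : nat).
Local Notation Rn := (Rn R n).
Implicit Types (l : R) (z : {ffun 'I_n -> int}) (x y : Rn).

Definition cell l z : set Rn := hcube (fun i => l * (z i)%:~R) l.

Definition neighbourhood_corner l z : 'I_n -> R := fun i => l * ((z i)%:~R - 1).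

(** The closed cube concentric with the cell and three times as large; it contains every point
    within distance [l] of the cell in the maximum norm. *)
Definition neighbourhood l z : set Rn := ccube (neighbourhood_corner l z) (3 * l).

Definition cell_index l x : {ffun 'I_n -> int} :=
  [ffun i => Num.floor (coordinate x i / l)].

Lemma cell_sub_hcube l z : 0 < l ->
  cell l z `<=` hcube (neighbourhood_corner l z) (3 * l).
Proof.
move=> l0 x h i; have := h i; rewrite /= !in_itv /= /neighbourhood_corner.
by move=> /andP[h1 h2]; apply/andP; split; lra.
Qed.

Lemma in_cellP l x z : 0 < l -> cell l z x <-> z = cell_index l x.
Proof.
move=> l0; split.
  move=> h; apply/ffunP => i; rewrite ffunE; apply/esym/floor_def.
  have := h i; rewrite /= in_itv /= => /andP[h1 h2].
  rewrite ler_pdivlMr// ltr_pdivrMr// intrD mulrC h1/=; lra.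
move=> -> i; rewrite /= in_itv /= ffunE.
have /andP := floor_itv (coordinate x i / l).
rewrite ler_pdivlMr// ltr_pdivrMr// intrD => -[h1 h2].
by apply/andP; split; lra.
Qed.

Lemma cell_close l z x y : 0 < l -> cell l z x ->
  (forall i, `|coordinate x i - coordinate y i| <= l) -> neighbourhood l z y.
Proof.
move=> l0 h xy i; have := h i; have := xy i.
rewrite ler_norml /= !in_itv /= /neighbourhood_corner.
by move=> /andP[h1 h2] /andP[h3 h4]; apply/andP; split; lra.
Qed.

(** Shifts by -1, 0, 1 and 2 in each coordinate. The fourth value is due to the closed upper faces
    of the neighbourhood, whose points lie in cells of index [z i + 2]. *)
Definition shift_index z (m : {ffun 'I_n -> 'I_4}) : {ffun 'I_n -> int} :=
  [ffun i => z i + (m i : nat)%:Z - 1].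

Lemma shift_index_inj m : injective (shift_index^~ m).
Proof.
move=> z z' /ffunP h; apply/ffunP => i; have := h i; rewrite !ffunE.
by move/addIr/addIr.
Qed.

Lemma neighbourhood_cover l z y : 0 < l -> neighbourhood l z y ->
  exists m, cell l (shift_index z m) y.
Proof.
move=> l0 h.
pose w i := absz (Num.floor (coordinate y i / l) - z i + 1)%R.
have hw i : (w i < 4)%N /\ (w i)%:Z = Num.floor (coordinate y i / l) - z i + 1.
  have := h i; rewrite /= in_itv /= /neighbourhood_corner => /andP[h1 h2].
  have /andP[f1 f2] := floor_itv (coordinate y i / l).
  have k1 : z i - 1 <= Num.floor (coordinate y i / l).
    by rewrite floor_ge_int ler_pdivlMr// intrB mulrC.
  have k2 : Num.floor (coordinate y i / l) <= z i + 2.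
    rewrite -ltzD1 floor_lt_int ltr_pdivrMr// !intrD mulrC.
    by apply: le_lt_trans h2 _; lra.
  have w0 : 0 <= Num.floor (coordinate y i / l) - z i + 1 by lia.
  have e : (w i)%:Z = Num.floor (coordinate y i / l) - z i + 1.
    by rewrite /w gez0_abs.
  by split => //; rewrite -ltz_nat e; lia.
exists [ffun i => inord (w i)]; apply/in_cellP => //.
apply/ffunP => i; rewrite !ffunE inordK ?(hw i).1// (hw i).2; ring.
Qed.

Section enumeration.
Variable l : R.
Hypothesis l0 : 0 < l.
Local Notation index := {ffun 'I_n -> int}.

(** Cells are listed along the natural numbers, so that sums over them are series. [pickle_inv]
    returns [None] at a number that encodes no index, and the cell is then empty. *)
Definition nth_cell (j : nat) : set Rn :=
  if (pickle_inv j : option index) is Some z then cell l z else set0.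

Lemma measurable_nth_cell j : measurable (nth_cell j).
Proof.
rewrite /nth_cell; case: pickle_inv => [z|]; [exact: measurable_hcube|exact: measurable0].
Qed.

Lemma pickle_inv_uniq (i j : nat) (z : index) :
  pickle_inv i = Some z -> pickle_inv j = Some z -> i = j.
Proof.
move=> hi hj; have := @pickle_invK index i; have := @pickle_invK index j.
by rewrite hi hj /= => <- <-.
Qed.

Lemma trivIset_shifted_cells (s : index -> index) : injective s ->
  trivIset setT (fun j => if (pickle_inv j : option index) is Some z
                          then cell l (s z) else set0).
Proof.
move=> sinj i j _ _ [x []].
case Ei : (pickle_inv i) => [z|//]; case Ej : (pickle_inv j) => [z'|//].
move=> /(in_cellP _ _ l0) h /(in_cellP _ _ l0); rewrite -h => /sinj ezz.
by apply: pickle_inv_uniq Ei _; rewrite Ej ezz.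
Qed.

Lemma trivIset_nth_cell : trivIset setT nth_cell.
Proof. exact: (@trivIset_shifted_cells id). Qed.

Lemma nth_cell_index x : exists j,
  (pickle_inv j : option index) = Some (cell_index l x) /\ nth_cell j x.
Proof.
exists (pickle (cell_index l x)); rewrite /nth_cell pickleK_inv; split => //.
exact/in_cellP.
Qed.

(** Each neighbourhood is covered by its 4^n shifted cells. For a fixed shift these are pairwise
    disjoint as the index varies, so each shift contributes at most [nu setT]. *)
Lemma neighbourhood_overlap (nu : {measure set Rn -> \bar R}) :
  (\sum_(0 <= j <oo) (if (pickle_inv j : option index) is Some z
     then nu (neighbourhood l z) else 0) <= (4 ^ n)%:R%:E * nu setT)%E.
Proof.
pose c j m := if (pickle_inv j : option index) is Some z
              then cell l (shift_index z m) else set0.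
have mc j m : measurable (c j m).
  rewrite /c; case: pickle_inv => [z|]; [exact: measurable_hcube|exact: measurable0].
apply: (@le_trans _ _ (\sum_(0 <= j <oo) \sum_(m : {ffun 'I_n -> 'I_4}) nu (c j m))%E).
  apply: lee_nneseries => j _.
    by case: pickle_inv => [z|] //; rewrite measure_ge0.
  rewrite /c; case Ej : (pickle_inv j) => [z|]; last by rewrite sume_ge0.
  apply: le_trans (measure_bigsetU_le nu (index_enum _) (fun m => measurable_hcube _ _)).
  apply: le_measure; rewrite ?inE.
  - exact: measurable_ccube.
  - by apply: bigsetU_measurable => m _; exact: measurable_hcube.
  - move=> y /(neighbourhood_cover l0)[m ym].
    by rewrite (bigD1 m)//=; left.
rewrite nneseries_sum; last by move=> *; exact: measure_ge0.
apply: (@le_trans _ _ (\sum_(m : {ffun 'I_n -> 'I_4}) nu setT)%E).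
  apply: lee_sum => m _.
  have tc : trivIset setT (c ^~ m).
    by apply: (@trivIset_shifted_cells (shift_index^~ m)); exact: shift_index_inj.
  rewrite (cvg_lim _ (measure_sigma_additive (mc ^~ m) tc))//.
  apply: le_measure; rewrite ?inE//; last exact: bigcupT_measurable.
have -> : (4 ^ n)%:R = \sum_(m : {ffun 'I_n -> 'I_4}) (1 : R).
  by rewrite sumr_const card_ffun !card_ord.
rewrite -sumEFin ge0_sume_distrl//.
by apply: lee_sum => m _; rewrite mul1e.
Qed.

End enumeration.

End grid.

(** * Dyadic stopping and the decay of an A-infinity weight *)

Section dyadic.
Context (R : realType) (n : nat).
Local Notation Rn := (Rn R n).
Implicit Types (a : 'I_n -> R) (l t : R) (b : {ffun 'I_n -> bool}) (D : set Rn).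

Definition child_corner a l b : 'I_n -> R := fun i => a i + (b i)%:R * (l / 2).

Lemma child_sub a l b : 0 < l -> hcube (child_corner a l b) (l / 2) `<=` hcube a l.
Proof.
move=> l0 x h i; have := h i; rewrite /= !in_itv /= /child_corner.
by case: (b i) => /= /andP[h1 h2]; apply/andP; split; lra.
Qed.

Lemma hcube_children a l x : 0 < l -> hcube a l x ->
  exists b, hcube (child_corner a l b) (l / 2) x.
Proof.
move=> l0 h; exists [ffun i => a i + l / 2 <= coordinate x i] => i.
have := h i; rewrite /= !in_itv /= /child_corner ffunE.
by case: (leP (a i + l / 2)) => /= ? /andP[h1 h2]; apply/andP; split; lra.
Qed.

Lemma child_inj a l b b' x : 0 < l ->
  hcube (child_corner a l b) (l / 2) x ->
  hcube (child_corner a l b') (l / 2) x -> b = b'.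
Proof.
move=> l0 h h'; apply/ffunP => i; have := h i; have := h' i.
rewrite /= !in_itv /= /child_corner.
by case: (b i); case: (b' i) => //= /andP[h1 h2] /andP[h3 h4]; exfalso; lra.
Qed.

(** The stopping argument uses only finite additivity. It runs in real arithmetic, with [m] and [U]
    the restrictions of Lebesgue measure and of the weight to one fixed cube, where both are
    finite. *)
Definition finadd (m : set Rn -> R) :=
  (forall A, measurable A -> 0 <= m A) /\
  (forall A B, measurable A -> measurable B -> A `&` B = set0 ->
    m (A `|` B) = m A + m B).

Section finadd_theory.
Variables (m : set Rn -> R).
Hypothesis fm : finadd m.

Lemma finadd0 : m set0 = 0.
Proof.
have := fm.2 set0 set0 measurable0 measurable0 (setI0 _).
by rewrite setU0 => h; apply: (addrI (m set0)); rewrite addr0 -h.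
Qed.

Lemma finadd_le A B : measurable A -> measurable B -> A `<=` B -> m A <= m B.
Proof.
move=> mA mB AB; rewrite -(setDUK AB) fm.2//; last by rewrite setDIK.
  by rewrite lerDl fm.1//; exact: measurableD.
exact: measurableD.
Qed.

Lemma finaddD A B : measurable A -> measurable B -> m A <= m (A `\` B) + m B.
Proof.
move=> mA mB; have mD := measurableD mA mB.
rewrite -fm.2//; last by rewrite setIC setDIK.
apply: finadd_le => //; first exact: measurableU.
by move=> x Ax; have [Bx|Bx] := pselect (B x); [right|left].
Qed.

Lemma finadd_bigsetU (I : choiceType) (s : seq I) (F : I -> set Rn) : uniq s ->
  (forall i, measurable (F i)) -> trivIset setT F ->
  m (\big[setU/set0]_(i <- s) F i) = \sum_(i <- s) m (F i).
Proof.
move=> us mF tF; elim: s us => [|i s IH] /=; first by rewrite !big_nil finadd0.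
move=> /andP[si us]; rewrite !big_cons fm.2//.
- by rewrite IH.
- by apply: bigsetU_measurable.
apply/seteqP; split => // x [Fi]; rewrite -bigcup_seq => -[j /= js Fj].
have ij : i = j by apply: tF => //; exists x.
by move: si; rewrite ij js.
Qed.

Lemma finadd_children a l (F : {ffun 'I_n -> bool} -> set Rn) : 0 < l ->
  (forall b, measurable (F b)) ->
  (forall b, F b `<=` hcube (child_corner a l b) (l / 2)) ->
  m (\bigcup_b F b) = \sum_b m (F b).
Proof.
move=> l0 mF sF; rewrite -big_enum -finadd_bigsetU ?enum_uniq//.
  rewrite -bigcup_seq; congr (m _); apply: eq_bigcupl.
  by split => // b _ /=; rewrite mem_enum.
move=> b b' _ _ [x [xb xb']].
exact: (child_inj l0 (sF _ _ xb) (sF _ _ xb')).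
Qed.

Lemma finadd_split a l A : 0 < l -> measurable A -> A `<=` hcube a l ->
  m A = \sum_b m (A `&` hcube (child_corner a l b) (l / 2)).
Proof.
move=> l0 mA sA; rewrite -(@finadd_children a l)//; last first.
  by move=> b; apply: measurableI => //; exact: measurable_hcube.
congr (m _); apply/seteqP; split => x.
  by move=> Ax; have [b xb] := hcube_children l0 (sA _ Ax); exists b.
by move=> [b _ []].
Qed.

End finadd_theory.

Section stopping.
Variables (m U : set Rn -> R) (a0 : 'I_n -> R) (l0 : R) (K : R).
Hypotheses (fm : finadd m) (fU : finadd U) (K0 : 0 < K).
Hypothesis m_hcube : forall a l, 0 < l -> hcube a l `<=` hcube a0 l0 ->
  m (hcube a l) = l ^+ n.
(** A finitary Fujii-Wilson condition: a step function lying below the local maximal function of [U]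
    stands in for that function, so that no integral enters the stopping argument. *)
Hypothesis FW : forall a l, 0 < l -> hcube a l `<=` hcube a0 l0 ->
  forall (k : nat) (c : nat -> R) (S : nat -> set Rn),
  (forall i, 0 <= c i) -> (forall i, measurable (S i)) ->
  (forall i, S i `<=` hcube a l) ->
  (forall x, hcube a l x -> exists a' l',
    [/\ 0 < l', hcube a' l' `<=` hcube a l, hcube a' l' x &
        \sum_(i < k) c i * \1_(S i) x <= U (hcube a' l') / l' ^+ n]) ->
  \sum_(i < k) c i * m (S i) <= K * U (hcube a l).

(** A Calderon-Zygmund decomposition truncated at depth [N]: the union of the maximal dyadic
    subcubes, down to generation [N], on which the average of [U] exceeds [t]. *)
Fixpoint stop (N : nat) a l t : set Rn :=
  if t * l ^+ n < U (hcube a l) then hcube a l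
  else if N is N'.+1 then
    \bigcup_b stop N' (child_corner a l b) (l / 2) t else set0.

Lemma half_gt0 l : 0 < l -> 0 < l / 2. Proof. by move=> ?; lra. Qed.

Lemma measurable_stop N a l t : measurable (stop N a l t).
Proof.
elim: N a l => [|N IH] a l /=; case: ifP => _ //; try exact: measurable_hcube.
by apply: fin_bigcup_measurable => // b _.
Qed.

Lemma stop_sub N a l t : 0 < l -> stop N a l t `<=` hcube a l.
Proof.
elim: N a l => [|N IH] a l lp /=; case: ifP => _ //.
move=> x [b _ /IH h]; apply: (@child_sub a l b lp); apply: h.
exact: half_gt0.
Qed.

Lemma stop_cube N a l t x : 0 < l -> stop N a l t x ->
  exists a' l', [/\ 0 < l', hcube a' l' `<=` hcube a l, hcube a' l' x &
    t < U (hcube a' l') / l' ^+ n].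
Proof.
elim: N a l => [|N IH] a l lp /=; case: ifP => // tU.
- by move=> h; exists a, l; split => //; rewrite ltr_pdivlMr ?exprn_gt0.
- by move=> h; exists a, l; split => //; rewrite ltr_pdivlMr ?exprn_gt0.
move=> [b _ /IH[|a' [l' [l'0 s h1 h2]]]]; first exact: half_gt0.
by exists a', l'; split => //; apply: (subset_trans s); exact: child_sub.
Qed.

Lemma U_ge0 a l : 0 <= U (hcube a l).
Proof. by apply: fU.1; exact: measurable_hcube. Qed.

Lemma child_vol l : (l / 2) ^+ n = l ^+ n / 2 ^+ n.
Proof. by rewrite expr_div_n. Qed.

(** The child keeps at most the mass of its parent and has 2^n times less volume. *)
Lemma child_bound a l b t : 0 < l -> U (hcube a l) <= t * l ^+ n ->
  U (hcube (child_corner a l b) (l / 2)) <= 2 ^+ n * t * (l / 2) ^+ n.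
Proof.
move=> lp h; apply: (@le_trans _ _ (U (hcube a l))).
  by apply: finadd_le => //; try exact: measurable_hcube; exact: child_sub.
rewrite child_vol (le_trans h)// le_eqVlt; apply/orP; left; apply/eqP.
by rewrite -mulrA mulrCA mulrA -mulrA; congr (_ * _);
  rewrite mulrCA divff ?mulr1// expf_neq0.
Qed.

(** A selected cube has an unselected parent, so its average is at most 2^n t by [child_bound]. The
    hypothesis on [U (hcube a l)] plays this role for the top cube, which has no parent. *)
Lemma stop_density N a l t : 0 <= t -> 0 < l -> hcube a l `<=` hcube a0 l0 ->
  U (hcube a l) <= 2 ^+ n * t * l ^+ n ->
  U (stop N a l t) <= 2 ^+ n * t * m (stop N a l t).
Proof.
move=> t0; elim: N a l => [|N IH] a l lp sa Ua /=; case: ltP => h.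
- by rewrite m_hcube.
- by rewrite finadd0// finadd0// mulr0.
- by rewrite m_hcube.
have lp2 := half_gt0 lp.
rewrite !(@finadd_children _ _ a l)//; last 4 first.
- by move=> b; exact: measurable_stop.
- by move=> b; exact: stop_sub.
- by move=> b; exact: measurable_stop.
- by move=> b; exact: stop_sub.
rewrite mulr_sumr; apply: ler_sum => b _; apply: IH => //.
  by apply: subset_trans sa; exact: child_sub.
exact: child_bound.
Qed.

Lemma stop_mono N a l t t' : 0 < l -> t <= t' -> stop N a l t' `<=` stop N a l t.
Proof.
move=> lp tt'; elim: N a l lp => [|N IH] a l lp /=; case: (ltP (t' * l ^+ n)) => h.
- have h' : t * l ^+ n < U (hcube a l).
    by apply: le_lt_trans h; rewrite ler_pM2r// exprn_gt0.
  by rewrite h'; exact: subset_refl.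
- exact: sub0set.
- have h' : t * l ^+ n < U (hcube a l).
    by apply: le_lt_trans h; rewrite ler_pM2r// exprn_gt0.
  by rewrite h'; exact: subset_refl.
case: ifP => h'.
  move=> x [b _ /stop_sub xb]; apply: (@child_sub a l b lp); apply: xb.
  exact: half_gt0.
by apply: subset_bigcup => b _; apply: IH; exact: half_gt0.
Qed.

(** It has two roles: as the ratio of consecutive levels, where [2 <= A] keeps the sum of the halved
    levels below the last level, and as the constant 2 * 2^n lost when [U] is compared with [m] on
    the layers. *)
Let A : R := 2 ^+ n.+1.
Lemma A_ge2 : 2 <= A.
Proof. by rewrite /A exprS ler_peMr// exprn_ege1// ler1n. Qed.

(** A discrete layer-cake argument: half the levels, taken as heights on the nested stopping sets,
    form a step function below the local maximal function. [FW] bounds its integral, and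
    [stop_density] turns each layer back into a [U]-mass. The bound does not grow with the number
    [k] of layers. *)
Lemma stop_layers N a l t k : 0 <= t -> 0 < l -> hcube a l `<=` hcube a0 l0 ->
  U (hcube a l) <= 2 ^+ n * t * l ^+ n ->
  \sum_(i < k) U (stop N a l (t * A ^+ i.+1)) <= A * K * U (hcube a l).
Proof.
move=> t0 lp sa Ua.
pose tt i := t * A ^+ i.+1; pose c i := tt i / 2.
have A2 := A_ge2.
have A0 : 0 < A by lra.
have tt0 i : 0 <= tt i by rewrite mulr_ge0// exprn_ge0// ltW.
have c0 i : 0 <= c i by rewrite divr_ge0.
have t_tt i : t <= tt i by rewrite ler_peMr// exprn_ege1//; lra.
have := FW lp sa (k := k) (S := fun i => stop N a l (tt i)) c0
  (fun i => measurable_stop _ _ _ _) (fun i => stop_sub lp).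
rewrite -(ler_pM2l A0) mulrA => /(_ _) H.
apply: le_trans (H _) => {H}.
  rewrite mulr_sumr; apply: ler_sum => i _.
  apply: le_trans (stop_density _ _ _ _ _) _ => //.
  - exact: tt0.
  - apply: le_trans Ua _; rewrite ler_pM2r ?exprn_gt0// ler_pM2l ?exprn_gt0//.
    exact: t_tt.
  rewrite [leRHS]mulrA ler_wpM2r ?fm.1//; first exact: measurable_stop.
  rewrite -/(tt i) /c le_eqVlt; apply/orP; left; apply/eqP.
  by move: (tt i) => z; rewrite /A exprS; field.
move=> x hx.
have sumc j : \sum_(i < j.+1) c i <= tt j.
  elim: j => [|j IH]; first by rewrite big_ord1 /c; have := tt0 0%N; lra.
  rewrite big_ord_recr /=.
  have : 2 * tt j <= tt j.+1.
    by rewrite /tt [in leRHS]exprS [in leRHS]mulrCA ler_wpM2r//; exact: (tt0 j).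
  by rewrite /c; lra.
(* If [x] is in the last layer, all heights together are at most the last level, which is below the
   average on a selected cube around [x]. Otherwise the last term vanishes at [x]. *)
elim: k => [|k IH].
  exists a, l; split => //.
  by rewrite big_ord0 divr_ge0 ?U_ge0// exprn_ge0// ltW.
have [hS|hS] := pselect (stop N a l (tt k) x).
  have [a' [l' [h1 h2 h3 h4]]] := stop_cube lp hS.
  exists a', l'; split => //; apply: le_trans (ltW h4).
  apply: le_trans (sumc k); apply: ler_sum => i _.
  by rewrite indicE ler_piMr//; case: (_ \in _).
have [a' [l' [h1 h2 h3 h4]]] := IH.
exists a', l'; split => //; rewrite big_ord_recr /=.
by rewrite indicE memNset// mulr0 addr0.
Qed.

(** On a single cube, each of the [k] nested layers contains the last one, so [k] times its mass is
    at most [A * K * U (hcube a l)], and [k] was taken large enough to gain a factor 2. Descending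
    to the cubes selected at level [t] replaces the mass of the whole cube by that of their
    union. *)
Lemma stop_half N a l t k : 0 <= t -> 0 < l -> hcube a l `<=` hcube a0 l0 ->
  2 * A * K <= k%:R -> U (hcube a l) <= 2 ^+ n * t * l ^+ n ->
  U (stop N a l (t * A ^+ k)) <= U (stop N a l t) / 2.
Proof.
move=> t0 + + hk; have A2 := A_ge2.
have A1 : 1 <= A ^+ k by rewrite exprn_ege1//; lra.
have k0 : 0 < k%:R :> R by apply: lt_le_trans hk; rewrite !mulr_gt0//; lra.
have tA : t <= t * A ^+ k by rewrite ler_peMr.
have base N' a' l' : 0 < l' -> hcube a' l' `<=` hcube a0 l0 ->
    U (hcube a' l') <= 2 ^+ n * t * l' ^+ n ->
    U (stop N' a' l' (t * A ^+ k)) <= U (hcube a' l') / 2.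
  move=> lp sa Ua.
  have h : k%:R * U (stop N' a' l' (t * A ^+ k)) <= A * K * U (hcube a' l').
    apply: le_trans (stop_layers N' k t0 lp sa Ua).
    rewrite mulr_natl -[X in _ *+ X]card_ord -sumr_const; apply: ler_sum => i _.
    apply: finadd_le => //; try exact: measurable_stop.
    apply: stop_mono => //; rewrite ler_wpM2l// ler_weXn2l//; lra.
  rewrite -(ler_pM2l k0) (le_trans h)//.
  have := ler_wpM2r (U_ge0 a' l') hk; lra.
elim: N a l => [|N IH] a l lp sa Ua.
  have := base 0%N a l lp sa Ua; rewrite /=; case: (ltP (t * l ^+ n)) => // h1 _.
  by rewrite ltNge (le_trans h1) ?ler_pM2r ?exprn_gt0//= finadd0// mul0r.
have := base N.+1 a l lp sa Ua; rewrite /=; case: (ltP (t * l ^+ n)) => // h1 _.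
rewrite ltNge (le_trans h1) ?ler_pM2r ?exprn_gt0//=.
have lp2 := half_gt0 lp.
rewrite !(@finadd_children _ _ a l)//; last 4 first.
- by move=> b; exact: measurable_stop.
- by move=> b; exact: stop_sub.
- by move=> b; exact: measurable_stop.
- by move=> b; exact: stop_sub.
rewrite mulr_suml; apply: ler_sum => b _; apply: IH => //.
  by apply: subset_trans sa; exact: child_sub.
exact: child_bound.
Qed.

(** Inside the cube, [D] is a union of dyadic subcubes of generation [N]. *)
Fixpoint adapted (N : nat) a l D : Prop :=
  if N is N'.+1 then forall b, adapted N' (child_corner a l b) (l / 2) D
  else hcube a l `<=` D \/ hcube a l `<=` ~` D.

(** An unselected cube of generation [N] has [U]-mass at most [t] times its volume, and [D] contains
    all of it or nothing; selected cubes contribute nothing to the left-hand side. *)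
Lemma stop_compl N a l t D : 0 <= t -> 0 < l -> hcube a l `<=` hcube a0 l0 ->
  measurable D -> adapted N a l D ->
  U ((D `&` hcube a l) `\` stop N a l t) <= t * m (D `&` hcube a l).
Proof.
move=> t0 + + mD.
have mDI a' l' : measurable (D `&` hcube a' l').
  by apply: measurableI => //; exact: measurable_hcube.
have triv a' l' X : X `<=` hcube a' l' -> U (X `\` hcube a' l') <= t * m (D `&` hcube a' l').
  rewrite -setD_eq0 => ->; rewrite finadd0// mulr_ge0//; exact: fm.1.
elim: N a l => [|N IH] a l lp sa /=.
  case: ltP => h; first by move=> _; apply: triv; exact: subIsetr.
  rewrite setD0 => -[h1|h1].
    by rewrite setIidr// m_hcube.
  rewrite (_ : D `&` hcube a l = set0) ?finadd0// ?mulr0//.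
  by apply/seteqP; split => // x [Dx /h1].
move=> ad; case: ltP => h; first by apply: triv; exact: subIsetr.
have lp2 := half_gt0 lp.
rewrite (finadd_split fm lp (mDI a l) (@subIsetr _ _ _)).
rewrite (finadd_split (a := a) fU lp); last 2 first.
- apply: measurableD => //; apply: fin_bigcup_measurable => // b _.
  exact: measurable_stop.
- by move=> x [[]].
rewrite mulr_sumr; apply: ler_sum => b _.
have sb := @child_sub a l b lp.
have -> : D `&` hcube a l `&` hcube (child_corner a l b) (l / 2) =
  D `&` hcube (child_corner a l b) (l / 2) by rewrite -setIA (setIidr sb).
apply: le_trans (IH _ _ lp2 (subset_trans sb sa) (ad b)).
apply: finadd_le => //.
- apply: measurableI; last exact: measurable_hcube.
  apply: measurableD => //; apply: fin_bigcup_measurable => // b' _.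
  exact: measurable_stop.
- by apply: measurableD => //; exact: measurable_stop.
by move=> x [[[Dx _] nx] xb]; split => // xs; apply: nx; exists b.
Qed.

(** Start at the average of [U] over the cube and halve the mass [j] times, each time at the price
    of raising the level by [A ^+ k]. *)
Lemma stop_iter N a l k j : 0 < l -> hcube a l `<=` hcube a0 l0 ->
  2 * A * K <= k%:R ->
  U (stop N a l (U (hcube a l) / l ^+ n * A ^+ (k * j))) <= U (hcube a l) / 2 ^+ j.
Proof.
move=> lp sa hk; set t0 := _ / _.
have ln : 0 < l ^+ n by rewrite exprn_gt0.
have A2 := A_ge2.
have t00 : 0 <= t0 by rewrite divr_ge0 ?U_ge0// ltW.
elim: j => [|j IH].
  rewrite expr0 divr1; apply: finadd_le => //.
  - exact: measurable_stop.
  - exact: measurable_hcube.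
  - exact: stop_sub.
rewrite mulnS addnC exprD mulrA exprSr invfM mulrA.
apply: le_trans (stop_half _ _ _ _ hk _) _ => //.
- by rewrite mulr_ge0// exprn_ge0//; lra.
- have {1}-> : U (hcube a l) = t0 * l ^+ n by rewrite /t0 divfK// gt_eqF.
  rewrite ler_pM2r// mulrCA ler_peMr// mulr_ege1// exprn_ege1//; lra.
by rewrite ler_pM2r.
Qed.

Lemma adapted_bound N a l k j D : 0 < l -> hcube a l `<=` hcube a0 l0 ->
  2 * A * K <= k%:R -> measurable D -> adapted N a l D ->
  U (D `&` hcube a l) <= U (hcube a l) / 2 ^+ j +
    U (hcube a l) / l ^+ n * A ^+ (k * j) * m (D `&` hcube a l).
Proof.
move=> lp sa hk mD ad.
have A2 := A_ge2.
set t := U (hcube a l) / l ^+ n * A ^+ (k * j).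
have t0 : 0 <= t.
  rewrite mulr_ge0// ?divr_ge0 ?U_ge0// exprn_ge0 ?(ltW lp)//; lra.
rewrite addrC; apply: le_trans (finaddD fU _ (measurable_stop N a l t)) _.
  by apply: measurableI => //; exact: measurable_hcube.
by apply: lerD; [exact: stop_compl|exact: stop_iter].
Qed.

End stopping.
End dyadic.

(** * Approximation of measurable sets by unions of dyadic cubes *)

Section approximation.
Context (R : realType) (n : nat).
Local Notation R1 := (measurableTypeR R).
Local Notation Rn := (Rn R n).
Implicit Types (a : 'I_n -> R) (l t : R) (b : {ffun 'I_n -> bool}) (D E : set Rn).

Lemma adaptedC N a l D : adapted N a l D -> adapted N a l (~` D).
Proof.
elim: N a l => [|N IH] a l /=; last by move=> h b; exact: IH.
by rewrite setCK; case; [right|left].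
Qed.

Lemma adapted_set0 N a l : adapted N a l set0.
Proof.
elim: N a l => [|N IH] a l //=; right => x _ [].
Qed.

Lemma adaptedU N a l D E : adapted N a l D -> adapted N a l E ->
  adapted N a l (D `|` E).
Proof.
elim: N a l => [|N IH] a l /=; last by move=> h h' b; apply: IH.
move=> [h _|h [h'|h']].
- by left; apply: subset_trans h _; exact: subsetUl.
- by left; apply: subset_trans h' _; exact: subsetUr.
by right; rewrite setCU => x ax; split; [exact: h|exact: h'].
Qed.

Lemma adaptedS N a l D : 0 < l -> adapted N a l D -> adapted N.+1 a l D.
Proof.
elim: N a l => [|N IH] a l lp; last first.
  by move=> h b; apply: IH => //; exact: half_gt0.
move=> [h|h] b; [left|right]; apply: subset_trans h; exact: child_sub.
Qed.

Lemma adapted_le N N' a l D : 0 < l -> (N <= N')%N ->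
  adapted N a l D -> adapted N' a l D.
Proof.
move=> lp; elim: N' => [|N' IH]; first by rewrite leqn0 => /eqP ->.
rewrite leq_eqVlt => /predU1P[-> //|]; rewrite ltnS => /IH {}IH /IH.
exact: adaptedS.
Qed.

(** A threshold on the grid of depth [N.+1] is again a grid threshold, of depth [N], seen from the
    corner of a child: the upper child shifts [k] by [2 ^+ N]. At depth 0 the integer [k] decides
    whether the whole cube is on one side. *)
Lemma adapted_halfspace N a l (i : 'I_n) (k : int) : 0 < l ->
  adapted N a l [set x | coordinate x i < a i + l * k%:~R / 2 ^+ N].
Proof.
elim: N a l k => [|N IH] a l k lp /=.
  rewrite expr0 divr1; have [k1|k1] := leP 1 k.
  - left => x h; have := h i; rewrite /= in_itv/= => /andP[_ h2].
    apply: lt_le_trans h2 _; rewrite lerD2l ler_peMr ?(ltW lp)//.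
    by rewrite (_ : 1 = 1%:~R)// ler_int.
  - right => x h /=; have := h i; rewrite /= in_itv/= => /andP[h1 _].
    apply/negP; rewrite -leNgt; apply: le_trans h1; rewrite gerDl.
    by rewrite mulr_ge0_le0 ?(ltW lp)// (_ : 0 = 0%:~R)// ler_int -ltzD1.
move=> b; have := IH (child_corner a l b) (l / 2) (k - (b i : int) * 2 ^+ N) (half_gt0 lp).
congr adapted; rewrite /child_corner.
suff -> : a i + (b i)%:R * (l / 2) +
    l / 2 * (k - (b i : int) * 2 ^+ N)%:~R / 2 ^+ N = a i + l * k%:~R / 2 ^+ N.+1.
  by [].
rewrite intrB intrM rmorphXn /= -!pmulrn exprS; field.
by rewrite expf_neq0.
Qed.

Lemma measurable_coordinate_preimage (i : 'I_n) (B : set R1) : measurable B ->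
  measurable ((fun x : Rn => coordinate x i) @^-1` B).
Proof.
move=> mB; apply: (@borel_measurable_Rn _ _ ((fun t : n.-tuple R1 => tnth t i) @^-1` B)).
by rewrite -[X in measurable X]setTI; exact: (measurable_tnth i).
Qed.

Section mu.
Variables (mu : {measure set Rn -> \bar R}) (a : 'I_n -> R) (l : R).
Hypotheses (lp : 0 < l) (muQ : (mu (hcube a l) < +oo)%E).
Local Notation Q := (hcube a l).

Definition symd E D := ((E `\` D) `|` (D `\` E)) `&` Q.

Definition approximable E := measurable E /\ forall eps, 0 < eps ->
  exists N D, [/\ measurable D, adapted N a l D & (mu (symd E D) < eps%:E)%E].

Lemma measurable_symd E D : measurable E -> measurable D -> measurable (symd E D).
Proof.
move=> mE mD; apply: measurableI; last exact: measurable_hcube.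
by apply: measurableU; exact: measurableD.
Qed.

Lemma approximable_adapted N E : measurable E -> adapted N a l E -> approximable E.
Proof.
move=> mE aE; split => // eps e0; exists N, E; split => //.
by rewrite /symd setDv setU0 set0I measure0.
Qed.

Lemma approximableC E : approximable E -> approximable (~` E).
Proof.
move=> [mE h]; split; first exact: measurableC.
move=> eps e0; have [N [D [mD aD mu_]]] := h _ e0.
exists N, (~` D); split; [exact: measurableC|exact: adaptedC|].
rewrite (_ : symd _ _ = symd E D)// /symd; congr (_ `&` _).
by rewrite !setDE !setCK setUC ![_ `&` ~` _]setIC; congr (_ `|` _); rewrite setIC.
Qed.

Lemma approximableU E E' : approximable E -> approximable E' ->
  approximable (E `|` E').
Proof.
move=> [mE h] [mE' h']; split; first exact: measurableU.
move=> eps e0; have e2 : 0 < eps / 2 by lra.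
have [N [D [mD aD muD]]] := h _ e2.
have [N' [D' [mD' aD' muD']]] := h' _ e2.
exists (maxn N N'), (D `|` D'); split.
- exact: measurableU.
- by apply: adaptedU; [apply: adapted_le aD|apply: adapted_le aD'] => //;
    rewrite ?leq_maxl ?leq_maxr.
have m1 := measurable_symd mE mD; have m2 := measurable_symd mE' mD'.
apply: (@le_lt_trans _ _ (mu (symd E D `|` symd E' D'))).
  apply: le_measure; rewrite ?inE.
  - by apply: measurable_symd; exact: measurableU.
  - exact: measurableU.
  rewrite /symd => x [[[[Ex|Ex] /not_orP[nD nD']]|[[Dx|Dx] /not_orP[nE nE']]] xQ].
  - by left; split => //; left.
  - by right; split => //; left.
  - by left; split => //; right.
  - by right; split => //; right.
apply: (le_lt_trans (measureU2 _ m1 m2)).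
rewrite [X in (_ < X%:E)%E](_ : eps = eps / 2 + eps / 2); last by lra.
by rewrite EFinD lteD.
Qed.

(** Since [mu] is finite on the cube, the part of the union missed by its first [k] sets has measure
    tending to 0, and a finite union is approximable. *)
Lemma approximable_bigcup (F : nat -> set Rn) :
  (forall i, approximable (F i)) -> approximable (\bigcup_i F i).
Proof.
move=> aF; have mF i : measurable (F i) := (aF i).1.
have mU : measurable (\bigcup_i F i) by exact: bigcupT_measurable.
split => // eps e0; have e2 : 0 < eps / 2 by lra.
pose S k := \big[setU/set0]_(i < k) F i.
have aS k : approximable (S k).
  rewrite /S; elim: k => [|k IH].
    by rewrite big_ord0; exact: (@approximable_adapted 0%N _ measurable0 (adapted_set0 _ _ _)).
  by rewrite big_ord_recr /=; exact: approximableU.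
have mS k : measurable (S k) := (aS k).1.
pose G k := (\bigcup_i F i `\` S k) `&` Q.
have mG k : measurable (G k).
  by apply: measurableI; [exact: measurableD|exact: measurable_hcube].
have cG : mu (G k) @[k --> \oo] --> (0 : \bar R)%E.
  rewrite -(measure0 mu) (_ : set0 = \bigcap_k G k).
    apply: nonincreasing_cvg_mu => //.
    - apply: le_lt_trans muQ; apply: le_measure; rewrite ?inE//.
        exact: measurable_hcube.
      exact: subIsetr.
    - exact: bigcapT_measurable.
    - move=> k m km; apply/subsetPset => x [[xF nx] xQ]; split => //.
      by split => // Sx; apply: nx; exact: (subset_bigsetU km).
  apply/seteqP; split => // x Gx.
  have [[[i _ Fix] _] _] := Gx 0%N I.
  have [[_ h] _] := Gx i.+1 I; apply: h.
  by rewrite /S big_ord_recr /=; right.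
have [k hk] : exists k, (mu (G k) < (eps / 2)%:E)%E.
  have : \forall k \near \oo, (mu (G k) < (eps / 2)%:E)%E.
    have h : (0 < (eps / 2)%:E)%E by rewrite lte_fin.
    exact: cG _ (open_ereal_lt' h).
  by move=> [k _ hk]; exists k; apply: hk => /=.
have [N [D [mD aD muD]]] := (aS k).2 _ e2.
exists N, D; split => //.
have m1 := measurable_symd (mS k) mD.
apply: (@le_lt_trans _ _ (mu (symd (S k) D `|` G k))).
  apply: le_measure; rewrite ?inE.
  - exact: measurable_symd.
  - exact: measurableU.
  rewrite /symd => x [[[Fx nD]|[Dx nF]] xQ].
    have [Sx|Sx] := pselect (S k x); [left|right]; split => //.
    by left.
  left; split => //; right; split => // Sx; apply: nF.
  by move: Sx; rewrite /S -bigcup_mkord => -[i _ Fi]; exists i.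
apply: (le_lt_trans (measureU2 _ m1 (mG k))).
rewrite [X in (_ < X%:E)%E](_ : eps = eps / 2 + eps / 2); last by lra.
by rewrite EFinD lteD.
Qed.

Lemma approximable_sigma_algebra : sigma_algebra setT approximable.
Proof.
split; first exact: (@approximable_adapted 0%N _ measurable0 (adapted_set0 _ _ _)).
- by move=> A; rewrite setTD; exact: approximableC.
- exact: approximable_bigcup.
Qed.

Lemma approximable_gt (i : 'I_n) (r : R) :
  approximable [set x : Rn | r < coordinate x i].
Proof.
(* The threshold [r] rounded up to the grid of depth [N]; the added 1 makes the rounding strict. The
   half-spaces at and above [rr N] then exhaust the open half-space above [r]. *)
pose k N := Num.floor ((r - a i) / l * 2 ^+ N) + 1.
pose rr N := a i + l * (k N)%:~R / 2 ^+ N.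
have p2 N : 0 < 2 ^+ N :> R by rewrite exprn_gt0.
have scale N (z : R) : l * (z / l * 2 ^+ N) / 2 ^+ N = z.
  by field; rewrite ?expf_neq0 ?(gt_eqF lp)//.
have r_lt N : r < rr N.
  rewrite /rr -ltrBlDl -[X in X < _](scale N) ltr_pM2r ?invr_gt0// ltr_pM2l//.
  exact: floorD1_gt.
have rr_le N : rr N <= r + l / 2 ^+ N.
  rewrite /rr -lerBrDl addrAC -[X in _ <= X + _](scale N) -mulrDl.
  rewrite ler_pM2r ?invr_gt0// -[X in _ <= _ + X]mulr1 -mulrDr ler_pM2l//.
  by rewrite intrD lerD2r floor_le.
rewrite (_ : [set x | _] = \bigcup_N ~` [set x | coordinate x i < rr N]).
  apply: approximable_bigcup => N; apply: approximableC.
  apply: (@approximable_adapted N); last exact: adapted_halfspace.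
  rewrite (_ : [set x | _] =
      (fun x : Rn => coordinate x i) @^-1` (`]-oo, rr N[%classic : set R)).
    by apply: measurable_coordinate_preimage; exact: measurable_itv.
  by apply/seteqP; split => x /=; rewrite in_itv.
apply/seteqP; split => x /=; last first.
  by move=> [N _] /negP; rewrite -leNgt => h; exact: lt_le_trans (r_lt N) h.
move=> h; set e := coordinate x i - r.
have e0 : 0 < e by rewrite subr_gt0.
pose N := (Num.truncn (l / e)).+1.
exists N => //=; apply/negP; rewrite -leNgt.
apply: le_trans (rr_le N) _; rewrite -lerBrDl -/e ler_pdivrMr// mulrC.
rewrite -ler_pdivrMr//; apply: le_trans (ltW (truncnS_gt _)) _.
by rewrite -natrX ler_nat ltnW// ltn_expl.
Qed.

Lemma approximable_borel (E : set (n.-tuple R1)) : measurable E ->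
  approximable E.
Proof.
have sig (i : 'I_n) : (measurable : set (set R1)) `<=`
    [set B : set R1 | approximable ((fun x : Rn => coordinate x i) @^-1` B)].
  apply: smallest_sub.
    have [s0 sC sU] := approximable_sigma_algebra; split.
    - by rewrite /= preimage_set0.
    - by move=> A /= /sC; rewrite !setTD.
    - by move=> F /= hF; rewrite preimage_bigcup; exact: sU.
  move=> _ /= [[x1 x2] _ <-] /=.
  rewrite (_ : _ @^-1` _ = ~` (~` [set x : Rn | x1 < coordinate x i] `|`
     [set x : Rn | x2 < coordinate x i])).
    apply: approximableC; apply: approximableU; last exact: approximable_gt.
    by apply: approximableC; exact: approximable_gt.
  apply/seteqP; split => x /=; rewrite in_itv /=.
    by move=> /andP[h1 h2] [/(_ h1)//|]; rewrite ltNge h2.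
  rewrite not_orP => -[/contrapT -> /negP]; by rewrite -leNgt.
move: E; apply: smallest_sub; first exact: approximable_sigma_algebra.
elim/big_ind: _ => [|A B|i _]; first exact: sub0set.
  by move=> hA hB; rewrite subUset.
by move=> _ [B mB <-]; rewrite setTI; exact: sig.
Qed.

(** Countable Borel covers of [E] with excess below 1/(j+1) exist by definition of the outer
    measure; their intersection over [j] has no excess. *)
Lemma leb_borel_hull (E : set Rn) : measurable E -> (leb E < +oo)%E ->
  exists B : set (n.-tuple R1), [/\ measurable B, E `<=` B & leb (B `\` E) = 0%E].
Proof.
move=> mE Eoo.
have Efin : leb E \is a fin_num by rewrite ge0_fin_numE// measure_ge0.
have cov (j : nat) : exists B : set (n.-tuple R1),
    [/\ measurable B, E `<=` B & (leb B < leb E + j.+1%:R^-1%:E)%E].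
  have e0 : 0 < j.+1%:R^-1 :> R by rewrite invr_gt0.
  have [_ [F [mF EF] <-] h] := lb_ereal_inf_adherent e0 Efin.
  exists (\bigcup_k F k); split => //; first exact: bigcupT_measurable.
  apply: le_lt_trans h.
  rewrite leb_borel; last exact: bigcupT_measurable.
  by apply: measure_sigma_subadditive => //; exact: bigcupT_measurable.
pose B j := projT1 (cid (cov j)).
have [mB EB hB] : [/\ forall j, measurable (B j), forall j, E `<=` B j &
    forall j, (leb (B j : set Rn) < leb E + j.+1%:R^-1%:E)%E].
  by split=> j; rewrite /B; case: cid => //= ? [].
have mI : measurable (\bigcap_j B j) by exact: bigcapT_measurable.
exists (\bigcap_j B j); split => //; first by move=> x Ex j _; exact: EB.
apply/eqP; rewrite eq_le measure_ge0 andbT.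
apply/lee_addgt0Pr => e e0; rewrite add0e.
pose j := Num.truncn e^-1.
have mBj : measurable (B j : set Rn) by exact: borel_measurable_Rn.
apply: (@le_trans _ _ (leb (B j `\` E))).
  by apply: le_leb; apply: setSD => x; exact.
have -> : leb (B j `\` E) = (leb (B j : set Rn) - leb E)%E.
  have fin : (leb (B j : set Rn) < +oo)%E.
    by apply: lt_trans (hB j) _; rewrite -(fineK Efin) -EFinD ltry.
  by apply: etrans (measureD mBj mE fin) _; rewrite setIidr.
rewrite leeBlDl//; apply: le_trans (ltW (hB j)) _.
rewrite leeD2l// lee_fin invf_ple ?posrE//.
exact: ltW (truncnS_gt _).
Qed.

(** Inside the cube, [E] differs from a Borel hull by a Lebesgue null set, which [mu] does not
    charge by absolute continuity. *)
Lemma approximable_measurable E : measurable E ->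
  (forall N : set Rn, measurable N -> leb N = 0%E -> mu N = 0%E) ->
  approximable E.
Proof.
move=> mE ac; split => // eps e0.
have mEQ : measurable (E `&` Q) by apply: measurableI => //; exact: measurable_hcube.
have fin : (leb (E `&` Q) < +oo)%E.
  apply: (@le_lt_trans _ _ (leb Q)); first by apply: le_leb; exact: subIsetr.
  by rewrite leb_hcube ?(ltW lp)// ltry.
have [B [mB EB B0]] := leb_borel_hull mEQ fin.
have mB' : measurable (B : set Rn) by exact: borel_measurable_Rn.
have [_ /(_ eps e0)[N [D [mD aD h]]]] := approximable_borel mB.
exists N, D; split => //; apply: le_lt_trans h.
have mBE : measurable (B `\` (E `&` Q) : set Rn) by exact: measurableD.
have m1 := measurable_symd mB' mD.
apply: (@le_trans _ _ (mu (symd (B : set Rn) D `|` (B `\` (E `&` Q) : set Rn)))).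
  apply: le_measure; rewrite ?inE.
  - exact: measurable_symd.
  - exact: measurableU.
  rewrite /symd => x [[[Ex nD]|[Dx nE]] xQ].
    by left; split => //; left; split => //; apply: EB.
  have [Bx|Bx] := pselect (B x); [right|left]; first by split => // -[].
  by split => //; right.
apply: le_trans (measureU2 _ m1 mBE) _.
by rewrite [X in (_ + X)%E](_ : _ = 0%E) ?adde0//; exact: ac.
Qed.

End mu.
End approximation.

(** * From the Fujii-Wilson characteristic to the decay of the weight *)

Section Ainfty.
Context (R : realType) (n : nat).
Local Notation Rn := (Rn R n).
Implicit Types (a : 'I_n -> R) (l t : R) (D E : set Rn).

Lemma ge0_integral_ccube a l (u : Rn -> R) : 0 <= l -> measurable_fun setT u ->
  (forall x, 0 <= u x) ->
  (\int[leb]_(x in ccube a l) (u x)%:E = \int[leb]_(x in hcube a l) (u x)%:E)%E.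
Proof.
move=> l0 mu u0; apply: ge0_integral_null_setD.
- exact: measurable_hcube.
- exact: measurable_ccube.
- exact: hcube_sub_ccube.
- exact: leb_ccubeD.
- by apply/measurable_EFinP; exact: measurable_funTS.
- by move=> x; rewrite lee_fin.
Qed.

Lemma avg_ge0 (Q : set Rn) (g : Rn -> \bar R) :
  (forall x, Q x -> (0 <= g x)%E) -> (0 <= avg Q g)%E.
Proof.
move=> g0; rewrite /avg mule_ge0 ?integral_ge0// lee_fin invr_ge0 fine_ge0//.
Qed.

Lemma maximal_ge (g : Rn -> R) (Q : set Rn) x : is_cube Q -> Q x ->
  (avg Q (fun y => `|g y|%:E) <= maximal g x)%E.
Proof. by move=> cQ Qx; apply: ereal_sup_ubound; exists Q. Qed.

Definition layer_count (K : R) : nat := (Num.truncn (2 * 2 ^+ n.+1 * K)).+1.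

(** With k layers per halving, [adapted_bound] reads 2^(-j) + 2^((n+1) k j) eps, where eps =
    |E|/|Q|. The two terms balance at eps = 2^(-(1 + k (n+1)) j), hence the exponent. *)
Definition Ainfty_exponent (K : R) : R := (1 + layer_count K * n.+1)%:R^-1.

Section weight.
Variables (u : Rn -> R) (K : R).
Hypotheses (mu : measurable_fun setT u) (u0 : forall x, 0 <= u x) (K0 : 0 < K).
Hypothesis FW : forall a l, 0 < l ->
  (\int[leb]_(x in ccube a l) maximal (fun y => u y * \1_(ccube a l) y)%R x
    <= K%:E * \int[leb]_(x in ccube a l) (u x)%:E)%E.

Let nu : {measure set Rn -> \bar R} := density leb mu u0.

Section cube.
Variables (a0 : 'I_n -> R) (l0 : R).
Hypotheses (l0_gt0 : 0 < l0) (nuQ : (nu (hcube a0 l0) < +oo)%E).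
Local Notation Q0 := (hcube a0 l0).

Let m A : R := fine (leb (A `&` Q0)).
Let U A : R := fine (nu (A `&` Q0)).

Lemma finadd_fine (mm : {measure set Rn -> \bar R}) : (mm Q0 < +oo)%E ->
  finadd (fun A => fine (mm (A `&` Q0))).
Proof.
move=> fin; split=> [A mA|A B mA mB AB0]; first by rewrite fine_ge0// measure_ge0.
have mQ := measurable_hcube a0 l0.
have finA A' : measurable A' -> mm (A' `&` Q0) \is a fin_num.
  move=> mA'; rewrite ge0_fin_numE//; apply: le_lt_trans fin.
  by apply: le_measure; rewrite ?inE; [exact: measurableI|exact: mQ|exact: subIsetr].
rewrite setIUl measureU; [|exact: measurableI|exact: measurableI|].
  by rewrite fineD ?finA.
by rewrite setIACA AB0 set0I.
Qed.

Let leb_fin : (leb Q0 < +oo)%E.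
Proof. by rewrite leb_hcube ?ltry// ltW. Qed.

Lemma fine_leb_hcube a l : 0 < l -> hcube a l `<=` Q0 -> m (hcube a l) = l ^+ n.
Proof. by move=> lp s; rewrite /m setIidl// leb_hcube// ltW. Qed.

(** [maximal] ranges over closed cubes containing [x], and the closure of the half-open cube
    supplied at [x] is one of them. The step function vanishes on the faces by which the closed and
    half-open cubes differ. *)
Lemma FujiiWilson_layers a l : 0 < l -> hcube a l `<=` hcube a0 l0 ->
  forall (k : nat) (c : nat -> R) (S : nat -> set Rn),
  (forall i, 0 <= c i) -> (forall i, measurable (S i)) ->
  (forall i, S i `<=` hcube a l) ->
  (forall x, hcube a l x -> exists a' l',
    [/\ 0 < l', hcube a' l' `<=` hcube a l, hcube a' l' x &
        \sum_(i < k) c i * \1_(S i) x <= U (hcube a' l') / l' ^+ n]) ->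
  \sum_(i < k) c i * m (S i) <= K * U (hcube a l).
Proof.
move=> lp sa k c S c0 mS sS H.
have mQ := measurable_hcube a0 l0.
have finU A : measurable A -> nu (A `&` Q0) \is a fin_num.
  move=> mA'; rewrite ge0_fin_numE//; apply: le_lt_trans nuQ.
  by apply: le_measure; rewrite ?inE; [exact: measurableI|exact: mQ|exact: subIsetr].
have finm A : measurable A -> leb (A `&` Q0) \is a fin_num.
  move=> mA'; rewrite ge0_fin_numE ?measure_ge0//; apply: le_lt_trans leb_fin.
  by apply: le_leb; exact: subIsetr.
have mh := measurable_hcube a l.
have mc := measurable_ccube a l.
have hS i : S i `&` Q0 = S i by apply: setIidl; exact: subset_trans (sS i) sa.
have hfin : nu (hcube a l) \is a fin_num by rewrite -(setIidl sa) finU.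
rewrite -lee_fin EFinM /U setIidl// fineK// -sumEFin.
rewrite (_ : nu (hcube a l) = \int[leb]_(x in ccube a l) (u x)%:E)%E; last first.
  by rewrite ge0_integral_ccube// ltW.
apply: le_trans (FW a lp).
have -> : (\sum_(i < k) (c i * m (S i))%:E =
    \int[leb]_(x in ccube a l) (\sum_(i < k) c i * \1_(S i) x)%:E)%E.
  rewrite (integral_step _ _ mc c0 mS); last first.
    by move=> i; apply: subset_trans (sS i) _; exact: hcube_sub_ccube.
  apply: eq_bigr => i _.
  by rewrite EFinM /m hS fineK// -(hS i) finm.
apply: ge0_le_integral_nomeas => x cx.
  by rewrite lee_fin sumr_ge0// => i _; rewrite mulr_ge0.
have [hx|hx] := pselect (hcube a l x); last first.
  rewrite big1; last by move=> i _; rewrite indicE memNset ?mulr0// => /sS.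
  apply: le_trans (maximal_ge _ (is_cube_ccube a lp) cx).
  by apply: avg_ge0 => // y _; rewrite lee_fin.
have [a' [l' [lp' s' hx' h]]] := H x hx.
have cx' := hcube_sub_ccube hx'.
apply: le_trans (maximal_ge _ (is_cube_ccube a' lp') cx').
apply: (@le_trans _ _ (U (hcube a' l') / l' ^+ n)%:E); first by rewrite lee_fin.
rewrite /avg vol_ccube ?(ltW lp')// mulrC EFinM lee_wpmul2l//.
  by rewrite lee_fin invr_ge0 exprn_ge0// ltW.
have mh' := measurable_hcube a' l'.
rewrite /U setIidl; last exact: subset_trans s' sa.
rewrite fineK; last by rewrite -(setIidl (subset_trans s' sa)) finU.
apply: (@le_trans _ _ (\int[leb]_(y in hcube a' l') `|u y * \1_(ccube a l) y|%:E)%E).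
  apply: ge0_le_integral_nomeas => y hy; rewrite lee_fin//.
  rewrite indicE mem_set ?mulr1 ?ger0_norm//.
  by apply: hcube_sub_ccube; exact: s'.
apply: ge0_subset_integral_EFin.
- exact: mh'.
- exact: measurable_ccube.
- apply: measurableT_comp; first exact: normr_measurable.
  by apply: measurable_funM; [exact: mu|exact: measurable_indic].
- by move=> y.
- exact: hcube_sub_ccube.
Qed.

Lemma Ainfty_density_step E j : measurable E ->
  U E <= U Q0 * (2 ^- j + 2 ^+ (n.+1 * (layer_count K * j)) * (m E / l0 ^+ n)).
Proof.
move=> mE; have mQ := measurable_hcube a0 l0.
have fm : finadd m by exact: finadd_fine.
have fU : finadd U by exact: finadd_fine.
have hk : 2 * 2 ^+ n.+1 * K <= (layer_count K)%:R by apply: ltW; exact: truncnS_gt.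
have l0n : 0 < l0 ^+ n by rewrite exprn_gt0.
set B := 2 ^+ (n.+1 * _).
have B0 : 0 <= B by rewrite exprn_ge0.
have UQ0 : 0 <= U Q0 by apply: fU.1.
pose c := U Q0 / l0 ^+ n * B.
have c0 : 0 <= c by rewrite mulr_ge0// divr_ge0// ltW.
have -> : U Q0 * (2 ^- j + B * (m E / l0 ^+ n)) = U Q0 / 2 ^+ j + c * m E.
  by rewrite /c; field; rewrite expf_neq0 ?gt_eqF.
apply/ler_addgt0Pr => e e0.
(* The approximation error enters once through [U] and once, multiplied by [c], through [m]; the
   total is then exactly [e]. *)
have h0 : 0 < e / (1 + c) by rewrite divr_gt0// ltr_pwDl.
set h := e / (1 + c) in h0.
(* Approximating for the sum of the two measures gives one set [D] that is close to [E] for both. *)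
pose mm : {measure set Rn -> \bar R} := measure_add leb nu.
have mmE A : mm A = (leb A + nu A)%E by exact: measure_addE.
have mmQ : (mm Q0 < +oo)%E by rewrite mmE lte_add_pinfty.
have ac (N : set Rn) : measurable N -> leb N = 0%E -> mm N = 0%E.
  move=> mN N0; rewrite mmE N0 add0e; exact: density_null.
have [_ /(_ h h0)[N [D [mD aD]]]] := approximable_measurable l0_gt0 mmQ mE ac.
rewrite mmE => hsym.
have ms := measurable_symd a0 l0 mE mD.
have sQ : symd a0 l0 E D `<=` Q0 by exact: subIsetr.
have lebs : fine (leb (symd a0 l0 E D)) <= h.
  rewrite -lee_fin fineK; last first.
    rewrite ge0_fin_numE ?measure_ge0//; apply: le_lt_trans leb_fin.
    exact: le_leb.
  apply: le_trans (ltW hsym); rewrite leeDl//; exact: measure_ge0.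
have nus : fine (nu (symd a0 l0 E D)) <= h.
  rewrite -lee_fin fineK; last first.
    rewrite ge0_fin_numE ?measure_ge0//; apply: le_lt_trans nuQ.
    by apply: le_measure; rewrite ?inE.
  apply: le_trans (ltW hsym); rewrite leeDr//; exact: measure_ge0.
have mDE := measurableD mD mE.
have mED := measurableD mE mD.
have fins A : measurable A -> A `<=` Q0 -> nu A \is a fin_num.
  move=> mA sA; rewrite ge0_fin_numE ?measure_ge0//; apply: le_lt_trans nuQ.
  by apply: le_measure; rewrite ?inE.
have finl A : measurable A -> A `<=` Q0 -> leb A \is a fin_num.
  move=> mA sA; rewrite ge0_fin_numE ?measure_ge0//; apply: le_lt_trans leb_fin.
  exact: le_leb.
have h1 : m D <= h + m E.
  apply: le_trans (finaddD fm mD mE) _; rewrite lerD2r; apply: le_trans lebs.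
  apply: fine_le.
  - by apply: finl; [exact: measurableI|exact: subIsetr].
  - exact: finl.
  - by apply: le_leb; apply: setSI; exact: subsetUr.
have h2 : U E <= h + U D.
  apply: le_trans (finaddD fU mE mD) _; rewrite lerD2r; apply: le_trans nus.
  apply: fine_le.
  - by apply: fins; [exact: measurableI|exact: subIsetr].
  - exact: fins.
  - apply: le_measure; rewrite ?inE.
    + exact: measurableI.
    + exact: ms.
    + by apply: setSI; exact: subsetUl.
have := adapted_bound fm fU K0 fine_leb_hcube FujiiWilson_layers j l0_gt0
  (@subset_refl _ Q0) hk mD aD.
have -> : U (D `&` Q0) = U D by rewrite /U -setIA setIid.
have -> : m (D `&` Q0) = m D by rewrite /m -setIA setIid.
rewrite -exprM -/B -/c => h3.
have : c * m D <= c * (h + m E) by rewrite ler_wpM2l.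
have : h * (1 + c) = e by rewrite /h divfK// gt_eqF// ltr_pwDl.
by move: h2 h3; clear; lra.
Qed.

Lemma Ainfty_decay E : measurable E ->
  (nu (E `&` Q0) <= (4 * (m E / l0 ^+ n) `^ Ainfty_exponent K)%:E * nu Q0)%E.
Proof.
move=> mE.
have mQ := measurable_hcube a0 l0.
have fm : finadd m by exact: finadd_fine.
have fU : finadd U by exact: finadd_fine.
have l0n : 0 < l0 ^+ n by rewrite exprn_gt0.
have finE : nu (E `&` Q0) \is a fin_num.
  rewrite ge0_fin_numE ?measure_ge0//; apply: le_lt_trans nuQ.
  by apply: le_measure; rewrite ?inE; [exact: measurableI|exact: mQ|exact: subIsetr].
have finQ : nu Q0 \is a fin_num by rewrite ge0_fin_numE.
rewrite -(fineK finE) -(fineK finQ) -EFinM lee_fin.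
rewrite -[X in fine (nu X) <= _]/(E `&` Q0) -/(U E).
have -> : fine (nu Q0) = U Q0 by rewrite /U setIid.
set eps := m E / l0 ^+ n.
have UQ0 : 0 <= U Q0 by apply: fU.1.
have eps0 : 0 <= eps by rewrite divr_ge0 ?(ltW l0n)//; exact: fm.1.
have eps1 : eps <= 1.
  rewrite ler_pdivrMr// mul1r -(fine_leb_hcube l0_gt0 (@subset_refl _ Q0)).
  rewrite /m setIid; apply: fine_le.
  - rewrite ge0_fin_numE ?measure_ge0//; apply: le_lt_trans leb_fin.
    by apply: le_leb; exact: subIsetr.
  - by rewrite ge0_fin_numE ?measure_ge0.
  - by apply: le_leb; exact: subIsetr.
move: eps0; rewrite le_eqVlt => /predU1P[eps0|eps0].
  have : nu (E `&` Q0) = 0%E.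
    apply: density_null; first exact: measurableI.
    move: eps0; rewrite /eps => /esym/eqP; rewrite mulf_eq0 invr_eq0 (gt_eqF l0n) orbF.
    rewrite fine_eq0; first by move/eqP.
    rewrite ge0_fin_numE ?measure_ge0//; apply: le_lt_trans leb_fin.
    by apply: le_leb; exact: subIsetr.
  rewrite [X in X <= _]/U => ->; apply: mulr_ge0 => //; apply: mulr_ge0 => //.
  exact: powR_ge0.
(* With [j] the last index such that eps <= 2^(-s j), both terms of [Ainfty_density_step] are at
   most 2^(-j), and 2 * 2^(-j) = 4 * 2^(-(j+1)) is at most 4 eps^(1/s). *)
pose s := (1 + layer_count K * n.+1)%N.
have hex : exists N, 2 ^- (s * N) < eps.
  exists (Num.truncn eps^-1).+1.
  rewrite invf_plt ?posrE ?exprn_gt0//.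
  apply: lt_trans (truncnS_gt _) _; rewrite -natrX ltr_nat.
  by apply: leq_trans (ltn_expl _ (ltnSn 1)) _; rewrite leq_exp2l// leq_pmull.
have [] := ex_minnP hex => -[|j]; first by rewrite muln0 expr0 invr1 ltNge eps1.
move=> hj jmin.
have hj' : eps <= 2 ^- (s * j).
  by rewrite leNgt; apply/negP => /jmin; rewrite ltnn.
apply: le_trans (Ainfty_density_step j mE) _; rewrite mulrC ler_wpM2r// -/eps.
have p2 i : 0 < 2 ^+ i :> R by rewrite exprn_gt0.
have step1 : 2 ^+ (n.+1 * (layer_count K * j)) * eps <= 2 ^- j.
  apply: (@le_trans _ _ (2 ^+ (n.+1 * (layer_count K * j)) * 2 ^- (s * j))).
    by rewrite ler_pM2l.
  rewrite /s mulnDl mul1n exprD invfM mulrC -mulrA.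
  rewrite [(_ * n.+1)%N]mulnC -mulnA mulVf ?mulr1// gt_eqF//.
have step2 : 2 ^- j.+1 <= eps `^ Ainfty_exponent K.
  apply: (@le_trans _ _ ((2 ^- (s * j.+1)) `^ Ainfty_exponent K)).
    have -> : 2 ^- (s * j.+1) = (2 ^- j.+1) `^ s%:R :> R.
      by rewrite powR_mulrn ?invr_ge0 ?ltW// exprVn mulnC exprM.
    have s0 : s%:R != 0 :> R by rewrite pnatr_eq0.
    by rewrite -powRrM /Ainfty_exponent -/s mulfV// powRr1// invr_ge0 ltW.
  apply: ge0_ler_powR; rewrite ?nnegrE ?invr_ge0//; try exact: ltW.
have : 2 ^- j = 2 * 2 ^- j.+1 :> R by rewrite exprS invfM mulrA divff ?mul1r.
by lra.
Qed.

End cube.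
End weight.
End Ainfty.

(** * Reducing matrices *)

Section euclid.
Context (R : realType) (d : nat).
Implicit Types (u v : 'cV[R]_d) (A B M : 'M[R]_d).

Definition ev (i : 'I_d) : 'cV[R]_d := delta_mx i 0.

Lemma enorm_ge0 v : 0 <= enorm v.
Proof. exact: sqrtr_ge0. Qed.

Lemma ler_coord_enorm v i : `|v i 0| <= enorm v.
Proof.
rewrite /enorm -sqrtr_sqr ler_wsqrtr// (bigD1 i)//= lerDl sumr_ge0// => j _.
exact: sqr_ge0.
Qed.

Lemma enormZ (c : R) v : enorm (c *: v) = `|c| * enorm v.
Proof.
rewrite /enorm -sqrtr_sqr -sqrtrM ?sqr_ge0// mulr_sumr; congr Num.sqrt.
by apply: eq_bigr => i _; rewrite mxE exprMn.
Qed.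

Lemma enorm_le_sum v : enorm v <= \sum_i `|v i 0|.
Proof.
have s0 (P : pred 'I_d) : 0 <= \sum_(i | P i) `|v i 0| by exact: sumr_ge0.
rewrite -[leRHS]ger0_norm ?s0// -sqrtr_sqr ler_wsqrtr//.
suff : forall r : seq 'I_d,
    \sum_(i <- r) v i 0 ^+ 2 <= (\sum_(i <- r) `|v i 0|) ^+ 2 by exact.
elim=> [|i r IH]; first by rewrite !big_nil expr0n.
rewrite !big_cons sqrrD real_normK ?num_real// -addrA lerD2l.
by apply: le_trans IH _; rewrite lerDr mulrn_wge0// mulr_ge0// sumr_ge0.
Qed.

Lemma mulmx_ev A i : A *m ev i = col i A.
Proof. by rewrite /ev -colE. Qed.

Lemma ler_entry_enorm A i j : `|A i j| <= enorm (A *m ev j).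
Proof. by have := ler_coord_enorm (A *m ev j) i; rewrite mulmx_ev mxE. Qed.

Lemma enorm_mulmx_le A v :
  enorm (A *m v) <= d%:R * \sum_i enorm (A *m ev i) * `|v i 0|.
Proof.
apply: le_trans (enorm_le_sum _) _.
rewrite mulr_natl -[X in _ *+ X]card_ord -sumr_const; apply: ler_sum => k _.
rewrite mxE; apply: le_trans (ler_norm_sum _ _ _) _; apply: ler_sum => i _.
by rewrite normrM ler_wpM2r// ler_entry_enorm.
Qed.

Lemma enorm_mulmx_le_enorm A v :
  enorm (A *m v) <= d%:R * (\sum_i enorm (A *m ev i)) * enorm v.
Proof.
apply: le_trans (enorm_mulmx_le _ _) _; rewrite -mulrA ler_wpM2l// mulr_suml.
by apply: ler_sum => i _; rewrite ler_wpM2l ?enorm_ge0// ler_coord_enorm.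
Qed.

Lemma enorm_eq0 v : enorm v = 0 -> v = 0.
Proof.
move=> v0; apply/colP => i; rewrite mxE; apply/eqP; rewrite -normr_le0 -v0.
exact: ler_coord_enorm.
Qed.

Lemma enorm0 : enorm (0 : 'cV[R]_d) = 0.
Proof. by rewrite -(scale0r 0) enormZ normr0 mul0r. Qed.

Lemma enorm_gt0 v : v != 0 -> 0 < enorm v.
Proof.
by move=> v0; rewrite lt_neqAle enorm_ge0 andbT eq_sym; apply: contra_neq v0 => /enorm_eq0.
Qed.

Lemma enorm_ev i : enorm (ev i) = 1.
Proof.
rewrite /enorm (bigD1 i)//= big1 ?addr0; first by rewrite mxE !eqxx expr1n sqrtr1.
by move=> j ji; rewrite mxE (negbTE ji) expr0n.
Qed.

(** The crude entrywise bound shows that the set under [sup] is bounded, so that [opnorm] is a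
    genuine supremum and not a default value. *)
Lemma opnorm_unit_le M v : enorm v = 1 -> enorm (M *m v) <= opnorm M.
Proof.
move=> v1; apply: ub_le_sup; last by exists v.
exists (d%:R * (\sum_i enorm (M *m ev i))) => _ [w /= w1 <-].
by have := enorm_mulmx_le_enorm M w; rewrite w1 mulr1.
Qed.

Lemma opnorm_le M v : enorm (M *m v) <= opnorm M * enorm v.
Proof.
have [->|v0] := eqVneq v 0; first by rewrite mulmx0 enorm0 mulr0.
have e0 := enorm_gt0 v0.
rewrite -ler_pdivrMr// mulrC -[X in X * _]gtr0_norm ?invr_gt0// -enormZ scalemxAr.
by apply: opnorm_unit_le; rewrite enormZ gtr0_norm ?invr_gt0// mulVf// gt_eqF.
Qed.

Lemma ler_entry_opnorm M i j : `|M i j| <= opnorm M.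
Proof.
apply: le_trans (ler_entry_enorm _ _ _) _; apply: opnorm_unit_le; exact: enorm_ev.
Qed.

Lemma enorm_tr_ev_le M j : enorm (M^T *m ev j) <= d%:R * opnorm M.
Proof.
apply: le_trans (enorm_le_sum _) _.
rewrite mulr_natl -[X in _ *+ X]card_ord -sumr_const; apply: ler_sum => i _.
by rewrite mulmx_ev !mxE ler_entry_opnorm.
Qed.

Lemma opnorm_ge0 M : (0 < d)%N -> 0 <= opnorm M.
Proof.
move=> d0; apply: le_trans (opnorm_unit_le M (enorm_ev (Ordinal d0))).
exact: enorm_ge0.
Qed.

Definition replace_col A (i : 'I_d) v : 'M[R]_d :=
  \matrix_(k, j) if j == i then v k 0 else A k j.

(** Cramer's rule: the cofactors along column [i] do not see the replaced column. *)
Lemma det_replace_col A i v : A \in unitmx ->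
  \det (replace_col A i v) = \det A * (invmx A *m v) i 0.
Proof.
move=> uA; rewrite (expand_det_col _ i) /invmx uA -scalemxAl mxE.
rewrite mulrA mulfV ?mul1r; last by rewrite -unitfE -unitmxE.
rewrite mxE; apply: eq_bigr => k _; rewrite !mxE eqxx mulrC; congr (_ * _).
rewrite /cofactor; congr (_ * \det _); apply/matrixP => a b; rewrite !mxE.
by rewrite eq_sym (negbTE (neq_lift _ _)).
Qed.

Lemma det_le_entries A (b : R) : 0 <= b -> (forall i j, `|A i j| <= b) ->
  `|\det A| <= (d`!)%:R * b ^+ d.
Proof.
move=> b0 Ab; rewrite /determinant; apply: le_trans (ler_norm_sum _ _ _) _.
rewrite mulr_natl -card_Sn -sumr_const; apply: ler_sum => s _.
rewrite normrM normrX normrN1 expr1n mul1r normr_prod.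
by rewrite -[X in b ^+ X]card_ord -prodr_const; apply: ler_prod => i _; rewrite normr_ge0 Ab.
Qed.

(* Auerbach-type basis: a basis of the unit ball of [N] whose determinant is
   within a factor 2 of the largest possible; Cramer's rule then bounds the
   coordinates, and compactness of the ball is not needed. *)
Lemma near_max_basis (N : 'cV[R]_d -> R) (s c0 : R) :
  0 < s -> 0 < c0 -> (forall v, 0 <= N v) ->
  (forall c v, N (c *: v) = `|c| `^ s * N v) ->
  (forall v j, `|v j 0| `^ s * c0 <= N v) ->
  exists A, [/\ A \in unitmx, forall i, N (A *m ev i) <= 1 &
    forall t v i, 0 < t -> N v <= t `^ s -> `|(invmx A *m v) i 0| <= 2 * t].
Proof.
move=> s0 c00 N0 NZ Nc.
have s_neq0 : s != 0 by rewrite gt_eqF.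
pose ball A := forall i, N (A *m ev i) <= 1.
pose S := [set \det A | A in ball].
pose b := (c0^-1) `^ s^-1.
have b0 : 0 <= b by exact: powR_ge0.
have ballb A i j : ball A -> `|A i j| <= b.
  move=> /(_ j) h; have := le_trans (Nc (A *m ev j) i) h.
  rewrite mulmx_ev mxE -ler_pdivlMr// mul1r => h1.
  rewrite -[leLHS]powRr1// -(mulfV s_neq0) powRrM.
  by apply: ge0_ler_powR => //; rewrite ?nnegrE ?powR_ge0// invr_ge0 ltW.
have ubS : has_ubound S.
  exists ((d`!)%:R * b ^+ d) => _ [A hA <-].
  by apply: le_trans (ler_norm _) _; apply: det_le_entries => // i j; exact: ballb.
(* The scalar matrix [e%:M] lies in [ball], because e^s = 1/m and [m] exceeds every [N (ev i)];
   hence the determinants have a positive supremum. *)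
pose m := 1 + \sum_i N (ev i).
have m1 : 1 <= m by rewrite lerDl sumr_ge0.
have m0 : 0 < m by exact: lt_le_trans m1.
pose e := (m^-1) `^ s^-1.
have e0 : 0 < e by rewrite powR_gt0// invr_gt0.
have Seps : S (e ^+ d).
  exists (e%:M); last by rewrite det_scalar.
  move=> i; rewrite mul_scalar_mx NZ gtr0_norm// /e -powRrM mulVf// powRr1 ?invr_ge0 ?(ltW m0)//.
  rewrite mulrC ler_pdivrMr// mul1r /m (bigD1 i)//= addrCA lerDl addr_ge0//.
  exact: sumr_ge0.
have supS : has_sup S by split => //; exists (e ^+ d).
have M0 : 0 < sup S.
  by apply: lt_le_trans (ub_le_sup ubS Seps); rewrite exprn_gt0.
have [_ [A hA <-] hdet] := sup_adherent (ltac:(lra) : 0 < sup S / 2) supS.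
have hdet' : sup S / 2 < \det A by lra.
have dA0 : 0 < \det A by lra.
have uA : A \in unitmx by rewrite unitmxE unitfE gt_eqF.
exists A; split => // t v i t0 Nv.
(* Putting [c *: v] in place of a column stays in [ball], so the new determinant is at most [sup S],
   which is below [2 * \det A]. *)
have key (c : R) : `|c| = t^-1 -> c * (invmx A *m v) i 0 <= 2.
  move=> hc; rewrite leNgt; apply/negP => h.
  have : S (\det (replace_col A i (c *: v))).
    exists (replace_col A i (c *: v)) => // k.
    have -> : replace_col A i (c *: v) *m ev k = if k == i then c *: v else A *m ev k.
      apply/colP => l; rewrite mulmx_ev !mxE.
      by case: eqP => // _; rewrite ?mulmx_ev !mxE.
    case: eqP => // _; rewrite NZ hc; apply: (@le_trans _ _ (t^-1 `^ s * t `^ s)).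
      by rewrite ler_wpM2l// powR_ge0.
    by rewrite -powRM ?invr_ge0 ?(ltW t0)// mulVf ?powR1 ?gt_eqF.
  move=> /(ub_le_sup ubS); rewrite det_replace_col// -scalemxAr mxE.
  have : \det A * 2 < \det A * (c * (invmx A *m v) i 0) by rewrite ltr_pM2l.
  by lra.
have k1 := key t^-1 (gtr0_norm (ltac:(by rewrite invr_gt0) : 0 < t^-1)).
have k2 := key (- t^-1) (ltac:(by rewrite normrN gtr0_norm// invr_gt0)).
move: k1 k2; rewrite mulNr -mulrN !ler_pdivrMl// ![t * 2]mulrC => k1 k2.
by rewrite ler_norml k1 lerNl k2.
Qed.

End euclid.
Arguments ev {R d} i.

Section measurable_matrix.
Context (R : realType) disp (T : measurableType disp) (d : nat).
Implicit Types (V W : T -> 'M[R]_d).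

Definition mfmx m n (F : T -> 'M[R]_(m, n)) :=
  forall i j, measurable_fun setT (fun x => F x i j).

Lemma mfmx_cst m n (A : 'M[R]_(m, n)) : mfmx (fun=> A).
Proof. by move=> i j; exact: measurable_cst. Qed.

Lemma mfmx_mul m n p (F : T -> 'M[R]_(m, n)) (G : T -> 'M[R]_(n, p)) :
  mfmx F -> mfmx G -> mfmx (fun x => F x *m G x).
Proof.
move=> mF mG i j.
rewrite (_ : (fun x => _) = (fun x => \sum_k F x i k * G x k j)); last first.
  by apply/funext => x; rewrite mxE.
by apply: measurable_sum => k; exact: measurable_funM.
Qed.

Lemma measurable_det n (F : T -> 'M[R]_n) : mfmx F ->
  measurable_fun setT (fun x => \det (F x)).
Proof.
move=> mF; apply: measurable_sum => s; apply: measurable_funM.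
  exact: measurable_cst.
by apply: measurable_prod => i _; exact: mF.
Qed.

Lemma measurable_inv_fun (f : T -> R) : measurable_fun setT f ->
  (forall x, 0 <= f x) -> measurable_fun setT (fun x => (f x)^-1).
Proof.
move=> mf f0; rewrite (_ : (fun x => _) = (fun x => f x `^ (-1))).
  by apply: (measurableT_comp (measurable_powR _)).
by apply/funext => x; rewrite powR_inv1.
Qed.

Lemma posdef_unitmx (A : 'M[R]_d) : posdef_sym A -> A \in unitmx.
Proof.
move=> [_ pA]; rewrite -row_free_unit; apply: inj_row_free => v vA.
apply/eqP; apply: contraT => v0.
have := pA v^T; rewrite trmx_eq0 => /(_ v0).
by rewrite trmxK vA mul0mx mxE ltxx.
Qed.

(** The inverse of the determinant is written as det * (det^2)^-1, since [measurable_inv_fun]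
    applies to nonnegative functions. *)
Lemma mfmx_inv W : mfmx W -> (forall x, W x \in unitmx) ->
  mfmx (fun x => invmx (W x)).
Proof.
move=> mW uW i j.
rewrite (_ : (fun x => _) = (fun x => (\det (W x) * ((\det (W x) ^+ 2)^-1)) * cofactor (W x) j i)).
  apply: measurable_funM.
    apply: measurable_funM; first exact: measurable_det.
    apply: measurable_inv_fun; first by apply: measurable_funX; exact: measurable_det.
    by move=> x; exact: sqr_ge0.
  apply: measurable_funM; first exact: measurable_cst.
  by apply: measurable_det => k l; under eq_fun do rewrite !mxE; exact: mW.
apply/funext => x; rewrite /invmx uW !mxE; congr (_ * _); field.
by rewrite -unitfE -unitmxE uW.
Qed.

Lemma measurable_enorm (F : T -> 'cV[R]_d) : mfmx F ->
  measurable_fun setT (fun x => enorm (F x)).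
Proof.
move=> mF.
rewrite (_ : (fun x => _) = (fun x => (\sum_i F x i 0 ^+ 2) `^ 2^-1)).
  apply: (measurableT_comp (measurable_powR _)).
  by apply: measurable_sum => i; apply: measurable_funX; exact: mF.
apply/funext => x; rewrite powR12_sqrt//.
by apply: sumr_ge0 => i _; exact: sqr_ge0.
Qed.

Lemma measurable_enorm_powR (F : T -> 'cV[R]_d) (s : R) : mfmx F ->
  measurable_fun setT (fun x => enorm (F x) `^ s).
Proof.
by move=> mF; apply: (measurableT_comp (measurable_powR _)); exact: measurable_enorm.
Qed.

Variable (mu : {measure set T -> \bar R}).
Local Open Scope ereal_scope.

Lemma integral_gt0 (Q : set T) (w : T -> R) : measurable Q -> 0 < mu Q ->
  measurable_fun setT w -> (forall x, (0 < w x)%R) ->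
  0 < \int[mu]_(x in Q) (w x)%:E.
Proof.
move=> mQ Q0 mw w0; rewrite lt_neqAle; apply/andP; split; last first.
  by apply: integral_ge0 => x _; rewrite lee_fin ltW.
apply/eqP => /esym h.
have mwE : measurable_fun Q (EFin \o w).
  by apply/measurable_EFinP; exact: measurable_funTS.
have abs0 : \int[mu]_(x in Q) `|(EFin \o w) x| = 0.
  by rewrite -[RHS]h; apply: eq_integral => x _ /=; rewrite gtr0_norm.
have [N [mN N0 hN]] := (ae_eq_integral_abs mu mQ mwE).1 abs0.
move: Q0; rewrite ltNge => /negP; apply; rewrite -N0.
apply: le_measure; rewrite ?inE// => x Qx; apply: hN => /= /(_ Qx) /eqP.
by rewrite eqe gt_eqF.
Qed.

End measurable_matrix.

Section reduction.
Context (R : realType) disp (T : measurableType disp) (d : nat).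
Variables (mu : {measure set T -> \bar R}) (Q : set T) (V : T -> 'M[R]_d) (s : R).
Hypotheses (mQ : measurable Q) (Q0 : (0 < mu Q)%E) (Qoo : (mu Q < +oo)%E).
Hypotheses (mV : mfmx V) (uV : forall x, V x \in unitmx) (s0 : 0 < s).
Hypothesis Vfin : forall v : 'cV[R]_d,
  (\int[mu]_(y in Q) (enorm (V y *m v) `^ s)%:E < +oo)%E.

Let N (v : 'cV[R]_d) : R := fine (\int[mu]_(y in Q) (enorm (V y *m v) `^ s)%:E).

Let mN (v : 'cV[R]_d) : measurable_fun setT (fun y => enorm (V y *m v) `^ s).
Proof. by apply: measurable_enorm_powR; apply: mfmx_mul => //; exact: mfmx_cst. Qed.

Let N_ge0 v : (0 <= \int[mu]_(y in Q) (enorm (V y *m v) `^ s)%:E)%E.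
Proof. by apply: integral_ge0 => y _; rewrite lee_fin powR_ge0. Qed.

Let N_fin v : (\int[mu]_(y in Q) (enorm (V y *m v) `^ s)%:E)%E = (N v)%:E.
Proof. by rewrite fineK// ge0_fin_numE. Qed.

Lemma reducing_matrix : exists A : 'M[R]_d, [/\ A \in unitmx,
  forall i, (\int[mu]_(y in Q) (enorm (V y *m (A *m ev i)) `^ s)%:E <= 1)%E &
  forall t v i, 0 < t ->
    (\int[mu]_(y in Q) (enorm (V y *m v) `^ s)%:E <= (t `^ s)%:E)%E ->
    `|(invmx A *m v) i 0| <= 2 * t].
Proof.
pose g y := d%:R * \sum_i enorm (invmx (V y) *m ev i).
have g0 y : 0 <= g y by rewrite mulr_ge0// sumr_ge0// => i _; exact: enorm_ge0.
(* Since |v| <= g(y) |V(y) v|, the function w(y) |v_j|^s lies below the integrand of [N v], and its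
   integral gives the coercivity constant [c0]. The added 1 keeps [w] at most 1, hence integrable on
   [Q]. *)
pose w y := ((1 + g y)^-1) `^ s.
have g1 y : 0 < 1 + g y by rewrite ltr_pwDl.
have w0 y : 0 < w y by rewrite powR_gt0// invr_gt0.
have w1 y : w y <= 1.
  have -> : 1 = 1 `^ s :> R by rewrite powR1.
  rewrite ge0_ler_powR ?nnegrE ?invr_ge0 ?(ltW s0) ?(ltW (g1 y))//.
  by rewrite invf_le1// lerDl.
have mw : measurable_fun setT w.
  apply: (measurableT_comp (measurable_powR _)); apply: measurable_inv_fun; last by move=> y; exact: ltW.
  apply: measurable_funD; first exact: measurable_cst.
  apply: measurable_funM; first exact: measurable_cst.
  apply: measurable_sum => i; apply: measurable_enorm; apply: mfmx_mul.
    exact: mfmx_inv.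
  exact: mfmx_cst.
have wfin : (\int[mu]_(y in Q) (w y)%:E)%E \is a fin_num.
  rewrite ge0_fin_numE; last by apply: integral_ge0 => y _; rewrite lee_fin ltW.
  apply: le_lt_trans Qoo; rewrite -[leRHS]mul1e -integral_cst//.
  by apply: ge0_le_integral_nomeas => y _; rewrite lee_fin// ltW.
pose c0 := fine (\int[mu]_(y in Q) (w y)%:E)%E.
have c00 : 0 < c0.
  by rewrite -lte_fin fineK//; exact: integral_gt0.
have NZ (c : R) (v : 'cV[R]_d) : N (c *: v) = `|c| `^ s * N v.
  have e : (\int[mu]_(y in Q) (enorm (V y *m (c *: v)) `^ s)%:E =
      (`|c| `^ s)%:E * \int[mu]_(y in Q) (enorm (V y *m v) `^ s)%:E)%E.
    rewrite -ge0_integral_scale ?powR_ge0//; last by move=> y; exact: powR_ge0.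
    by apply: eq_integral => y _; rewrite -scalemxAr enormZ powRM ?enorm_ge0.
  by rewrite /N e (N_fin v) -EFinM.
have Nc (v : 'cV[R]_d) j : `|v j 0| `^ s * c0 <= N v.
  rewrite -lee_fin EFinM -(N_fin v) fineK// -ge0_integral_scale ?powR_ge0//; last first.
    by move=> y; exact: ltW.
  apply: ge0_le_integral_nomeas => y _.
    by rewrite lee_fin mulr_ge0 ?powR_ge0.
  rewrite lee_fin -powRM ?invr_ge0// ?(ltW (g1 y))//.
  apply: ge0_ler_powR; rewrite ?nnegrE ?enorm_ge0 ?divr_ge0 ?(ltW (g1 y)) ?(ltW s0)//.
  rewrite ler_pdivrMr// mulrC.
  apply: le_trans (ler_coord_enorm _ _) _.
  rewrite -[v in leLHS](mulKmx (uV y)).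
  apply: le_trans (enorm_mulmx_le_enorm _ _) _.
  by rewrite ler_wpM2r ?enorm_ge0// lerDr.
have [A [uA hA hA']] := near_max_basis s0 c00 (fun v => fine_ge0 (N_ge0 v)) NZ Nc.
exists A; split => //.
  by move=> i; rewrite (N_fin (A *m ev i)) lee_fin; exact: hA.
by move=> t v i t0; rewrite (N_fin v) lee_fin; exact: hA'.
Qed.

End reduction.

Lemma enorm_tr_le (R : realType) (d : nat) (M : 'M[R]_d) (u : 'cV[R]_d) :
  enorm (M^T *m u) <= d%:R ^+ 3 * opnorm M * enorm u.
Proof.
apply: le_trans (enorm_mulmx_le_enorm _ _) _; rewrite ler_wpM2r ?enorm_ge0//.
rewrite exprS expr2 -!mulrA ler_wpM2l// mulr_natl -[X in _ *+ X]card_ord -sumr_const.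
by apply: ler_sum => i _; exact: enorm_tr_ev_le.
Qed.

Section reduction_Apq.
Context (R : realType) disp (T : measurableType disp) (d : nat).
Variables (mu : {measure set T -> \bar R}) (Q : set T) (W : T -> 'M[R]_d).
Variables (vq H : R).
Hypotheses (d0 : (0 < d)%N) (mQ : measurable Q) (vq0 : 0 < vq) (Qvq : mu Q = vq%:E).
Hypotheses (mW : mfmx W) (pW : forall x, posdef_sym (W x)).

Let uW x : W x \in unitmx. Proof. exact: posdef_unitmx. Qed.
Let Q0 : (0 < mu Q)%E. Proof. by rewrite Qvq lte_fin. Qed.
Let Qoo : (mu Q < +oo)%E. Proof. by rewrite Qvq ltry. Qed.
Let d1 : 1 <= d%:R :> R. Proof. by rewrite ler1n. Qed.
Let d0R : 0 < d%:R :> R. Proof. by rewrite ltr0n. Qed.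

Lemma exists_in_of_ae (P : T -> Prop) : (\forall x \ae mu, Q x -> P x) -> exists2 x, Q x & P x.
Proof.
move=> [N [mN N0 hN]]; apply: contrapT => nex.
move: Q0; rewrite ltNge => /negP; apply; rewrite -N0.
apply: le_measure; rewrite ?inE// => x Qx; apply: hN => /= h.
by apply: nex; exists x => //; exact: h.
Qed.

(** In the applications [k] is an operator norm, so the constant is moved to the integral of the
    measurable function [h]. *)
Lemma integral_powR_le (h k : T -> R) (c s : R) : measurable_fun setT h ->
  (forall x, 0 <= h x) -> 0 < c -> 0 < s -> (forall x, h x <= c * k x) ->
  (\int[mu]_(x in Q) (h x `^ s)%:E <=
   (c `^ s)%:E * \int[mu]_(x in Q) (k x `^ s)%:E)%E.
Proof.
move=> mh h0 c0 s0 hk.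
have mhs : measurable_fun setT (fun x => h x `^ s).
  exact: (measurableT_comp (measurable_powR _)).
have cs0 : 0 < c `^ s by exact: powR_gt0.
rewrite muleC -lee_pdivrMr// muleC -ge0_integral_scale ?invr_ge0 ?(ltW cs0)//; last first.
  by move=> x; exact: powR_ge0.
apply: ge0_le_integral_nomeas => x _; rewrite lee_fin.
  by rewrite mulr_ge0 ?invr_ge0 ?powR_ge0.
rewrite mulrC ler_pdivrMr// mulrC -powRM ?(ltW c0)//; last first.
  by have := le_trans (h0 x) (hk x); rewrite pmulr_rge0.
by apply: ge0_ler_powR; rewrite ?nnegrE ?(ltW s0)//; exact: le_trans (hk x).
Qed.

Lemma integral_opnorm_gt0 (M : T -> 'M[R]_d) (s : R) : mfmx M ->
  (forall x, M x \in unitmx) -> 0 < s ->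
  (0 < \int[mu]_(x in Q) (opnorm (M x) `^ s)%:E)%E.
Proof.
move=> mM uM s0; pose i := Ordinal d0.
have me : measurable_fun setT (fun x => enorm (M x *m ev i)).
  by apply: measurable_enorm; apply: mfmx_mul => //; exact: mfmx_cst.
have ei : ev i != 0 :> 'cV[R]_d.
  by apply/eqP => e0; have := enorm_ev R i; rewrite e0 enorm0 => /esym/eqP; rewrite oner_eq0.
apply: (@lt_le_trans _ _ (\int[mu]_(x in Q) (enorm (M x *m ev i) `^ s)%:E)%E).
  apply: integral_gt0 => //; first exact: (measurableT_comp (measurable_powR _)).
  move=> x; apply: powR_gt0; apply: enorm_gt0; apply: contra_neq ei => e0.
  by rewrite -(mulKmx (uM x) (ev i)) e0 mulmx0.
apply: ge0_le_integral_nomeas => x _; rewrite lee_fin ?powR_ge0//.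
apply: ge0_ler_powR; rewrite ?nnegrE ?enorm_ge0 ?opnorm_ge0 ?(ltW s0)//.
by apply: opnorm_unit_le; exact: enorm_ev.
Qed.

Section exponent_one.
Variables (q : R).
Hypotheses (q0 : 0 < q).
Hypothesis Apq1 : \forall x \ae mu, Q x ->
  (vq^-1%:E * \int[mu]_(y in Q) (opnorm (W y *m invmx (W x)) `^ q)%:E <= H%:E)%E.

Let mWx x : mfmx (fun y => W y *m invmx (W x)).
Proof. by apply: mfmx_mul => //; exact: mfmx_cst. Qed.

Let Iop x := (\int[mu]_(y in Q) (opnorm (W y *m invmx (W x)) `^ q)%:E)%E.

(** [B] is the inverse of a reducing matrix A of [W] for the exponent [q]. For almost every x, the
    condition bounds the integral over y of |W(y) W(x)^-1 f(x)|^q by H |Q| |f(x)|^q, and the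
    defining property of A turns this into a bound on the coordinates of A^-1 W(x)^-1 f(x). *)
Lemma reduction_eq1 : exists (B : 'M[R]_d) (c1 c2 : R),
  [/\ [/\ 0 < H, 0 < c1, 0 < c2 & B \in unitmx],
   c1 `^ q^-1 * c2 <= 4 * d%:R ^+ 6 * (H * vq) `^ q^-1,
   forall i, (\int[mu]_(x in Q) (enorm (W x *m (invmx B *m ev i)) `^ q)%:E <= c1%:E)%E &
   forall (f : T -> 'cV[R]_d) (F : R), mfmx f -> 0 < F ->
     (\int[mu]_(x in Q) (enorm (f x))%:E <= F%:E)%E ->
     (\int[mu]_(x in Q) (enorm (B *m (invmx (W x) *m f x)))%:E <= (c2 * F)%:E)%E].
Proof.
have Ile x : (vq^-1%:E * Iop x <= H%:E)%E -> (Iop x <= (H * vq)%:E)%E.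
  by rewrite muleC -lee_pdivlMr ?invr_gt0// invrK -EFinM.
have [x0 Qx0 /Ile Ix0] := exists_in_of_ae Apq1.
have I0 x : (0 < Iop x)%E.
  apply: integral_opnorm_gt0 => // y; rewrite unitmx_mul uW/=.
  by rewrite unitmx_inv.
have Hvq0 : 0 < H * vq by rewrite -lte_fin; exact: lt_le_trans (I0 x0) Ix0.
have H0 : 0 < H by move: Hvq0; rewrite pmulr_lgt0.
have dom x (v : 'cV[R]_d) c : 0 < c -> enorm v <= c ->
    (\int[mu]_(y in Q) (enorm (W y *m (invmx (W x) *m v)) `^ q)%:E <= (c `^ q)%:E * Iop x)%E.
  move=> c0 vc; apply: integral_powR_le => //.
  - by apply: measurable_enorm; apply: mfmx_mul => //; exact: mfmx_cst.
  - by move=> y; exact: enorm_ge0.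
  - move=> y; rewrite mulmxA; apply: le_trans (opnorm_le _ _) _.
    by rewrite mulrC ler_wpM2r// opnorm_ge0.
have Vfin (v : 'cV[R]_d) : (\int[mu]_(y in Q) (enorm (W y *m v) `^ q)%:E < +oo)%E.
  rewrite -[v](mulKmx (uW x0)).
  have c0 : 0 < 1 + enorm (W x0 *m v) by rewrite ltr_pwDl// enorm_ge0.
  apply: le_lt_trans (dom x0 _ _ c0 _) _; first by rewrite lerDr.
  apply: le_lt_trans (lee_wpmul2l _ Ix0) _; first by rewrite lee_fin powR_ge0.
  by rewrite -EFinM ltry.
have [A [uA hA hA']] := reducing_matrix mQ Q0 Qoo mW uW q0 Vfin.
have hq0 : 0 < (H * vq) `^ q^-1 by exact: powR_gt0.
exists (invmx A), 1, (2 * d%:R * (H * vq) `^ q^-1); split.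
- by split => //; rewrite ?mulr_gt0// unitmx_inv.
- rewrite powR1 mul1r ler_wpM2r ?(ltW hq0)//.
  have : d%:R <= d%:R ^+ 6 :> R by rewrite exprS ler_peMr ?(ltW d0R)// exprn_ege1.
  by move: d0R; lra.
- by rewrite invmxK.
move=> f F mf F0 hF.
have mE : measurable_fun setT (fun x => enorm (f x)) by exact: measurable_enorm.
apply: (@le_trans _ _ (\int[mu]_(x in Q) (2 * d%:R * (H * vq) `^ q^-1 * enorm (f x))%:E)%E).
  apply: ae_ge0_le_integral => //.
  - by move=> x _; rewrite lee_fin enorm_ge0.
  - apply/measurable_EFinP; apply: measurable_funTS; apply: measurable_enorm.
    apply: mfmx_mul; first exact: mfmx_cst.
    by apply: mfmx_mul => //; exact: mfmx_inv.
  - by move=> x _; rewrite lee_fin mulr_ge0 ?enorm_ge0// ltW// !mulr_gt0.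
  - apply/measurable_EFinP; apply: measurable_funTS.
    by apply: measurable_funM => //; exact: measurable_cst.
  apply: filterS Apq1 => x hx Qx; rewrite lee_fin.
  have /Ile Ix := hx Qx.
  have [f0|f0] := eqVneq (f x) 0; first by rewrite f0 !mulmx0 enorm0 mulr0.
  have ef0 := enorm_gt0 f0.
  apply: le_trans (enorm_le_sum _) _.
  have -> : 2 * d%:R * (H * vq) `^ q^-1 * enorm (f x) =
    \sum_(i < d) 2 * ((H * vq) `^ q^-1 * enorm (f x)).
    by rewrite sumr_const card_ord -mulr_natl; ring.
  apply: ler_sum => i _; apply: hA'; first by rewrite mulr_gt0.
  apply: le_trans (dom x _ _ ef0 (lexx _)) _.
  apply: le_trans (lee_wpmul2l _ Ix) _; first by rewrite lee_fin powR_ge0.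
  rewrite -EFinM lee_fin powRM ?(ltW hq0) ?enorm_ge0//.
  by rewrite -powRrM mulVf ?gt_eqF// powRr1 ?(ltW Hvq0)// mulrC.
rewrite ge0_integral_scale//; last 2 first.
- by move=> x; exact: enorm_ge0.
- by rewrite ltW// !mulr_gt0.
by rewrite [leRHS]EFinM lee_wpmul2l// lee_fin ltW// !mulr_gt0.
Qed.

End exponent_one.

Section exponent_gt1.
Variables (p q : R).
Hypotheses (p1 : 1 < p) (q0 : 0 < q).
Let p' : R := (1 - p^-1)^-1.
Let J x := (\int[mu]_(y in Q) (opnorm (W x *m invmx (W y)) `^ p')%:E)%E.
Hypothesis ApqP :
  (vq^-1%:E * \int[mu]_(x in Q) ((vq^-1%:E * J x) `^ (q / p')) <= H%:E)%E.

(** Here A reduces W^-1 for the exponent p', and [B] is its transpose. As [W] is symmetric, W(y)^-1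
    W(x) is the transpose of W(x) W(y)^-1, so [J x] bounds the coordinates of A^-1 W(x) e_j, which
    are the entries of W(x) B^-1. The integral of |B W^-1 f| is bounded by Hoelder's inequality,
    since each |W^-1 A e_j|^p' has integral at most 1. *)
Lemma reduction_gt1 : exists (B : 'M[R]_d) (c1 c2 : R),
  [/\ [/\ 0 < H, 0 < c1, 0 < c2 & B \in unitmx],
   c1 `^ q^-1 * c2 <= 4 * d%:R ^+ 6 * (H * vq) `^ q^-1 * vq `^ (1 - p^-1),
   forall i, (\int[mu]_(x in Q) (enorm (W x *m (invmx B *m ev i)) `^ q)%:E <= c1%:E)%E &
   forall (f : T -> 'cV[R]_d) (F : R), mfmx f -> 0 < F ->
     (\int[mu]_(x in Q) (enorm (f x) `^ p)%:E <= F%:E)%E ->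
     (\int[mu]_(x in Q) (enorm (B *m (invmx (W x) *m f x)))%:E <= (c2 * F `^ p^-1)%:E)%E].
Proof.
have p0 : 0 < p by exact: lt_trans p1.
have ip1 : 0 < 1 - p^-1 by rewrite subr_gt0 invf_lt1.
have p'0 : 0 < p' by rewrite invr_gt0.
have qp0 : 0 < q / p' by rewrite divr_gt0.
have symW x : (W x)^T = W x := (pW x).1.
have symiW x : (invmx (W x))^T = invmx (W x) by rewrite trmx_inv symW.
have mWx x : mfmx (fun y => W x *m invmx (W y)).
  by apply: mfmx_mul; [exact: mfmx_cst|exact: mfmx_inv].
have J0 x : (0 < J x)%E.
  by apply: integral_opnorm_gt0 => // y; rewrite unitmx_mul uW/= unitmx_inv.
have d3 : 0 < d%:R ^+ 3 :> R by rewrite exprn_gt0.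
have dom x (u : 'cV[R]_d) c : 0 < c -> d%:R ^+ 3 * enorm u <= c ->
    (\int[mu]_(y in Q) (enorm (invmx (W y) *m (W x *m u)) `^ p')%:E <= (c `^ p')%:E * J x)%E.
  move=> c0 uc; apply: integral_powR_le => //.
  - apply: measurable_enorm; apply: mfmx_mul; [exact: mfmx_inv|exact: mfmx_cst].
  - by move=> y; exact: enorm_ge0.
  - move=> y; rewrite mulmxA -[invmx _]symiW -[W x in X in enorm (X *m _)]symW -trmx_mul.
    apply: le_trans (enorm_tr_le _ _) _.
    by rewrite symiW mulrAC; apply: ler_wpM2r => //; exact: opnorm_ge0.
(* If [J] were infinite on all of [Q], so would be the integral in [ApqP]. One finite value yields
   the local integrability of W^-1 that [reducing_matrix] requires. *)
have [x0 Qx0 Jx0] : exists2 x0, Q x0 & (J x0 < +oo)%E.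
  apply: contrapT => nex.
  have Joo x : Q x -> J x = +oo%E.
    by move=> Qx; apply/eqP; rewrite eq_le leey leNgt; apply/negP => h; apply: nex; exists x.
  have : (\int[mu]_(x in Q) ((vq^-1%:E * J x) `^ (q / p')) = +oo)%E.
    transitivity (\int[mu]_(x in Q) (cst +oo%E x))%E.
      apply: eq_integral => x /set_mem Qx; rewrite (Joo _ Qx) gt0_muley ?lte_fin ?invr_gt0//.
      by rewrite poweRyr// gt_eqF.
    by rewrite (integral_cst mu mQ +oo%E) gt0_mulye.
  by move=> h; move: ApqP; rewrite h gt0_muley ?lte_fin ?invr_gt0.
have Jfin : J x0 \is a fin_num by rewrite ge0_fin_numE// ltW.
have Vfin (v : 'cV[R]_d) : (\int[mu]_(y in Q) (enorm (invmx (W y) *m v) `^ p')%:E < +oo)%E.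
  rewrite -[v](mulKVmx (uW x0)).
  set u := invmx _ *m v.
  have c0 : 0 < 1 + d%:R ^+ 3 * enorm u by rewrite ltr_pwDl// mulr_ge0 ?enorm_ge0 ?ltW.
  apply: le_lt_trans (dom x0 _ _ c0 _) _; first by rewrite lerDr.
  by rewrite -(fineK Jfin) -EFinM ltry.
have miW : mfmx (fun y => invmx (W y)) by exact: mfmx_inv.
have uiW x : invmx (W x) \in unitmx by rewrite unitmx_inv.
have [A [uA hA hA']] := reducing_matrix mQ Q0 Qoo miW uiW p'0 Vfin.
(* The first factor collects the dimensional losses in the entries of W(x) B^-1; the second undoes
   the averaging of [J x]. *)
pose K : R := (2 * d%:R ^+ 4) `^ q * vq `^ (q / p').
have K0 : 0 < K by rewrite mulr_gt0// powR_gt0// mulr_gt0// exprn_gt0.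
have invB : invmx A^T = (invmx A)^T by rewrite trmx_inv.
have ptw x i : (Q x -> (K^-1 * enorm (W x *m (invmx A^T *m ev i)) `^ q)%:E <=
    (vq^-1%:E * J x) `^ (q / p'))%E.
  move=> _; have [Jx|Jx] := ltP (J x) +oo%E; last first.
    move: Jx; rewrite leye_eq => /eqP ->.
    by rewrite gt0_muley ?lte_fin ?invr_gt0// poweRyr ?leey// gt_eqF.
  have Jxf : J x \is a fin_num by rewrite ge0_fin_numE// ltW.
  move: (J0 x); rewrite -(fineK Jxf); set r := fine (J x); rewrite lte_fin => r0.
  rewrite -EFinM poweR_EFin lee_fin ler_pdivrMl//.
  have r1 : 0 < r `^ p'^-1 by exact: powR_gt0.
  apply: (@le_trans _ _ ((2 * d%:R ^+ 4 * r `^ p'^-1) `^ q)).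
    apply: ge0_ler_powR; rewrite ?nnegrE ?enorm_ge0 ?(ltW q0)//.
      by rewrite mulr_ge0 ?(ltW r1)// mulr_ge0// exprn_ge0.
    apply: le_trans (enorm_le_sum _) _.
    have -> : 2 * d%:R ^+ 4 * r `^ p'^-1 = \sum_(j < d) 2 * (d%:R ^+ 3 * r `^ p'^-1).
      by rewrite sumr_const card_ord -mulr_natl exprS; ring.
    apply: ler_sum => j _.
    have -> : (W x *m (invmx A^T *m ev i)) j 0 = (invmx A *m (W x *m ev j)) i 0.
      rewrite !mulmxA !mulmx_ev invB -{1}(symW x) -trmx_mul.
      by rewrite !mxE.
    apply: hA'; first by rewrite mulr_gt0.
    apply: le_trans (dom x _ _ d3 _) _; first by rewrite enorm_ev mulr1.
    rewrite -(fineK Jxf) -/r -EFinM lee_fin powRM ?(ltW d3) ?(ltW r1)//.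
    by rewrite -[(r `^ _) `^ _]powRrM mulVf ?gt_eqF// powRr1 ?(ltW r0).
  rewrite powRM ?(ltW r1)//.
  rewrite -powRrM [p'^-1 * q]mulrC /K -mulrA ler_wpM2l ?powR_ge0//.
  rewrite -powRM ?(ltW vq0)//; last by rewrite mulr_ge0 ?invr_ge0 ?(ltW vq0) ?(ltW r0).
  by rewrite mulrA divff ?mul1r// gt_eqF.
have meWB i : measurable_fun setT (fun x => enorm (W x *m (invmx A^T *m ev i)) `^ q).
  by apply: measurable_enorm_powR; apply: mfmx_mul => //; exact: mfmx_cst.
have intWB i : (\int[mu]_(x in Q) (enorm (W x *m (invmx A^T *m ev i)) `^ q)%:E <=
    (K * (H * vq))%:E)%E.
  have : (\int[mu]_(x in Q) (K^-1 * enorm (W x *m (invmx A^T *m ev i)) `^ q)%:E <=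
     (H * vq)%:E)%E.
    apply: (@le_trans _ _ (\int[mu]_(x in Q) ((vq^-1%:E * J x) `^ (q / p')))%E).
      apply: ge0_le_integral_nomeas => x Qx; last exact: ptw.
      by rewrite lee_fin mulr_ge0 ?powR_ge0// invr_ge0 ltW.
    move: ApqP; set I := (\int[mu]_(x in Q) _)%E.
    by rewrite [(_ * I)%E]muleC -lee_pdivlMr ?invr_gt0// invrK -EFinM.
  rewrite ge0_integral_scale ?invr_ge0 ?(ltW K0)//; last by move=> x; exact: powR_ge0.
  by rewrite muleC -lee_pdivlMr ?invr_gt0// invrK -EFinM [H * vq * K]mulrC.
have uAT : A^T \in unitmx by rewrite unitmx_tr.
have Hvq0 : 0 < H * vq.
  pose i := Ordinal d0.
  have : (0 < \int[mu]_(x in Q) (enorm (W x *m (invmx A^T *m ev i)) `^ q)%:E)%E.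
    apply: integral_gt0 => // x; apply: powR_gt0; apply: enorm_gt0.
    apply/eqP => h; have := enorm_ev R i.
    rewrite -(mulKVmx uAT (ev i)) -(mulKmx (uW x) (invmx _ *m _)) h !mulmx0 enorm0.
    by move/esym/eqP; rewrite oner_eq0.
  by move=> /lt_le_trans/(_ (intWB i)); rewrite lte_fin pmulr_rgt0.
have H0 : 0 < H by move: Hvq0; rewrite pmulr_lgt0.
exists A^T, (K * (H * vq)), (2 * d%:R ^+ 2); split.
- by split => //; rewrite mulr_gt0// exprn_gt0.
- rewrite powRM ?(ltW K0) ?(ltW Hvq0)// /K powRM ?powR_ge0//.
  rewrite -[((2 * _) `^ q) `^ _]powRrM mulfV ?gt_eqF// powRr1; last first.
    by rewrite mulr_ge0// exprn_ge0.
  have e : q / p' * q^-1 = 1 - p^-1 by rewrite mulrAC divff ?gt_eqF// mul1r /p' invrK.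
  rewrite -powRrM e le_eqVlt; apply/orP; left.
  by apply/eqP; rewrite exprS; ring.
- exact: intWB.
move=> f F mf F0 hF.
have ipos : 0 <= 1 - p^-1 <= 1.
  by rewrite (ltW ip1)/= lerBlDr lerDl invr_ge0 ltW.
have mh j : measurable_fun setT (fun y => enorm (invmx (W y) *m (A *m ev j))).
  by apply: measurable_enorm; apply: mfmx_mul => //; exact: mfmx_cst.
have me : measurable_fun setT (fun y => enorm (f y)) by exact: measurable_enorm.
have F1 : 0 <= F `^ p^-1 by exact: powR_ge0.
have hj j : (\int[mu]_(y in Q) (enorm (invmx (W y) *m (A *m ev j)) * enorm (f y))%:E <=
    (2 * F `^ p^-1)%:E)%E.
  have e y : enorm (invmx (W y) *m (A *m ev j)) * enorm (f y) =
      (enorm (invmx (W y) *m (A *m ev j)) `^ p') `^ (1 - p^-1) *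
      (enorm (f y) `^ p) `^ (1 - (1 - p^-1)).
    rewrite subKr -!powRrM mulVf ?gt_eqF// mulfV ?gt_eqF//.
    by rewrite !powRr1 ?enorm_ge0.
  under eq_integral => y _ do rewrite e.
  have -> : 2 * F `^ p^-1 = 2 * (1 `^ (1 - p^-1) * F `^ (1 - (1 - p^-1))).
    by rewrite subKr powR1 mul1r.
  apply: integral_interp_le => //.
  - by apply: measurable_funTS; exact: (measurableT_comp (measurable_powR _)).
  - by apply: measurable_funTS; exact: (measurableT_comp (measurable_powR _)).
  - by move=> y _; exact: powR_ge0.
  - by move=> y _; exact: powR_ge0.
apply: (@le_trans _ _ (\int[mu]_(y in Q) (\sum_(j < d)
   d%:R * (enorm (invmx (W y) *m (A *m ev j)) * enorm (f y)))%:E)%E).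
  apply: ge0_le_integral_nomeas => y _; rewrite lee_fin ?enorm_ge0//.
  apply: le_trans (enorm_le_sum _) _; apply: ler_sum => j _.
  rewrite mulmxA mxE; apply: le_trans (ler_norm_sum _ _ _) _.
  rewrite mulr_natl -[X in _ *+ X]card_ord -sumr_const; apply: ler_sum => i _.
  rewrite normrM ler_pM// ?ler_coord_enorm//.
  have -> : (A^T *m invmx (W y)) j i = (invmx (W y) *m A) i j.
    by rewrite -{1}(symiW y) -trmx_mul mxE.
  by apply: le_trans (ler_entry_enorm _ _ _) _; rewrite mulmxA.
under eq_integral do rewrite -sumEFin.
rewrite ge0_integral_sum//; last 2 first.
- move=> j; apply/measurable_EFinP; apply: measurable_funTS.
  by apply: measurable_funM; [exact: measurable_cst|exact: measurable_funM].
- by move=> j y _; rewrite lee_fin !mulr_ge0 ?enorm_ge0.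
have -> : 2 * d%:R ^+ 2 * F `^ p^-1 = \sum_(j < d) d%:R * (2 * F `^ p^-1).
  by rewrite sumr_const card_ord -mulr_natl; ring.
rewrite -sumEFin; apply: lee_sum => j _.
rewrite ge0_integral_scale//; last 2 first.
- exact: measurable_funM.
- by move=> y; rewrite mulr_ge0 ?enorm_ge0.
by rewrite EFinM lee_wpmul2l// lee_fin.
Qed.

End exponent_gt1.

End reduction_Apq.

(** * One scale of the kernel *)

Section abstract_estimates.
Context (R : realType) disp (T : measurableType disp).
Variables (mu : {measure set T -> \bar R}).

Lemma Rintegral_lincomb (I : Type) (r : seq I) (c : I -> R) (h : I -> T -> R) :
  (forall j, mu.-integrable setT (EFin \o h j)) ->
  mu.-integrable setT (EFin \o (fun y => \sum_(j <- r) c j * h j y)) /\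
  \sum_(j <- r) c j * \int[mu]_y h j y = \int[mu]_y (\sum_(j <- r) c j * h j y).
Proof.
move=> ih; elim: r => [|j r [IH1 IH2]].
  split.
    under eq_fun do rewrite big_nil; exact: integrable0.
  rewrite big_nil; under eq_Rintegral do rewrite big_nil.
  by rewrite Rintegral_cst// mul0r.
have hj : mu.-integrable setT (EFin \o (fun y => c j * h j y)).
  exact: (integrableZl _ _ (ih j)).
split.
  under eq_fun do rewrite big_cons.
  exact: (integrableD _ hj IH1).
rewrite big_cons IH2 -RintegralZl// -RintegralD//.
by apply: eq_Rintegral => y _; rewrite big_cons.
Qed.

(** If the right-hand integral is infinite, the inequality holds whatever default values the
    components take. Otherwise invertibility of [A] makes each component integrable, and [A]
    commutes with the integral. *)
Lemma enorm_integral_le (d : nat) (A : 'M[R]_d) (g : T -> 'cV[R]_d) (k : T -> R) :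
  (0 < d)%N ->
  A \in unitmx -> mfmx g -> measurable_fun setT k -> (forall y, 0 <= k y) ->
  ((enorm (A *m \col_i \int[mu]_y (g y i 0 * k y)))%:E <=
   d%:R%:E * \int[mu]_y (enorm (A *m g y) * k y)%:E)%E.
Proof.
move=> d0 uA mg mk k0.
have mAg : mfmx (fun y => A *m g y) by apply: mfmx_mul => //; exact: mfmx_cst.
have mphi : measurable_fun setT (fun y => enorm (A *m g y) * k y).
  by apply: measurable_funM => //; exact: measurable_enorm.
have phi0 y : 0 <= enorm (A *m g y) * k y by rewrite mulr_ge0 ?enorm_ge0.
have [Ioo|Ioo] := ltP (\int[mu]_y (enorm (A *m g y) * k y)%:E)%E +oo%E; last first.
  move: Ioo; rewrite leye_eq => /eqP ->.
  by rewrite gt0_muley ?leey// lte_fin ltr0n.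
have iphi : mu.-integrable setT (EFin \o (fun y => enorm (A *m g y) * k y)).
  apply/integrableP; split; first exact/measurable_EFinP.
  by under eq_integral do rewrite /= ger0_norm//.
pose c := d%:R * \sum_i enorm (invmx A *m ev i).
have ig j : mu.-integrable setT (EFin \o (fun y => g y j 0 * k y)).
  apply: (le_integrable measurableT _ _ (integrableZl measurableT c iphi)).
    by apply/measurable_EFinP; exact: measurable_funM.
  move=> y _ /=; rewrite lee_fin normrM (ger0_norm (k0 y)).
  rewrite [leRHS]ger0_norm; last first.
    rewrite mulr_ge0// mulr_ge0// sumr_ge0// => i _; exact: enorm_ge0.
  rewrite mulrA ler_wpM2r//; apply: le_trans (ler_coord_enorm _ _) _.
  by rewrite -[g y in leLHS](mulKmx uA); exact: enorm_mulmx_le_enorm.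
pose r : 'cV[R]_d := \col_i \int[mu]_y (g y i 0 * k y).
have key i : ((`|(A *m r) i 0|%R)%:E <= \int[mu]_y (enorm (A *m g y) * k y)%:E)%E.
  have [iG eG] := Rintegral_lincomb (index_enum 'I_d) (fun j => A i j) ig.
  rewrite mxE; under eq_bigr do rewrite mxE.
  rewrite eG; apply: (@le_trans _ _ (\int[mu]_y `|\sum_j A i j * (g y j 0 * k y)|)%:E).
    by rewrite lee_fin; apply: le_normr_Rintegral.
  rewrite /Rintegral fineK; last first.
    by apply: integrable_fin_num => //; exact: (integrable_norm iG).
  apply: ge0_le_integral_nomeas => y _; rewrite lee_fin//.
  under eq_bigr do rewrite mulrA.
  rewrite -mulr_suml normrM (ger0_norm (k0 y)) ler_wpM2r//.
  by have := ler_coord_enorm (A *m g y) i; rewrite mxE.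
apply: (@le_trans _ _ (\sum_(i < d) `|(A *m r) i 0|)%:E).
  by rewrite lee_fin; exact: enorm_le_sum.
rewrite -sumEFin; apply: (@le_trans _ _ (\sum_(i < d) \int[mu]_y (enorm (A *m g y) * k y)%:E)%E).
  by apply: lee_sum => i _; exact: key.
have Ifin : (\int[mu]_y (enorm (A *m g y) * k y)%:E)%E \is a fin_num.
  by rewrite ge0_fin_numE//; apply: integral_ge0 => y _; rewrite lee_fin.
by rewrite -(fineK Ifin) sumEFin sumr_const card_ord -EFinM mulr_natl.
Qed.

(** The power [tau] of the measure of [E] in a cell is bounded uniformly by m^tau. The remaining
    powers 1 - 1/p and 1/p are the conjugate exponents with which the measures and the masses [F j]
    are summed. *)
Lemma sum_cells_le (E : set T) (C : nat -> set T) (G : nat -> T -> R) (F : nat -> R)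
    (p tau D m e Ftot : R) :
  measurable E -> (forall j, measurable (C j)) -> trivIset setT C ->
  (forall j, measurable_fun setT (G j)) -> (forall j x, 0 <= G j x) ->
  1 <= p -> 0 < tau -> 0 <= D -> 0 < e -> 0 < Ftot ->
  mu E = e%:E -> (forall j, (mu (E `&` C j) <= m%:E)%E) ->
  (forall j, 0 <= F j) -> (\sum_(0 <= j <oo) (F j)%:E <= Ftot%:E)%E ->
  (forall j, 0 < fine (mu (E `&` C j)) -> (\int[mu]_(x in E `&` C j) (G j x)%:E <=
    (D * fine (mu (E `&` C j)) `^ (tau + (1 - p^-1)) * F j `^ p^-1)%:E)%E) ->
  (\int[mu]_(x in E) (\sum_(0 <= j <oo) ((\1_(C j) x) * G j x)%:E) <=
   (2 * D * m `^ tau * (e `^ (1 - p^-1) * Ftot `^ p^-1))%:E)%E.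
Proof.
move=> mE mC tC mG G0 p1 tau0 D0 e0 Ft0 Ee Em F0 FF HG.
have p0 : 0 < p by exact: lt_le_trans p1.
have ip : 0 <= 1 - p^-1 <= 1.
  by rewrite subr_ge0 invf_le1// p1/= lerBlDr lerDl invr_ge0 ltW.
have mEC j : measurable (E `&` C j) by exact: measurableI.
pose ee j := fine (mu (E `&` C j)).
have ECfin j : mu (E `&` C j) \is a fin_num.
  rewrite ge0_fin_numE//; apply: (@le_lt_trans _ _ (mu E)); last by rewrite Ee ltry.
  by apply: le_measure; rewrite ?inE//; exact: subIsetl.
have ee0 j : 0 <= ee j by rewrite fine_ge0.
have eem j : ee j <= m by rewrite -lee_fin fineK.
have m0 : 0 <= m := le_trans (ee0 0%N) (eem 0%N).
rewrite integral_nneseries//; last 2 first.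
- move=> j; apply/measurable_EFinP; apply: measurable_funTS.
  by apply: measurable_funM => //; exact: measurable_indic.
- by move=> j x _; rewrite lee_fin mulr_ge0.
have cell j : (\int[mu]_(x in E) ((\1_(C j) x) * G j x)%:E =
    \int[mu]_(x in E `&` C j) (G j x)%:E)%E.
  rewrite [RHS]integral_mkcondr; apply: eq_integral => x _.
  by rewrite /patch indicE; case: ifP => _; rewrite ?mul1r ?mul0r.
have t0 : 0 <= m `^ tau by exact: powR_ge0.
have bound j : (\int[mu]_(x in E) ((\1_(C j) x) * G j x)%:E <=
    (D * m `^ tau)%:E * (ee j `^ (1 - p^-1) * F j `^ (1 - (1 - p^-1)))%:E)%E.
  rewrite cell subKr; have := ee0 j; rewrite le_eqVlt => /predU1P[ej|ej].
    rewrite null_set_integral//.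
    - by rewrite -EFinM lee_fin !mulr_ge0 ?powR_ge0.
    - by apply/measurable_EFinP; exact: measurable_funTS.
    - by rewrite -(fineK (ECfin j)) -/(ee j) -ej.
  apply: le_trans (HG j ej) _; rewrite -/(ee j) -EFinM lee_fin.
  rewrite powRD; last by rewrite (gt_eqF ej) implybT.
  rewrite !mulrA ler_wpM2r ?powR_ge0// ler_wpM2r ?powR_ge0// ler_wpM2l//.
  by apply: ge0_ler_powR; rewrite ?nnegrE ?(ltW tau0).
apply: (@le_trans _ _ (\sum_(0 <= j <oo)
  ((D * m `^ tau)%:E * (ee j `^ (1 - p^-1) * F j `^ (1 - (1 - p^-1)))%:E))%E).
  apply: lee_nneseries => j _; last exact: bound.
  by move=> _; apply: integral_ge0 => x _; rewrite lee_fin mulr_ge0.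
rewrite nneseriesZl; last by move=> j _; rewrite lee_fin mulr_ge0 ?powR_ge0.
have -> : 2 * D * m `^ tau * (e `^ (1 - p^-1) * Ftot `^ p^-1) =
  D * m `^ tau * (2 * (e `^ (1 - p^-1) * Ftot `^ (1 - (1 - p^-1)))).
  by rewrite subKr; ring.
rewrite [leRHS]EFinM; apply: lee_wpmul2l; first by rewrite lee_fin mulr_ge0.
apply: nneseries_interp_le => //.
under eq_eseriesr do rewrite fineK//.
have mU : measurable (\bigcup_j (E `&` C j)) by exact: bigcupT_measurable.
have tEC : trivIset setT (fun j => E `&` C j) by exact: trivIset_setIl.
rewrite (cvg_lim _ (measure_sigma_additive mEC tEC))//.
rewrite -Ee; apply: le_measure; rewrite ?inE//.
by move=> x [j _ []].
Qed.

End abstract_estimates.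

Section weighted.
Context (R : realType) (n d : nat).
Local Notation Rn := (Rn R n).
Variables (alpha p q : R).
Hypotheses (d_ge1 : (1 <= d)%N) (alpha_gt0 : 0 < alpha) (alpha_lt_n : alpha < n%:R)
  (p_ge1 : 1 <= p) (p_lt : p < n%:R / alpha) (def_q : p^-1 - q^-1 = alpha / n%:R).

Lemma nR_gt0 : 0 < n%:R :> R.
Proof. exact: lt_trans alpha_lt_n. Qed.

Lemma p_gt0 : 0 < p.
Proof. exact: lt_le_trans p_ge1. Qed.

Lemma qV_gt0 : 0 < q^-1.
Proof.
have -> : q^-1 = p^-1 - alpha / n%:R by rewrite -def_q; ring.
rewrite subr_gt0 -[alpha / _]invrK ltf_pV2 ?posrE ?p_gt0//; last first.
  by rewrite invr_gt0 divr_gt0// nR_gt0.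
by rewrite invf_div.
Qed.

Lemma q_gt0 : 0 < q.
Proof. by rewrite -invr_gt0 qV_gt0. Qed.

Lemma qV_lt1 : q^-1 < 1.
Proof.
have : p^-1 <= 1 by rewrite invf_le1// p_gt0.
have : 0 < alpha / n%:R by rewrite divr_gt0// nR_gt0.
by move: def_q; lra.
Qed.

Variables (W : Rn -> 'M[R]_d).
Hypothesis hW : matrix_weight W.

Let mW : mfmx W := hW.2.
Let pW x : posdef_sym (W x) := hW.1 x.
Let uW x : W x \in unitmx. Proof. exact: posdef_unitmx. Qed.

Lemma measurable_weight (v : 'cV[R]_d) :
  measurable_fun setT (fun x => enorm (W x *m v) `^ q).
Proof. by apply: measurable_enorm_powR; apply: mfmx_mul; [exact: mW|exact: mfmx_cst]. Qed.

Lemma weight_gt0 (v : 'cV[R]_d) : v != 0 -> forall x, 0 < enorm (W x *m v) `^ q.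
Proof.
move=> v0 x; apply: powR_gt0; apply: enorm_gt0; apply: contra_neq v0 => h.
by rewrite -(mulKmx (uW x) v) h mulmx0.
Qed.

Lemma leb_cube_gt0 a (l : R) : 0 < l -> (0 < leb (ccube a l : set Rn))%E.
Proof. by move=> l0; rewrite leb_ccube ?(ltW l0)// lte_fin exprn_gt0. Qed.

Section reduction.
Variable H : R.
Hypothesis HW : (Apq_char p q W <= H%:E)%E.

(** The infimum may fail to be attained: the bounds H + 1/(k+1) hold almost everywhere, and
    countably many null sets are discarded. *)
Lemma ess_sup_in_le (Q : set Rn) (g : Rn -> \bar R) :
  (ess_sup_in Q g <= H%:E)%E -> \forall x \ae leb, Q x -> (g x <= H%:E)%E.
Proof.
move=> h; have hk (k : nat) : \forall x \ae leb, Q x -> (g x <= H%:E + k.+1%:R^-1%:E)%E.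
  have : (ess_sup_in Q g < H%:E + k.+1%:R^-1%:E)%E.
    by apply: le_lt_trans h _; rewrite -EFinD lte_fin ltrDl invr_gt0.
  move=> /ereal_inf_lt[y hy yk].
  by apply: filterS hy => x hx Qx; apply: le_trans (hx Qx) _; exact: ltW.
have := ae_foralln hk; apply: filterS => x hx Qx.
apply/lee_addgt0Pr => e e0.
apply: le_trans (hx (Num.truncn e^-1) Qx) _.
rewrite leeD2l// lee_fin invf_ple ?posrE//.
exact: ltW (truncnS_gt _).
Qed.

Lemma Apq_reduction a (l : R) : 0 < l -> exists (B : 'M[R]_d) (c1 c2 : R),
  [/\ [/\ 0 < H, 0 < c1, 0 < c2 & B \in unitmx],
   c1 `^ q^-1 * c2 <= 4 * d%:R ^+ 6 * (H * l ^+ n) `^ q^-1 * (l ^+ n) `^ (1 - p^-1),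
   forall i, (\int[leb]_(x in ccube a l)
      (enorm (W x *m (invmx B *m ev i)) `^ q)%:E <= c1%:E)%E &
   forall (f : Rn -> 'cV[R]_d) (F : R), mfmx f -> 0 < F ->
     (\int[leb]_(x in ccube a l) (enorm (f x) `^ p)%:E <= F%:E)%E ->
     (\int[leb]_(x in ccube a l) (enorm (B *m (invmx (W x) *m f x)))%:E
       <= (c2 * F `^ p^-1)%:E)%E].
Proof.
move=> l0; have ln0 : 0 < l ^+ n by rewrite exprn_gt0.
have mQ := measurable_ccube a l.
have lQ : leb (ccube a l : set Rn) = (l ^+ n)%:E by rewrite leb_ccube// ltW.
have vQ : vol (ccube a l : set Rn) = l ^+ n by rewrite vol_ccube// ltW.
have cQ := is_cube_ccube a l0.
move: HW; rewrite /Apq_char; case: eqP => [p1|/eqP p1] h.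
- have := le_trans (ereal_sup_ubound (ex_intro2 _ _ _ cQ erefl)) h.
  move=> /ess_sup_in_le; rewrite /avg vQ => ae.
  have [B [c1 [c2 [h1 h2 h3 h4]]]] :=
    reduction_eq1 d_ge1 mQ ln0 lQ mW pW q_gt0 ae.
  exists B, c1, c2; split => //.
    by rewrite p1 invr1 subrr powRr0 mulr1.
  move=> f F mf F0 hF; rewrite p1 invr1 powRr1 ?(ltW F0)//.
  apply: h4 => //; apply: le_trans hF; rewrite p1.
  by under [leRHS]eq_integral do rewrite powRr1 ?enorm_ge0//.
- have p1' : 1 < p by rewrite lt_neqAle eq_sym p1.
  have := le_trans (ereal_sup_ubound (ex_intro2 _ _ _ cQ erefl)) h.
  rewrite /avg vQ => h'.
  exact: (reduction_gt1 d_ge1 mQ ln0 lQ mW pW p1' q_gt0 h').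
Qed.

End reduction.

Section Ainfty_constant.
Variable K : R.
Hypotheses (K0 : 0 < K) (KW : (sc_Ainfty_char q W <= K%:E)%E).

(** Clears the denominator in [Ainfty_char]. When the weight has infinite mass on the cube the
    quotient says nothing, but then the right-hand side is infinite because [0 < K]. *)
Lemma sc_Ainfty_FW (v : 'cV[R]_d) : v != 0 -> forall a (l : R), 0 < l ->
  (\int[leb]_(x in ccube a l)
     maximal (fun y => enorm (W y *m v) `^ q * \1_(ccube a l) y)%R x
   <= K%:E * \int[leb]_(x in ccube a l) (enorm (W x *m v) `^ q)%:E)%E.
Proof.
move=> v0 a l l0.
have h1 : (Ainfty_char (fun x => (enorm (W x *m v) `^ q)%R) <= K%:E)%E.
  by apply: le_trans KW; apply: ereal_sup_ubound; exists v.
have := le_trans (ereal_sup_ubound (ex_intro2 _ _ _ (is_cube_ccube a l0) erefl)) h1.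
set J := (\int[leb]_(x in ccube a l) (enorm (W x *m v) `^ q)%:E)%E.
have J0 : (0 < J)%E.
  apply: integral_gt0.
  - exact: measurable_ccube.
  - exact: leb_cube_gt0.
  - exact: measurable_weight.
  - exact: weight_gt0.
have [Joo|Joo _] := ltP J +oo%E; last first.
  move: Joo; rewrite leye_eq => /eqP ->.
  by rewrite gt0_muley ?leey// lte_fin.
have Jfin : J \is a fin_num by rewrite ge0_fin_numE// ltW.
rewrite -(fineK Jfin) in J0 *.
by rewrite inver gt_eqF// lee_pdivrMr.
Qed.

(** On the cube the maximal function is at least the average of the weight over that cube, so its
    integral is at least the mass of the weight. *)
Lemma Ainfty_const_ge1 (v : 'cV[R]_d) a (l : R) : v != 0 -> 0 < l ->
  (\int[leb]_(x in ccube a l) (enorm (W x *m v) `^ q)%:E < +oo)%E -> 1 <= K.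
Proof.
move=> v0 l0; have ln0 : 0 < l ^+ n by rewrite exprn_gt0.
have := sc_Ainfty_FW v0 a l0.
set J := (\int[leb]_(x in ccube a l) (enorm (W x *m v) `^ q)%:E)%E => h Joo.
have J0 : (0 < J)%E.
  apply: integral_gt0.
  - exact: measurable_ccube.
  - exact: leb_cube_gt0.
  - exact: measurable_weight.
  - exact: weight_gt0.
have Jfin : J \is a fin_num by rewrite ge0_fin_numE// ltW.
have : (J <= K%:E * J)%E.
  apply: le_trans h.
  apply: (@le_trans _ _ (\int[leb]_(x in ccube a l) ((l ^+ n)^-1 * fine J)%:E)%E).
    rewrite integral_cst; last exact: measurable_ccube.
    rewrite [X in (_ * X)%E]leb_ccube ?(ltW l0)// -EFinM.
    by rewrite mulrC mulrA divff ?gt_eqF// mul1r fineK.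
  apply: ge0_le_integral_nomeas => x xQ.
    by rewrite lee_fin mulr_ge0 ?invr_ge0 ?(ltW ln0)// fine_ge0// ltW.
  apply: le_trans (maximal_ge _ (is_cube_ccube a l0) xQ).
  rewrite /avg vol_ccube ?(ltW l0)// EFinM fineK// lee_wpmul2l//.
    by rewrite lee_fin invr_ge0 ltW.
  apply: ge0_le_integral_nomeas => y yQ; rewrite lee_fin ?powR_ge0//.
  by rewrite indicE mem_set// mulr1 ger0_norm ?powR_ge0.
move: J0; rewrite -(fineK Jfin) -EFinM lte_fin lee_fin => J0.
by move=> hJ; rewrite -(ler_pM2r J0) mul1r.
Qed.

Section cells.
Variables (H : R) (f : Rn -> 'cV[R]_d).
Hypothesis HW : (Apq_char p q W <= H%:E)%E.
Hypotheses (mf : mfmx f) (fp : (\int[leb]_x (enorm (f x) `^ p)%:E < +oo)%E).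

Let theta := Ainfty_exponent n K / q.

Lemma Ainfty_exponent_gt0 : 0 < Ainfty_exponent n K.
Proof. by rewrite invr_gt0 ltr0n. Qed.

Lemma theta_gt0 : 0 < theta.
Proof. by rewrite divr_gt0 ?Ainfty_exponent_gt0// q_gt0. Qed.

Lemma measurable_f_powR : measurable_fun setT (fun x => enorm (f x) `^ p).
Proof. exact: measurable_enorm_powR. Qed.

Lemma f_powR_ge0 x : 0 <= enorm (f x) `^ p.
Proof. exact: powR_ge0. Qed.

Let nuf : {measure set Rn -> \bar R} := density leb measurable_f_powR f_powR_ge0.

Definition kernel_term (x y : Rn) : R := enorm (W x *m (invmx (W y) *m f y)).

(** [G] is a constant in x, the integral of |B W^-1 f| over the neighbourhood, times a sum of |W(x)
    beta_i|. The decay on the cube of side [3 * l] bounds the integral of |W beta_i|^q over the part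
    of [E] in the cell, and Hoelder's inequality passes from exponent q to 1. The powers add up
    because theta + (1 - 1/q) = alpha/n + theta + (1 - 1/p). *)
Lemma cell_data (l : R) (z : {ffun 'I_n -> int}) : 0 < l ->
  exists G : Rn -> R, [/\ measurable_fun setT G, forall x, 0 <= G x,
    forall x, (\int[leb]_(y in neighbourhood l z) (kernel_term x y)%:E <= (G x)%:E)%E &
    forall E : set Rn, measurable E -> 0 < fine (leb (E `&` cell l z)) ->
      (\int[leb]_(x in E `&` cell l z) (G x)%:E <=
        (32 * d%:R ^+ 8 * (H * (3 * l) ^+ n) `^ q^-1 * ((3 * l) ^+ n) `^ (1 - p^-1)
          / ((3 * l) ^+ n) `^ theta
         * fine (leb (E `&` cell l z)) `^ (alpha / n%:R + theta + (1 - p^-1))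
         * fine (nuf (neighbourhood l z)) `^ p^-1)%:E)%E].
Proof.
move=> l0; have l30 : 0 < 3 * l by rewrite mulr_gt0.
set v := (3 * l) ^+ n; have v0 : 0 < v by rewrite exprn_gt0.
have [B [c1 [c2 [[H0 c10 c20 uB] hc hW1 hf]]]] := Apq_reduction HW (neighbourhood_corner l z) l30.
set Q := neighbourhood l z.
have mQ : measurable Q by exact: measurable_ccube.
set F := fine (nuf Q).
have nufin : nuf Q \is a fin_num.
  rewrite ge0_fin_numE; last exact: measure_ge0.
  apply: le_lt_trans fp; apply: ge0_subset_integral_EFin.
  - exact: mQ.
  - exact: measurableT.
  - exact: measurable_f_powR.
  - exact: f_powR_ge0.
  - by [].
have F0 : 0 <= F by apply: fine_ge0; exact: measure_ge0.
pose h y := enorm (B *m (invmx (W y) *m f y)).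
have mh : measurable_fun setT h.
  apply: measurable_enorm; apply: mfmx_mul; first exact: mfmx_cst.
  by apply: mfmx_mul; [apply: mfmx_inv; [exact: mW|exact: uW]|exact: mf].
have h0 y : 0 <= h y by exact: enorm_ge0.
have hb F' : 0 < F' -> F <= F' -> (\int[leb]_(y in Q) (h y)%:E <= (c2 * F' `^ p^-1)%:E)%E.
  move=> F'0 FF'; apply: hf => //.
  by rewrite -[X in (X <= _)%E]/(nuf Q) -(fineK nufin) lee_fin.
(* [hf] asks for a positive bound on the mass of [f]. When this mass is 0, arbitrarily small bounds
   are used, scaled so that the error is [e]. *)
have bF : (\int[leb]_(y in Q) (h y)%:E <= (c2 * F `^ p^-1)%:E)%E.
  move: F0; rewrite le_eqVlt => /predU1P[F0|F0]; last exact: hb.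
  apply/lee_addgt0Pr => e e0.
  have e1 : 0 < (e / c2) `^ p by rewrite powR_gt0// divr_gt0.
  apply: (le_trans (hb _ e1 _)); first by rewrite -F0 ltW.
  rewrite -powRrM divff ?gt_eqF ?p_gt0// powRr1; last by rewrite divr_ge0 ?ltW.
  rewrite mulrCA divff ?gt_eqF// mulr1 -F0 powR0; last by rewrite gt_eqF ?invr_gt0 ?p_gt0.
  by rewrite mulr0 add0e.
have bfin : (\int[leb]_(y in Q) (h y)%:E)%E \is a fin_num.
  rewrite ge0_fin_numE; last by apply: integral_ge0 => y _; rewrite lee_fin.
  by apply: le_lt_trans bF _; rewrite ltry.
set b := fine (\int[leb]_(y in Q) (h y)%:E)%E.
have b0 : 0 <= b by apply: fine_ge0; apply: integral_ge0 => y _; rewrite lee_fin.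
have bF' : b <= c2 * F `^ p^-1 by rewrite -lee_fin fineK.
pose beta i := invmx B *m ev i.
have beta0 i : beta i != 0.
  apply/eqP => hb0; have := enorm_ev R i.
  by rewrite -(mulKVmx uB (ev i)) -/(beta i) hb0 mulmx0 enorm0 => /esym/eqP; rewrite oner_eq0.
pose S x := d%:R * \sum_i enorm (W x *m beta i).
have mWb i : measurable_fun setT (fun x => enorm (W x *m beta i)).
  by apply: measurable_enorm; apply: mfmx_mul; [exact: mW|exact: mfmx_cst].
have S0 x : 0 <= S x by rewrite mulr_ge0// sumr_ge0// => i _; exact: enorm_ge0.
exists (fun x => b * S x); split.
- apply: measurable_funM; first exact: measurable_cst.
  apply: measurable_funM; first exact: measurable_cst.
  by apply: measurable_sum.
- by move=> x; rewrite mulr_ge0.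
- move=> x.
  have -> : ((b * S x)%:E = (S x)%:E * \int[leb]_(y in Q) (h y)%:E)%E.
    by rewrite -(fineK bfin) -EFinM mulrC.
  rewrite -ge0_integral_scale; last 4 first.
  + exact: mQ.
  + exact: mh.
  + exact: h0.
  + exact: S0.
  apply: ge0_le_integral_nomeas => y _; rewrite lee_fin ?enorm_ge0//.
  rewrite /kernel_term -{1}(mulKmx uB (invmx (W y) *m f y)).
  rewrite (mulmxA (W x) (invmx B) (B *m _)).
  apply: le_trans (enorm_mulmx_le_enorm _ _) _.
  apply: ler_wpM2r; first exact: h0.
  have -> : S x = d%:R * \sum_i enorm (W x *m beta i) by [].
  apply: ler_wpM2l => //; apply: ler_sum => i _.
  by rewrite /beta mulmxA.
move=> E mE; set e := fine _ => e0.
have mEc : measurable (E `&` cell l z) by apply: measurableI => //; exact: measurable_hcube.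
have efin : leb (E `&` cell l z) = e%:E.
  rewrite /e fineK// ge0_fin_numE; last exact: measure_ge0.
  apply: (@le_lt_trans _ _ (leb (cell l z))); first by apply: le_leb; exact: subIsetr.
  by rewrite leb_hcube ?ltry// ltW.
pose a := 4 * (e / v) `^ Ainfty_exponent n K * c1.
have a0 : 0 < a by rewrite mulr_gt0// mulr_gt0// powR_gt0// divr_gt0.
have hWi i : (\int[leb]_(x in E `&` cell l z) (enorm (W x *m beta i) `^ q)%:E <= a%:E)%E.
  have mu := measurable_weight (beta i).
  have u0 x : 0 <= enorm (W x *m beta i) `^ q by exact: powR_ge0.
  have Qc : (density leb mu u0 (hcube (neighbourhood_corner l z) (3 * l)) <= c1%:E)%E.
    by rewrite /density -ge0_integral_ccube ?(ltW l30)//; exact: hW1.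
  have Qoo := le_lt_trans Qc (ltry _).
  have := Ainfty_decay K0 (sc_Ainfty_FW (beta0 i)) l30 Qoo mEc.
  have sub : (E `&` cell l z) `&` hcube (neighbourhood_corner l z) (3 * l) = E `&` cell l z.
    apply: setIidl; apply: subset_trans (@subIsetr _ _ _) _; exact: cell_sub_hcube.
  rewrite sub -/e -/v => hdec; apply: le_trans hdec _.
  by rewrite /a [leRHS]EFinM lee_wpmul2l// lee_fin mulr_ge0// powR_ge0.
have qV := qV_gt0; have qV1 := qV_lt1; have q0 := q_gt0.
have hi i : (\int[leb]_(x in E `&` cell l z) (enorm (W x *m beta i))%:E <=
    (2 * (a `^ q^-1 * e `^ (1 - q^-1)))%:E)%E.
  have e1 x : enorm (W x *m beta i) =
      (enorm (W x *m beta i) `^ q) `^ q^-1 * 1 `^ (1 - q^-1).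
    rewrite powR1 mulr1 -powRrM divff ?gt_eqF//.
    by rewrite powRr1// enorm_ge0.
  rewrite (eq_integral (fun x => ((enorm (W x *m beta i) `^ q) `^ q^-1 *
    (fun=> 1 : R) x `^ (1 - q^-1))%:E)); last by move=> x _; rewrite -e1.
  apply: integral_interp_le.
  - exact: mEc.
  - by apply: measurable_funTS; exact: measurable_weight.
  - exact: measurable_cst.
  - by move=> x _; exact: powR_ge0.
  - by move=> x _.
  - by rewrite (ltW qV) (ltW qV1).
  - exact: a0.
  - exact: e0.
  - exact: hWi.
  - rewrite integral_cst; last exact: mEc.
    by rewrite mul1e [X in (X <= _)%E]efin.
set c3 := a `^ q^-1 * e `^ (1 - q^-1) in hi.
have c30 : 0 <= c3 by rewrite mulr_ge0 ?powR_ge0.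
apply: (@le_trans _ _ (b * (d%:R * (d%:R * (2 * c3))))%:E).
  rewrite ge0_integral_scale; last 4 first.
  - exact: mEc.
  - apply: measurable_funM; first exact: measurable_cst.
    by apply: measurable_sum.
  - exact: S0.
  - exact: b0.
  rewrite [leRHS]EFinM; apply: lee_wpmul2l; first by rewrite lee_fin.
  rewrite ge0_integral_scale; last 4 first.
  - exact: mEc.
  - by apply: measurable_sum.
  - by move=> x; apply: sumr_ge0 => i _; exact: enorm_ge0.
  - by [].
  rewrite [leRHS]EFinM; apply: lee_wpmul2l; first by rewrite lee_fin.
  rewrite (integral_sum_EFin _ mEc mWb (fun i x => enorm_ge0 _)).
  rewrite mulr_natl -[X in _ *+ X]card_ord -sumr_const -sumEFin.
  by apply: lee_sum => i _; exact: hi.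
rewrite lee_fin.
apply: (@le_trans _ _ (c2 * F `^ p^-1 * (d%:R * (d%:R * (2 * c3))))).
  by apply: ler_wpM2r => //; apply: mulr_ge0 => //; apply: mulr_ge0 => //; exact: mulr_ge0.
have v1 : 0 < v `^ theta by exact: powR_gt0.
have c3E : c3 = 4 `^ q^-1 * c1 `^ q^-1 * (e `^ (alpha / n%:R + theta + (1 - p^-1)) / v `^ theta).
  rewrite /c3 /a powRM ?powR_ge0//; last 2 first.
  - by rewrite mulr_ge0// powR_ge0.
  - exact: ltW.
  rewrite powRM ?powR_ge0// -powRrM -/theta.
  rewrite powRM ?(ltW e0) ?invr_ge0 ?(ltW v0)//.
  have -> : v^-1 `^ theta = (v `^ theta)^-1 by rewrite -powR_inv1 ?(ltW v0)// -powRrM mulN1r powRN.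
  have -> : alpha / n%:R + theta + (1 - p^-1) = theta + (1 - q^-1) by rewrite -def_q; ring.
  rewrite [e `^ (theta + _)]powRD; last by rewrite (gt_eqF e0) implybT.
  by ring.
have h4 : 4 `^ q^-1 <= 4 :> R.
  by rewrite -[leRHS]powRr1// ler_powR ?(ltW qV1)//; lra.
have := ler_pM (powR_ge0 _ _) (mulr_ge0 (powR_ge0 c1 q^-1) (ltW c20)) h4 hc.
set P := _ * (_ `^ (1 - p^-1)) => hP.
pose X := 2 * d%:R ^+ 2 * (e `^ (alpha / n%:R + theta + (1 - p^-1)) / v `^ theta) * F `^ p^-1.
have X0 : 0 <= X.
  by rewrite mulr_ge0 ?powR_ge0// mulr_ge0// divr_ge0// powR_ge0.
have := ler_wpM2l X0 hP; rewrite c3E /X /P -/v.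
by congr (_ <= _); ring.
Qed.

Definition scale_const (l : R) : R :=
  32 * d%:R ^+ 8 * (H * (3 * l) ^+ n) `^ q^-1 * ((3 * l) ^+ n) `^ (1 - p^-1)
          / ((3 * l) ^+ n) `^ theta.

Lemma tau_gt0 : 0 < alpha / n%:R + theta.
Proof. by rewrite addr_gt0 ?theta_gt0// divr_gt0// nR_gt0. Qed.

Lemma nuf_le_setT (A : set Rn) : measurable A -> (nuf A <= nuf setT)%E.
Proof. by move=> mA; apply: le_measure; rewrite ?inE. Qed.

(** [m] bounds the measure of [E] in a single cell: either through the measure of [E], for the large
    scales, or through the volume of the cell, for the small ones. *)
Lemma scale_data (l : R) : 0 < l -> (0 < nuf setT)%E ->
  exists g : Rn -> \bar R, [/\ measurable_fun setT g, forall x, (0 <= g x)%E,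
    forall x, (\int[leb]_(y in neighbourhood l (cell_index l x)) (kernel_term x y)%:E <= g x)%E &
    forall (E : set Rn) (e m : R), measurable E -> 0 < e -> leb E = e%:E ->
      e <= m \/ (3 * l) ^+ n <= m ->
      (\int[leb]_(x in E) g x <=
        (2 * scale_const l * m `^ (alpha / n%:R + theta)
         * (e `^ (1 - p^-1) * ((4 ^ n)%:R * fine (nuf setT)) `^ p^-1))%:E)%E].
Proof.
move=> l0 Phi0.
have Phifin : nuf setT \is a fin_num by rewrite ge0_fin_numE// ltW.
have l3 : l <= 3 * l by rewrite ler_peMl ?(ltW l0)// ler1n.
have l30 : 0 <= 3 * l by apply: le_trans l3; exact: ltW.
have GG (j : nat) : exists G : Rn -> R, [/\ measurable_fun setT G, forall x, 0 <= G x &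
   forall z, (pickle_inv j : option {ffun 'I_n -> int}) = Some z ->
    (forall x, (\int[leb]_(y in neighbourhood l z) (kernel_term x y)%:E <= (G x)%:E)%E) /\
    forall E : set Rn, measurable E -> 0 < fine (leb (E `&` cell l z)) ->
      (\int[leb]_(x in E `&` cell l z) (G x)%:E <=
        (scale_const l
         * fine (leb (E `&` cell l z)) `^ (alpha / n%:R + theta + (1 - p^-1))
         * fine (nuf (neighbourhood l z)) `^ p^-1)%:E)%E].
  case Ej : (pickle_inv j) => [z|]; last first.
    by exists (fun=> 0); split => //; exact: measurable_cst.
  have [G [h1 h2 h3 h4]] := cell_data z l0.
  by exists G; split => // z' [<-]; split.
have [G hG] := choice GG.
have mG j : measurable_fun setT (G j) by have [h _ _] := hG j; exact: h.
have G0 j x : 0 <= G j x by have [_ h _] := hG j; exact: h.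
have Gz j := let: And3 _ _ h := hG j in h.
have mC j := @measurable_nth_cell R n l j.
pose g x : \bar R := (\sum_(0 <= j <oo) ((\1_(nth_cell l j) x) * G j x)%:E)%E.
have t0 j x : (0 <= ((\1_(nth_cell l j) x) * G j x)%:E)%E by rewrite lee_fin mulr_ge0.
exists g; split.
- apply: ge0_emeasurable_sum; last first.
    move=> j _; apply/measurable_EFinP.
    by apply: measurable_funM; [exact: measurable_indic|exact: mG].
  by move=> j x _ _; exact: t0.
- by move=> x; apply: nneseries_ge0 => j _ _.
- move=> x; have [j [Ej Cj]] := nth_cell_index l0 x.
  apply: le_trans ((Gz j _ Ej).1 x) _.
  have := nneseries_ge_term j (t0 ^~ x).
  by rewrite indicE mem_set// mul1r.
move=> E e m mE e0 Ee em.
pose F j := if (pickle_inv j : option {ffun 'I_n -> int}) is Some z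
            then fine (nuf (neighbourhood l z)) else 0.
have nbfin z : nuf (neighbourhood l z) \is a fin_num.
  rewrite ge0_fin_numE ?measure_ge0//; apply: le_lt_trans fp.
  by apply: nuf_le_setT; exact: measurable_ccube.
have sc0 : 0 <= scale_const l.
  rewrite /scale_const !mulr_ge0 ?powR_ge0// ?invr_ge0 ?powR_ge0//.
apply: (sum_cells_le (F := F)) => //.
- exact: trivIset_nth_cell.
- exact: tau_gt0.
- by rewrite mulr_gt0 ?fine_gt0// ?ltr0n ?expn_gt0//; rewrite Phi0 ltey_eq Phifin.
- move=> j; case: em => em.
    apply: (@le_trans _ _ (leb E)); first by apply: le_leb; exact: subIsetl.
    by rewrite Ee lee_fin.
  apply: (@le_trans _ _ (leb (nth_cell l j))); first by apply: le_leb; exact: subIsetr.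
  rewrite /nth_cell; case: pickle_inv => [z|].
    rewrite leb_hcube ?(ltW l0)// lee_fin; apply: le_trans em.
    by apply: lerXn2r => //; rewrite nnegrE; exact: ltW.
  by rewrite measure0 lee_fin; apply: le_trans em; rewrite exprn_ge0.
- by move=> j; rewrite /F; case: pickle_inv => [z|] //; apply: fine_ge0; exact: measure_ge0.
- rewrite EFinM fineK//; apply: le_trans (neighbourhood_overlap l0 nuf).
  apply: lee_nneseries => j _; rewrite /F; case: pickle_inv => [z|] //.
  by rewrite (fineK (nbfin z)).
move=> j; rewrite /nth_cell /F; case Ej : (pickle_inv j) => [z|].
  exact: (Gz j z Ej).2.
by rewrite setI0 measure0 ltxx.
Qed.

End cells.
End Ainfty_constant.

End weighted.

(** * Summation over the scales *)

Section majorant.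
Context (R : realType) (n d : nat).
Local Notation Rn := (Rn R n).
Variables (alpha p q : R).
Hypotheses (d_ge1 : (1 <= d)%N) (alpha_gt0 : 0 < alpha) (alpha_lt_n : alpha < n%:R)
  (p_ge1 : 1 <= p) (p_lt : p < n%:R / alpha) (def_q : p^-1 - q^-1 = alpha / n%:R).
Variables (W : Rn -> 'M[R]_d) (f : Rn -> 'cV[R]_d) (K H phi : R).
Hypotheses (hW : matrix_weight W) (K0 : 0 < K) (KW : (sc_Ainfty_char q W <= K%:E)%E)
  (HW : (Apq_char p q W <= H%:E)%E) (mf : mfmx f)
  (fphi : (\int[leb]_x (enorm (f x) `^ p)%:E = phi%:E)%E) (phi0 : 0 < phi).

Let theta := Ainfty_exponent n K / q.
Let tau := alpha / n%:R + theta.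
Let M0 := 64 * d%:R ^+ 8 * 3 ^+ n * H `^ q^-1 * ((4 ^ n)%:R * phi) `^ p^-1.
Let n0 : 0 < n%:R :> R := nR_gt0 alpha_gt0 alpha_lt_n.
Let q0 : 0 < q := q_gt0 alpha_gt0 alpha_lt_n p_ge1 p_lt def_q.
Let p0 : 0 < p := p_gt0 p_ge1.

Definition scale_term (x : Rn) (l : R) : \bar R :=
  ((l `^ (alpha - n%:R))%:E *
   \int[leb]_(y in neighbourhood l (cell_index l x)) (kernel_term W f x y)%:E)%E.

Lemma H_gt0 : 0 < H.
Proof.
have [B [c1 [c2 [[H0 _ _ _] _ _ _]]]] := Apq_reduction d_ge1 alpha_gt0 alpha_lt_n
  p_ge1 p_lt def_q hW HW (fun=> 0) ltr01.
exact: H0.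
Qed.

(** The powers of [l] cancel: 1/q + 1 - 1/p = (n - alpha)/n, so the volume factors give (3 l)^(n -
    alpha) against the kernel's l^(alpha - n). Only the decay factor still depends on [l]. *)
Lemma scale_const_le (l : R) : 0 < l ->
  l `^ (alpha - n%:R) * (2 * scale_const n d p q K H l) <=
  64 * d%:R ^+ 8 * 3 ^+ n * H `^ q^-1 * (((3 * l) ^+ n) `^ theta)^-1.
Proof.
move=> l0; rewrite /scale_const -/theta; set v := (3 * l) ^+ n.
have l30 : 0 < 3 * l by rewrite mulr_gt0.
have v0 : 0 < v by rewrite exprn_gt0.
have e1 : (H * v) `^ q^-1 * v `^ (1 - p^-1) = H `^ q^-1 * (3 `^ (n%:R - alpha) * l `^ (n%:R - alpha)).
  rewrite powRM ?(ltW v0) ?(ltW H_gt0)// -mulrA -powRD; last by rewrite (gt_eqF v0) implybT.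
  congr (_ * _).
  have -> : q^-1 + (1 - p^-1) = (n%:R - alpha) / n%:R.
    by rewrite mulrBl divff ?gt_eqF// -def_q; ring.
  rewrite -powRM ?(ltW l0)// /v -powR_mulrn ?(ltW l30)// -powRrM.
  by congr (_ `^ _); rewrite mulrCA divff ?mulr1// gt_eqF.
have e2 : l `^ (alpha - n%:R) * l `^ (n%:R - alpha) = 1.
  rewrite -powRD; last by rewrite (gt_eqF l0) implybT.
  by have -> : alpha - n%:R + (n%:R - alpha) = 0 :> R; [ring|rewrite powRr0].
have e3 : 3 `^ (n%:R - alpha) <= 3 ^+ n :> R.
  rewrite -powR_mulrn// ler_powR ?ler1n//.
  by rewrite lerBlDr lerDl ltW.
set a := l `^ (alpha - n%:R) in e2 *; set b := l `^ (n%:R - alpha) in e1 e2.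
have -> : a * (2 * (32 * d%:R ^+ 8 * (H * v) `^ q^-1 * v `^ (1 - p^-1) / v `^ theta)) =
  64 * d%:R ^+ 8 * (a * ((H * v) `^ q^-1 * v `^ (1 - p^-1))) * (v `^ theta)^-1 by ring.
rewrite e1.
have -> : a * (H `^ q^-1 * (3 `^ (n%:R - alpha) * b)) =
    (a * b) * (3 `^ (n%:R - alpha) * H `^ q^-1) by ring.
rewrite e2 mul1r ler_wpM2r ?invr_ge0 ?powR_ge0// !mulrA ler_wpM2r ?powR_ge0//.
by rewrite ler_wpM2l// mulr_ge0// exprn_ge0.
Qed.

Lemma scaled_majorant (l : R) : 0 < l ->
  exists g : Rn -> \bar R, [/\ measurable_fun setT g, forall x, (0 <= g x)%E,
    forall x, (scale_term x l <= g x)%E &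
    forall (E : set Rn) (e m : R), measurable E -> 0 < e -> leb E = e%:E ->
      e <= m \/ (3 * l) ^+ n <= m ->
      (\int[leb]_(x in E) g x <=
        (M0 * e `^ (1 - p^-1) * (m `^ tau / ((3 * l) ^+ n) `^ theta))%:E)%E].
Proof.
move=> l0.
have fp : (\int[leb]_x (enorm (f x) `^ p)%:E < +oo)%E by rewrite fphi ltry.
have ph : (0 < density leb (@measurable_f_powR R n d p f mf) (@f_powR_ge0 R n d p f) setT)%E.
  by rewrite /density fphi lte_fin.
have [g [mg g0 g1 g2]] := scale_data d_ge1 alpha_gt0 alpha_lt_n p_ge1 p_lt def_q hW
  K0 KW HW fp l0 ph.
set c := l `^ (alpha - n%:R).
have c0 : 0 <= c by exact: powR_ge0.
exists (fun x => c%:E * g x)%E; split.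
- exact: measurable_funeM.
- by move=> x; rewrite mule_ge0.
- by move=> x; rewrite /scale_term lee_wpmul2l.
move=> E e m mE e0 Ee em.
rewrite ge0_integralZl; last 4 first.
- exact: mE.
- exact: measurable_funTS.
- by move=> x _; exact: g0.
- by rewrite lee_fin.
apply: le_trans (lee_wpmul2l _ (g2 E e m mE e0 Ee em)) _; first by rewrite lee_fin.
rewrite -EFinM lee_fin -[X in fine X]/(\int[leb]_x (enorm (f x) `^ p)%:E)%E.
rewrite fphi [fine _]/=.
set P := ((4 ^ n)%:R * phi) `^ p^-1.
have -> : c * (2 * scale_const n d p q K H l * m `^ (alpha / n%:R + Ainfty_exponent n K / q) *
    (e `^ (1 - p^-1) * P)) =
    (c * (2 * scale_const n d p q K H l)) * (m `^ tau * (e `^ (1 - p^-1) * P)).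
  by rewrite /tau /theta; ring.
have -> : M0 * e `^ (1 - p^-1) * (m `^ tau / ((3 * l) ^+ n) `^ theta) =
    (64 * d%:R ^+ 8 * 3 ^+ n * H `^ q^-1 * (((3 * l) ^+ n) `^ theta)^-1) *
    (m `^ tau * (e `^ (1 - p^-1) * P)).
  by rewrite /M0 -/P; ring.
by rewrite ler_wpM2r ?scale_const_le// !mulr_ge0 ?powR_ge0.
Qed.

Lemma decay_exponent_gt0 : 0 < theta.
Proof. by rewrite divr_gt0// Ainfty_exponent_gt0. Qed.

Lemma theta_le_qV : theta <= q^-1.
Proof.
rewrite /theta ler_piMl ?invr_ge0 ?(ltW q0)// invf_le1 ?ltr0n//.
by rewrite ler1n.
Qed.

Lemma majorant (L : R) : 0 < L ->
  exists G : Rn -> \bar R, [/\ measurable_fun setT G, forall x, (0 <= G x)%E,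
    forall x, (\sum_(0 <= i <oo) (scale_term x (L * 2 ^+ i) + scale_term x (L / 2 ^+ i.+1))
      <= G x)%E &
    forall (E : set Rn) (e : R), measurable E -> leb E = e%:E -> L ^+ n <= e ->
      (\int[leb]_(x in E) G x <=
        (M0 * e `^ (1 - p^-1) *
          (3 / theta * (e `^ tau / (L ^+ n) `^ theta) +
           3 ^+ n * (L ^+ n) `^ (alpha / n%:R) / (1 - 2 `^ (- alpha))))%:E)%E].
Proof.
move=> L0.
have n1 : (0 < n)%N by move: n0; rewrite ltr0n.
have Li0 i : 0 < L * 2 ^+ i by rewrite mulr_gt0// exprn_gt0.
have Li0' i : 0 < L / 2 ^+ i.+1 by rewrite divr_gt0// exprn_gt0.
have [g hg] := choice (fun i => scaled_majorant (Li0 i)).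
have [g' hg'] := choice (fun i => scaled_majorant (Li0' i)).
have g0 i x : (0 <= g i x)%E by have [_ h _ _] := hg i; exact: h.
have g0' i x : (0 <= g' i x)%E by have [_ h _ _] := hg' i; exact: h.
have mg i : measurable_fun setT (g i) by have [h _ _ _] := hg i; exact: h.
have mg' i : measurable_fun setT (g' i) by have [h _ _ _] := hg' i; exact: h.
have st0 x l : (0 <= scale_term x l)%E.
  rewrite /scale_term mule_ge0 ?lee_fin ?powR_ge0//.
  by apply: integral_ge0 => y _; rewrite lee_fin; exact: enorm_ge0.
exists (fun x => \sum_(0 <= i <oo) (g i x + g' i x))%E; split.
- apply: ge0_emeasurable_sum; first by move=> i x _ _; exact: adde_ge0.
  by move=> i _; exact: emeasurable_funD.
- by move=> x; apply: nneseries_ge0 => i _ _; exact: adde_ge0.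
- move=> x; apply: lee_nneseries => i _; first by move=> _; exact: adde_ge0.
  by apply: leeD; [have [_ _ h _] := hg i|have [_ _ h _] := hg' i]; exact: h.
move=> E e mE Ee Le.
have X0 : 0 < L ^+ n by rewrite exprn_gt0.
have e0 : 0 < e by exact: lt_le_trans X0 Le.
have th0 := decay_exponent_gt0.
have th1 : theta <= 1.
  by apply: le_trans theta_le_qV _; apply: ltW; exact: (qV_lt1 alpha_gt0 alpha_lt_n p_ge1 def_q).
set c := M0 * e `^ (1 - p^-1).
have c0 : 0 <= c.
  rewrite /c /M0 !mulr_ge0 ?powR_ge0// ?exprn_ge0//.
have sumE : (\int[leb]_(x in E) (\sum_(0 <= i <oo) (g i x + g' i x)) =
    \sum_(0 <= i <oo) (\int[leb]_(x in E) g i x + \int[leb]_(x in E) g' i x))%E.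
  rewrite integral_nneseries; last 3 first.
  - exact: mE.
  - by move=> i; apply: measurable_funTS; exact: emeasurable_funD.
  - by move=> i x _; exact: adde_ge0.
  apply: eq_eseriesr => i _; rewrite ge0_integralD; last 5 first.
  - exact: mE.
  - by move=> x _; exact: g0.
  - by apply: measurable_funTS; exact: mg.
  - by move=> x _; exact: g0'.
  - by apply: measurable_funTS; exact: mg'.
  by [].
rewrite sumE nneseriesD; last 2 first.
- by move=> i _ _; apply: integral_ge0 => x _; exact: g0.
- by move=> i _ _; apply: integral_ge0 => x _; exact: g0'.
rewrite mulrDr EFinD; apply: leeD.
(* Large scales, with m = e: the powers of l^n in the denominator grow at least like 2^(i theta),
   and the sum costs 3/theta. *)
- set r := 2 `^ (- theta).
  have r0 : 0 <= r by exact: powR_ge0.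
  have r1 : theta / 3 <= 1 - r by apply: one_sub_powR2N_ge; rewrite th0.
  have t3 : 0 < theta / 3 by rewrite divr_gt0.
  have r1' : r < 1 by rewrite -subr_gt0; exact: lt_le_trans t3 r1.
  set A := e `^ tau / (L ^+ n) `^ theta.
  have A0 : 0 <= A by rewrite divr_ge0 ?powR_ge0.
  apply: (@le_trans _ _ (\sum_(0 <= i <oo) (c * A * r ^+ i)%:E)%E).
    apply: lee_nneseries => i _; first by move=> _; apply: integral_ge0 => x _; exact: g0.
    have [_ _ _ h] := hg i.
    apply: le_trans (h E e e mE e0 Ee (or_introl (lexx _))) _.
    rewrite lee_fin -/c -[c * A * _]mulrA ler_wpM2l// /A -[_ / _ * _]mulrA ler_wpM2l ?powR_ge0//.
    have -> : ((L ^+ n) `^ theta)^-1 * r ^+ i = ((L ^+ n * 2 ^+ i) `^ theta)^-1.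
      rewrite powRM ?(ltW X0) ?exprn_ge0// invfM; congr (_ * _).
      by rewrite /r powRN exprVn powR_exprn.
    have v0 : 0 < (3 * (L * 2 ^+ i)) ^+ n by rewrite exprn_gt0// mulr_gt0.
    have w0 : 0 < L ^+ n * 2 ^+ i by rewrite mulr_gt0// exprn_gt0.
    rewrite lef_pV2 ?posrE ?powR_gt0// ge0_ler_powR ?nnegrE ?(ltW th0) ?(ltW v0) ?(ltW w0)//.
    rewrite !exprMn; apply: (@le_trans _ _ (L ^+ n * (2 ^+ i) ^+ n)).
      by rewrite ler_wpM2l ?(ltW X0)// ler_eXnr// exprn_ege1// ler1n.
    rewrite ler_peMl ?exprn_ege1 ?ler1n//.
    by rewrite mulr_ge0 ?(ltW X0)// exprn_ge0// exprn_ge0.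
  apply: le_trans (nneseries_geometric_le _ r0 r1') _; first exact: mulr_ge0.
  rewrite lee_fin -[c * A / _]mulrA; apply: ler_wpM2l => //.
  rewrite mulrC; apply: ler_wpM2r => //.
  by rewrite -[3 / theta]invf_div lef_pV2 ?posrE// subr_gt0.
(* Small scales, with m = (3 l)^n: the decay factor cancels and (3 l)^alpha remains, so the sum
   costs a constant independent of the weight. *)
set r := 2 `^ (- alpha).
have r0 : 0 <= r by exact: powR_ge0.
have r1 : r < 1.
  rewrite /r powRN invf_lt1 ?powR_gt0//.
  have h12 : 1 < 2 :> R by rewrite ltr1n.
  by have := gt0_ltr_powR alpha_gt0 _ _ h12; rewrite powR1; apply; rewrite nnegrE.
set A := 3 ^+ n * (L ^+ n) `^ (alpha / n%:R).
have A0 : 0 <= A by rewrite mulr_ge0 ?powR_ge0// exprn_ge0.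
apply: (@le_trans _ _ (\sum_(0 <= i <oo) (c * A * r ^+ i)%:E)%E).
  apply: lee_nneseries => i _; first by move=> _; apply: integral_ge0 => x _; exact: g0'.
  have [_ _ _ h] := hg' i.
  apply: le_trans (h E e _ mE e0 Ee (or_intror (lexx _))) _.
  rewrite lee_fin -/c -[c * A * _]mulrA ler_wpM2l//.
  have v0 : 0 < (3 * (L / 2 ^+ i.+1)) ^+ n by rewrite exprn_gt0// mulr_gt0.
  rewrite powRD; last by rewrite (gt_eqF v0) implybT.
  rewrite mulfK ?gt_eqF ?powR_gt0//.
  have pw (x : R) : 0 <= x -> (x ^+ n) `^ (alpha / n%:R) = x `^ alpha.
    by move=> x0; rewrite -powR_mulrn// -powRrM mulrCA divff ?mulr1// gt_eqF.
  rewrite /A !pw ?(ltW L0) ?mulr_ge0 ?(ltW (Li0' i))//.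
  rewrite !powRM ?(ltW L0) ?(ltW (Li0' i)) ?invr_ge0 ?exprn_ge0// -mulrA.
  apply: ler_pM; rewrite ?mulr_ge0 ?powR_ge0//.
    by rewrite -powR_mulrn// ler_powR ?ler1n// ltW.
  rewrite ler_wpM2l ?powR_ge0//.
  have -> : (2 ^- i.+1) `^ alpha = r ^+ i.+1 :> R.
    by rewrite /r powRN exprVn powRV// powR_exprn.
  by rewrite exprS ler_piMl ?exprn_ge0// ltW.
  exact: ltW.
apply: le_trans (nneseries_geometric_le _ r0 r1) _; first exact: mulr_ge0.
by rewrite lee_fin -[c * A / _]mulrA.
Qed.

End majorant.

(** * Pointwise domination of both operators by the sum over the scales *)

Section domination.
Context (R : realType) (n d : nat).
Local Notation Rn := (Rn R n).
Variables (alpha : R) (W : Rn -> 'M[R]_d) (f : Rn -> 'cV[R]_d).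
Hypotheses (d_ge1 : (1 <= d)%N) (alpha_gt0 : 0 < alpha) (alpha_lt_n : alpha < n%:R)
  (hW : matrix_weight W) (mf : mfmx f).

Let mW : mfmx W := hW.2.
Let uW x : W x \in unitmx. Proof. by apply: posdef_unitmx; exact: hW.1. Qed.

Definition scale_sum (x : Rn) (L : R) : \bar R :=
  (\sum_(0 <= i <oo) (scale_term alpha W f x (L * 2 ^+ i)
                    + scale_term alpha W f x (L / 2 ^+ i.+1)))%E.

Lemma kernel_term_ge0 x y : 0 <= kernel_term W f x y.
Proof. exact: enorm_ge0. Qed.

Let mg : mfmx (fun y => invmx (W y) *m f y).
Proof. by apply: mfmx_mul; [exact: mfmx_inv|exact: mf]. Qed.

Lemma measurable_kernel_term x : measurable_fun setT (kernel_term W f x).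
Proof. by apply: measurable_enorm; apply: mfmx_mul; [exact: mfmx_cst|exact: mg]. Qed.

Lemma scale_term_ge0 x l : (0 <= scale_term alpha W f x l)%E.
Proof.
rewrite /scale_term mule_ge0 ?lee_fin ?powR_ge0//.
by apply: integral_ge0 => y _; rewrite lee_fin; exact: enorm_ge0.
Qed.

Lemma scale_term_le_sum x L (i : nat) :
  (scale_term alpha W f x (L * 2 ^+ i) <= scale_sum x L)%E /\
  (scale_term alpha W f x (L / 2 ^+ i.+1) <= scale_sum x L)%E.
Proof.
have h := nneseries_ge_term i (fun j => adde_ge0
  (scale_term_ge0 x (L * 2 ^+ j)) (scale_term_ge0 x (L / 2 ^+ j.+1))).
split; apply: le_trans h.
  by rewrite leeDl// scale_term_ge0.
by rewrite leeDr// scale_term_ge0.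
Qed.

Lemma measurable_coordinate (i : 'I_n) : measurable_fun setT (fun x : Rn => coordinate x i).
Proof. by move=> _ B mB; rewrite setTI; exact: measurable_coordinate_preimage. Qed.

Lemma measurable_eucl_dist (x : Rn) : measurable_fun setT (eucl_dist x).
Proof.
rewrite (_ : eucl_dist x =
  (fun y => (\sum_(i < n) (coordinate x i - coordinate y i) ^+ 2) `^ 2^-1)).
  apply: (measurableT_comp (measurable_powR _)).
  apply: measurable_sum => i; apply: measurable_funX.
  by apply: measurable_funB; [exact: measurable_cst|exact: measurable_coordinate].
apply/funext => y; rewrite powR12_sqrt//.
by apply: sumr_ge0 => i _; exact: sqr_ge0.
Qed.

Lemma ler_coord_eucl_dist (x y : Rn) i :
  `|coordinate x i - coordinate y i| <= eucl_dist x y.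
Proof.
rewrite /eucl_dist -sqrtr_sqr ler_wsqrtr// (bigD1 i)//= lerDl sumr_ge0// => j _.
exact: sqr_ge0.
Qed.

Lemma powR_half_le (l D : R) : 0 < l -> l / 2 < D ->
  D `^ (alpha - n%:R) <= 2 `^ (n%:R - alpha) * l `^ (alpha - n%:R).
Proof.
move=> l0 lD; have l20 : 0 < l / 2 by rewrite divr_gt0.
have D0 : 0 < D by exact: lt_trans lD.
have e (x : R) : x `^ (alpha - n%:R) = (x `^ (n%:R - alpha))^-1 by rewrite -powRN opprB.
have s0 : 0 <= n%:R - alpha by rewrite subr_ge0 ltW.
have -> : 2 `^ (n%:R - alpha) * l `^ (alpha - n%:R) = ((l / 2) `^ (n%:R - alpha))^-1.
  by rewrite e powRM ?(ltW l0)// invfM powRV// invrK mulrC.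
rewrite e lef_pV2 ?posrE ?powR_gt0// ge0_ler_powR ?nnegrE ?(ltW D0) ?(ltW l20)//.
exact: ltW.
Qed.

(** A point y other than x has l/2 < |x - y| <= l for some scale l. It then lies in the
    neighbourhood of the cell of x, and there the kernel is at most 2^(n - alpha) l^(alpha - n). *)
Lemma W_riesz_le x L : 0 < L ->
  ((enorm (W_riesz W alpha f x))%:E <=
   (d%:R * 2 `^ (n%:R - alpha))%:E * scale_sum x L)%E.
Proof.
move=> L0.
set s := n%:R - alpha.
have s0 : 0 < s by rewrite subr_gt0.
pose k y := (eucl_dist x y `^ s)^-1.
have k0 y : 0 <= k y by rewrite invr_ge0 powR_ge0.
have mk : measurable_fun setT k.
  apply: measurable_inv_fun; last by move=> y; exact: powR_ge0.
  by apply: (measurableT_comp (measurable_powR _)); exact: measurable_eucl_dist.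
apply: le_trans (enorm_integral_le leb d_ge1 (uW x) mg mk k0) _.
rewrite EFinM -muleA; apply: lee_wpmul2l; first by rewrite lee_fin.
pose c l := 2 `^ s * l `^ (alpha - n%:R).
have c0 l : 0 <= c l by rewrite mulr_ge0 ?powR_ge0.
pose N l := neighbourhood l (cell_index l x).
pose h l y := c l * (\1_(N l) y * kernel_term W f x y).
have mind l : measurable_fun setT (fun y => \1_(N l) y * kernel_term W f x y).
  apply: measurable_funM; last exact: measurable_kernel_term.
  by apply: measurable_indic; exact: measurable_ccube.
have ind0 l y : 0 <= \1_(N l) y * kernel_term W f x y.
  by apply: mulr_ge0; [rewrite indicE|exact: kernel_term_ge0].
have mh l : measurable_fun setT (h l).
  by apply: measurable_funM; [exact: measurable_cst|exact: mind].
have h0 l y : 0 <= h l y by apply: mulr_ge0; [exact: c0|exact: ind0].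
have hint l : (\int[leb]_y (h l y)%:E = (2 `^ s)%:E * scale_term alpha W f x l)%E.
  rewrite ge0_integral_scale; last 4 first.
  - exact: measurableT.
  - exact: mind.
  - exact: ind0.
  - exact: c0.
  by rewrite integral_indicM /scale_term muleA -EFinM.
have dom l y : 0 < l -> l / 2 < eucl_dist x y <= l ->
    kernel_term W f x y * k y <= h l y.
  move=> l0 /andP[lD Dl].
  have Ny : N l y.
    apply: (@cell_close _ _ _ _ x) => //; first exact/in_cellP.
    by move=> i; apply: le_trans (ler_coord_eucl_dist x y i) Dl.
  rewrite /h indicE mem_set// mul1r mulrC; apply: ler_wpM2r.
    exact: kernel_term_ge0.
  by rewrite /k -powRN opprB; exact: powR_half_le.
apply: le_trans (@integral_le_two_series R _ _ leb (fun y => enorm (W x *m (invmx (W y) *m f y)) * k y)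
  (fun i => h (L * 2 ^+ i)) (fun i => h (L / 2 ^+ i.+1)) _ _ _ _ _ _) _.
- by move=> y; rewrite mulr_ge0 ?enorm_ge0.
- by move=> i; exact: mh.
- by move=> i y; exact: h0.
- by move=> i; exact: mh.
- by move=> i y; exact: h0.
- move=> y; have [D0|D0] := ltP 0 (eucl_dist x y).
    have [i [hi|hi]] := dyadic_scale L0 D0.
      exists i; left; apply: dom => //.
      by rewrite mulr_gt0// exprn_gt0.
    exists i; right; apply: dom => //.
    by rewrite divr_gt0// exprn_gt0.
  exists 0%N; left.
  (* On the diagonal, 0 to a positive power is 0 and the inverse of 0 is 0, so the integrand takes
     the harmless value 0. *)
  have -> : k y = 0.
    have D00 : eucl_dist x y = 0 by apply/eqP; rewrite eq_le D0 sqrtr_ge0.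
    by rewrite /k D00 powR0 ?invr0// gt_eqF.
  by rewrite mulr0; exact: h0.
rewrite /scale_sum -nneseriesZl; last first.
  by move=> i _; apply: adde_ge0; exact: scale_term_ge0.
apply: lee_nneseries => i _.
  by move=> _; apply: adde_ge0; apply: integral_ge0 => y _; rewrite lee_fin; exact: h0.
by rewrite !hint -ge0_muleDr ?scale_term_ge0.
Qed.

(** A single scale suffices: a cube of side s containing x lies in the neighbourhood at the scale l
    with l/2 < s <= l, and its normalising factor is s^(alpha - n). *)
Lemma christ_goldberg_le x L : 0 < L ->
  (christ_goldberg W alpha f x <= (2 `^ (n%:R - alpha))%:E * scale_sum x L)%E.
Proof.
move=> L0; apply: ge_ereal_sup => _ [Q [/is_cubeP[a [s [s0 ->]]] xQ] <-].
have n0 : 0 < n%:R :> R by exact: lt_trans alpha_lt_n.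
have [i hi] := dyadic_scale L0 s0.
have [l [l0 /andP[ls sl] lsum]] : exists l, [/\ 0 < l, l / 2 < s <= l &
    (scale_term alpha W f x l <= scale_sum x L)%E].
  have [h1 h2] := scale_term_le_sum x L i.
  case: hi => hi; [exists (L * 2 ^+ i)|exists (L / 2 ^+ i.+1)]; split => //.
    by rewrite mulr_gt0// exprn_gt0.
  by rewrite divr_gt0// exprn_gt0.
apply: (@le_trans _ _ ((2 `^ (n%:R - alpha))%:E * scale_term alpha W f x l)%E); last first.
  by apply: lee_wpmul2l => //; rewrite lee_fin powR_ge0.
rewrite /avg vol_ccube ?(ltW s0)// muleA -EFinM.
have -> : (s ^+ n) `^ (alpha / n%:R) * (s ^+ n)^-1 = s `^ (alpha - n%:R).
  rewrite -powR_mulrn ?(ltW s0)// -powRrM mulrCA divff ?gt_eqF// mulr1.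
  by rewrite -powRN -powRD// (gt_eqF s0) implybT.
rewrite /scale_term muleA -EFinM; apply: lee_pmul.
- by rewrite lee_fin powR_ge0.
- by apply: integral_ge0 => y _; rewrite lee_fin; exact: enorm_ge0.
- by rewrite lee_fin; exact: powR_half_le.
apply: ge0_subset_integral_EFin.
- exact: measurable_ccube.
- exact: measurable_ccube.
- exact: measurable_kernel_term.
- exact: kernel_term_ge0.
move=> y yQ; apply: (@cell_close _ _ _ _ x) => //; first exact/in_cellP.
move=> j; apply: le_trans sl.
have := xQ j; have := yQ j; rewrite /= !in_itv /= => /andP[h1 h2] /andP[h3 h4].
by rewrite ler_norml; apply/andP; split; lra.
Qed.

End domination.

Lemma sigma_finite_subset_gt disp (T : measurableType disp) (R : realType)
    (mu : {measure set T -> \bar R}) (E : set T) (X : \bar R) :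
  sigma_finite setT mu -> measurable E -> (X < mu E)%E ->
  exists F, [/\ measurable F, F `<=` E, (X < mu F)%E & (mu F < +oo)%E].
Proof.
move=> /sigma_finiteP[D [DT ndD Doo]] mE XE.
pose F k := E `&` D k.
have mF k : measurable (F k) by apply: measurableI => //; exact: (Doo k).1.
have FE : \bigcup_k F k = E by rewrite -setI_bigcupr -DT setIT.
have cF : mu (F k) @[k --> \oo] --> mu E.
  rewrite -FE; apply: nondecreasing_cvg_mu => //.
    by rewrite FE.
  move=> k m km; apply/subsetPset; apply: setIS.
  by apply/subsetPset; exact: ndD.
have [k _ hk] := cF _ (open_ereal_gt' XE).
exists (F k); split => //.
- exact: subIsetl.
- exact: (hk k (leqnn k)).
- apply: le_lt_trans (Doo k).2; apply: le_measure; rewrite ?inE//.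
    exact: (Doo k).1.
  exact: subIsetr.
Qed.

Lemma integral_eq0_of_zero disp (T : measurableType disp) (R : realType)
    (mu : {measure set T -> \bar R}) (N : set T) (u v : T -> R) :
  measurable N -> measurable_fun setT u -> measurable_fun setT v ->
  (forall y, 0 <= u y) -> (forall y, 0 <= v y) -> (forall y, u y = 0 -> v y = 0) ->
  (\int[mu]_y (u y)%:E = 0)%E -> (\int[mu]_(y in N) (v y)%:E = 0)%E.
Proof.
move=> mN mu_ mv u0 v0 uv Iu.
have muE : measurable_fun setT (EFin \o u) by exact/measurable_EFinP.
have abs0 : (\int[mu]_y `|(EFin \o u) y| = 0)%E.
  by rewrite -[RHS]Iu; apply: eq_integral => y _ /=; rewrite ger0_norm.
have ae := (ae_eq_integral_abs mu measurableT muE).1 abs0.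
rewrite (ge0_ae_eq_integral (g := cst 0%E)) ?integral0//.
- by apply/measurable_EFinP; exact: measurable_funTS.
- by move=> y _; rewrite lee_fin.
apply: filterS ae => y /(_ I) /= [uy0] _.
by rewrite (uv y uy0).
Qed.

Lemma leb_sigma_finite (R : realType) (n : nat) : sigma_finite setT (@leb R n).
Proof.
exact: completed_measure_extension_sigma_finite (sigma_finiteT (@borel_lebesgue R n)).
Qed.

(** * The bound on the level set *)

Section weak_type.
Context (R : realType) (n d : nat).
Local Notation Rn := (Rn R n).
Variables (alpha p q : R).
Hypotheses (d_ge1 : (1 <= d)%N) (alpha_gt0 : 0 < alpha) (alpha_lt_n : alpha < n%:R)
  (p_ge1 : 1 <= p) (p_lt : p < n%:R / alpha) (def_q : p^-1 - q^-1 = alpha / n%:R).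

Let n0 : 0 < n%:R :> R := nR_gt0 alpha_gt0 alpha_lt_n.
Let q0 : 0 < q := q_gt0 alpha_gt0 alpha_lt_n p_ge1 p_lt def_q.
Let p0 : 0 < p := p_gt0 p_ge1.

Let Ct : R := 3 * q * (1 + (2 * 2 ^+ n.+1 + 1) * n.+1%:R).
Let Ca : R := 3 ^+ n / (1 - 2 `^ (- alpha)).

Lemma Ca_gt0 : 0 < Ca.
Proof.
rewrite divr_gt0 ?exprn_gt0// subr_gt0 powRN invf_lt1 ?powR_gt0//.
have h12 : 1 < 2 :> R by rewrite ltr1n.
by have := gt0_ltr_powR alpha_gt0 _ _ h12; rewrite powR1; apply; rewrite nnegrE.
Qed.

Lemma Ct_gt0 : 0 < Ct.
Proof.
rewrite /Ct !mulr_gt0// ltr_pwDl// mulr_ge0// addr_ge0// mulr_ge0// exprn_ge0//.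
Qed.

(** The layer count is affine in [K], and [1 <= K] absorbs the additive constants. *)
Lemma exponent_inv_le (K : R) : 1 <= K -> 3 / (Ainfty_exponent n K / q) <= Ct * K.
Proof.
move=> K1; rewrite /Ainfty_exponent invfM !invrK /Ct.
have K0 : 0 <= K by exact: le_trans K1.
have lc : (layer_count n K)%:R <= (2 * 2 ^+ n.+1 + 1) * K.
  rewrite /layer_count [(_ + 1) * K]mulrDl mul1r; set A := 2 * 2 ^+ n.+1 * K.
  have A0 : 0 <= A by rewrite !mulr_ge0// exprn_ge0.
  have -> : (Num.truncn A).+1%:R = (Num.truncn A)%:R + 1 :> R by rewrite natr1.
  by apply: lerD => //; have /andP[] := truncn_itv A0.
have h : (1 + layer_count n K * n.+1)%:R <= (1 + (2 * 2 ^+ n.+1 + 1) * n.+1%:R) * K.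
  rewrite natrD natrM [(1 + _) * K]mulrDl mul1r; apply: lerD => //.
  by rewrite mulrAC; apply: ler_wpM2r.
rewrite -[leRHS]mulrA -mulrA ler_wpM2l// mulrC ler_wpM2l// ltW//.
Qed.

(** The leading 2 is the slack that makes the contradiction in [weak_type_bound] read
    [lam <= lam / 2]. *)
Definition weak_const : R :=
  2 * (d%:R * 2 `^ (n%:R - alpha)) *
  (64 * d%:R ^+ 8 * 3 ^+ n * (4 ^ n)%:R `^ p^-1) * (Ct + Ca).

Lemma weak_const_gt0 : 0 < weak_const.
Proof.
have dR : 0 < d%:R :> R by rewrite ltr0n.
rewrite /weak_const !mulr_gt0 ?powR_gt0 ?exprn_gt0 ?addr_gt0 ?Ct_gt0 ?Ca_gt0//.
Qed.

Variables (W : Rn -> 'M[R]_d) (f : Rn -> 'cV[R]_d) (K H phi : R).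
Hypotheses (hW : matrix_weight W) (K1 : 1 <= K) (KW : (sc_Ainfty_char q W <= K%:E)%E)
  (HW : (Apq_char p q W <= H%:E)%E) (mf : mfmx f)
  (fphi : (\int[leb]_x (enorm (f x) `^ p)%:E = phi%:E)%E) (phi0 : 0 < phi).

Let K0 : 0 < K. Proof. exact: lt_le_trans K1. Qed.
Let H0 : 0 < H.
Proof. exact: (H_gt0 d_ge1 alpha_gt0 alpha_lt_n p_ge1 p_lt def_q hW HW). Qed.

Lemma weak_type_bound (S : set Rn) (lam : R) : 0 < lam ->
  (forall x, S x -> forall L, 0 < L ->
    (lam%:E < (d%:R * 2 `^ (n%:R - alpha))%:E * scale_sum alpha W f x L)%E) ->
  (leb S <= (weak_const `^ q * (H * K `^ q * (lam `^ q)^-1 * phi `^ (q / p)))%:E)%E.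
Proof.
move=> lam0 hS.
have dR : 0 < d%:R :> R by rewrite ltr0n.
set c := d%:R * 2 `^ (n%:R - alpha).
have c0 : 0 < c by rewrite mulr_gt0// powR_gt0.
pose Z := weak_const * (H `^ q^-1 * K * lam^-1 * phi `^ p^-1).
have Z0 : 0 < Z.
  by rewrite /Z mulr_gt0 ?weak_const_gt0// !mulr_gt0 ?powR_gt0// invr_gt0.
have -> : weak_const `^ q * (H * K `^ q * (lam `^ q)^-1 * phi `^ (q / p)) = Z `^ q.
  rewrite /Z powRM; last 2 first.
  - exact: ltW weak_const_gt0.
  - by rewrite !mulr_ge0 ?powR_ge0 ?invr_ge0 ?(ltW lam0) ?(ltW K0).
  congr (_ * _); rewrite powRM ?powR_ge0//; last first.
    by rewrite !mulr_ge0 ?powR_ge0 ?invr_ge0 ?(ltW lam0) ?(ltW K0).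
  rewrite powRM ?invr_ge0 ?(ltW lam0)//; last by rewrite mulr_ge0 ?powR_ge0 ?(ltW K0).
  rewrite powRM ?powR_ge0 ?(ltW K0)// powRV ?(ltW lam0)//.
  rewrite -[(H `^ _) `^ _]powRrM mulVf ?gt_eqF// powRr1 ?(ltW H0)//.
  by rewrite -[(phi `^ _) `^ _]powRrM mulrC [p^-1 * q]mulrC mulrC.
pose X := Z `^ q.
have X0 : 0 < X by exact: powR_gt0.
(* The scale whose cells have volume exactly the bound to be proved, so that a set E violating this
   bound satisfies the condition L^n <= |E| of [majorant]. *)
pose L := X `^ n%:R^-1.
have L0 : 0 < L by exact: powR_gt0.
have LX : L ^+ n = X.
  by rewrite /L -powR_mulrn ?powR_ge0// -powRrM mulVf ?gt_eqF// powRr1 ?(ltW X0).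
have [G [mG G0 sG hG]] := majorant d_ge1 alpha_gt0 alpha_lt_n p_ge1 p_lt def_q hW K0 KW HW mf fphi phi0 L0.
pose E0 := [set x | ((lam / c)%:E < G x)%E].
have mE0 : measurable E0.
  rewrite -[E0]setTI; exact: (emeasurable_fun_o_infty measurableT mG).
have SE0 : S `<=` E0.
  move=> x Sx; rewrite /E0 /=.
  have h : (lam%:E < c%:E * G x)%E.
    apply: lt_le_trans (hS x Sx L L0) _; apply: lee_wpmul2l; first by rewrite lee_fin ltW.
    exact: sG.
  by rewrite EFinM lte_pdivrMr// muleC.
apply: le_trans (le_leb SE0) _; rewrite leNgt; apply/negP => XE.
(* The superlevel set may have infinite measure, while the averaging needs a finite one that still
   exceeds [X]. *)
have [E [mE EE0 XE' Eoo]] := sigma_finite_subset_gt (@leb_sigma_finite R n) mE0 XE.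
have Efin : leb E \is a fin_num by rewrite ge0_fin_numE// measure_ge0.
set e := fine (leb E).
have Ee : leb E = e%:E by rewrite /e fineK.
have Xe : X < e by rewrite -lte_fin -Ee.
have e0 : 0 < e by exact: lt_trans X0 Xe.
have := hG E e mE Ee; rewrite LX => /(_ (ltW Xe)) hI.
have lowI : ((lam / c * e)%:E <= \int[leb]_(x in E) G x)%E.
  apply: (@le_trans _ _ (\int[leb]_(x in E) (lam / c)%:E)%E).
    rewrite integral_cst; last exact: mE.
    by rewrite [X in (_ <= _ * X)%E]Ee -EFinM.
  apply: ge0_le_integral_nomeas => x Ex; first by rewrite lee_fin ltW// divr_gt0.
  by apply: ltW; exact: EE0.
have := le_trans lowI hI; rewrite lee_fin.
set theta := Ainfty_exponent n K / q.
have th0 : 0 < theta by rewrite divr_gt0// Ainfty_exponent_gt0.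
have thq : theta <= q^-1 := theta_le_qV alpha_gt0 alpha_lt_n p_ge1 p_lt def_q K.
set M0 := 64 * d%:R ^+ 8 * 3 ^+ n * H `^ q^-1 * ((4 ^ n)%:R * phi) `^ p^-1.
have M00 : 0 < M0.
  by rewrite /M0 !mulr_gt0 ?powR_gt0 ?exprn_gt0// mulr_gt0// ltr0n expn_gt0.
have Xq : X `^ (- q^-1) = Z^-1.
  by rewrite /X -powRrM mulrN divff ?gt_eqF// powR_inv1// ltW.
(* both scale ranges contribute at most a multiple of [e * X `^ (- 1 / q)] *)
have large : e `^ (1 - p^-1) * (e `^ (alpha / n%:R + theta) / X `^ theta) <= e * X `^ (- q^-1).
  rewrite mulrA -powRD; last by rewrite (gt_eqF e0) implybT.
  have -> : 1 - p^-1 + (alpha / n%:R + theta) = 1 + (theta - q^-1) by rewrite -def_q; ring.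
  rewrite powRD; last by rewrite (gt_eqF e0) implybT.
  rewrite powRr1 ?(ltW e0)// -mulrA ler_wpM2l ?(ltW e0)//.
  rewrite ler_pdivrMr ?powR_gt0// -powRD; last by rewrite (gt_eqF X0) implybT.
  have -> : - q^-1 + theta = - (q^-1 - theta) by ring.
  have -> : theta - q^-1 = - (q^-1 - theta) by ring.
  rewrite !powRN lef_pV2 ?posrE ?powR_gt0//.
  by rewrite ge0_ler_powR ?nnegrE ?subr_ge0 ?(ltW X0) ?(ltW e0) ?(ltW Xe).
have small : e `^ (1 - p^-1) * X `^ (alpha / n%:R) <= e * X `^ (- q^-1).
  rewrite powRD; last by rewrite (gt_eqF e0) implybT.
  rewrite powRr1 ?(ltW e0)// -mulrA ler_wpM2l ?(ltW e0)//.
  have -> : - q^-1 = - p^-1 + alpha / n%:R by rewrite -def_q; ring.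
  rewrite powRD; last by rewrite (gt_eqF X0) implybT.
  rewrite ler_wpM2r ?powR_ge0// !powRN lef_pV2 ?posrE ?powR_gt0//.
  by rewrite ge0_ler_powR ?nnegrE ?invr_ge0 ?(ltW p0) ?(ltW X0) ?(ltW e0) ?(ltW Xe).
have upper : M0 * e `^ (1 - p^-1) *
    (3 / theta * (e `^ (alpha / n%:R + theta) / X `^ theta) +
     3 ^+ n * X `^ (alpha / n%:R) / (1 - 2 `^ (- alpha))) <=
    M0 * ((Ct + Ca) * K) * (e * X `^ (- q^-1)).
  set B := e `^ (1 - p^-1) in large small *.
  set T1 := e `^ (alpha / n%:R + theta) / X `^ theta in large *.
  set T2 := X `^ (alpha / n%:R) in small *.
  set Y := e * X `^ (- q^-1) in large small *.
  have -> : M0 * B * (3 / theta * T1 + 3 ^+ n * T2 / (1 - 2 `^ (- alpha))) =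
      M0 * (3 / theta * (B * T1) + Ca * (B * T2)) by rewrite /Ca; ring.
  have -> : M0 * ((Ct + Ca) * K) * Y = M0 * (Ct * K * Y + Ca * K * Y) by ring.
  have B0 : 0 <= B by exact: powR_ge0.
  have T10 : 0 <= T1 by rewrite divr_ge0 ?powR_ge0.
  have T20 : 0 <= T2 by exact: powR_ge0.
  apply: ler_wpM2l; first exact: ltW.
  apply: lerD; apply: ler_pM => //.
  - by rewrite divr_ge0// ltW.
  - exact: mulr_ge0.
  - exact: exponent_inv_le.
  - exact: ltW Ca_gt0.
  - exact: mulr_ge0.
  - by rewrite ler_peMr// ltW// Ca_gt0.
move=> /le_trans/(_ upper); rewrite Xq => h.
have : lam <= c * (M0 * ((Ct + Ca) * K)) * Z^-1.
  rewrite -(ler_pM2r e0).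
  have -> : lam * e = c * (lam / c * e) by field; rewrite gt_eqF.
  have -> : c * (M0 * ((Ct + Ca) * K)) * Z^-1 * e = c * (M0 * ((Ct + Ca) * K) * (e * Z^-1)).
    by ring.
  by rewrite ler_wpM2l// ltW.
have -> : c * (M0 * ((Ct + Ca) * K)) = lam * Z / 2.
  rewrite /M0 /Z /weak_const -/c powRM ?(ltW phi0)//; field.
  by rewrite gt_eqF.
by rewrite mulrAC mulfK ?gt_eqF//; lra.
Qed.

End weak_type.

Lemma scale_sum_eq0 (R : realType) (n d : nat) (alpha p : R)
    (W : Rn R n -> 'M[R]_d) (f : Rn R n -> 'cV[R]_d) x L :
  0 < p -> matrix_weight W -> mfmx f ->
  (\int[leb]_x (enorm (f x) `^ p)%:E = 0)%E -> scale_sum alpha W f x L = 0%E.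
Proof.
move=> p0 hW mf f0; rewrite /scale_sum; apply: eseries0 => i _ _.
have z l : scale_term alpha W f x l = 0%E.
  rewrite /scale_term; apply/eqP; rewrite mule_eq0; apply/orP; right; apply/eqP.
  apply: (@integral_eq0_of_zero _ _ _ _ _ (fun y => enorm (f y) `^ p)).
  - exact: measurable_ccube.
  - exact: measurable_enorm_powR.
  - exact: measurable_kernel_term.
  - by move=> y; exact: powR_ge0.
  - by move=> y; exact: kernel_term_ge0.
  - move=> y /eqP; rewrite powR_eq0 => /andP[/eqP h _].
    by rewrite /kernel_term (enorm_eq0 h) !mulmx0 enorm0.
  - exact: f0.
by rewrite !z adde0.
Qed.

Theorem theorem1p9 (R : realType) (n d : nat) (alpha p q : R)
    (d_ge1 : (1 <= d)%N)
    (alpha_gt0 : 0 < alpha) (alpha_lt_n : alpha < n%:R)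
    (p_ge1 : 1 <= p) (p_lt : p < n%:R / alpha)
    (def_q : p^-1 - q^-1 = alpha / n%:R) :
  exists C : R, 0 < C /\
    forall (W : Rn R n -> 'M[R]_d) (f : Rn R n -> 'cV[R]_d) (lambda : R),
      matrix_weight W -> Apq p q W -> Lp p f -> 0 < lambda ->
      let bound :=
        (C%:E * Apq_char p q W * sc_Ainfty_char q W `^ q
         * ((lambda `^ q)^-1)%:E
         * (\int[leb]_x (enorm (f x) `^ p)%:E) `^ (q / p))%E in
      (leb [set x | (lambda < enorm (W_riesz W alpha f x))%R] <= bound)%E /\
      (leb [set x | lambda%:E < christ_goldberg W alpha f x] <= bound)%E.
Proof.
exists (weak_const n d alpha p q `^ q); split.
  by apply: powR_gt0; exact: weak_const_gt0.
move=> W f lam hW hA [mf1 fp] lam0 bound.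
have p0 : 0 < p := p_gt0 p_ge1.
have q0 : 0 < q := q_gt0 alpha_gt0 alpha_lt_n p_ge1 p_lt def_q.
have mf : mfmx f by move=> i j; rewrite ord1; exact: mf1.
have dR : 1 <= d%:R :> R by rewrite ler1n.
pose c := d%:R * 2 `^ (n%:R - alpha).
(* One set that contains both level sets; requiring all [L] leaves its choice to
   [weak_type_bound]. *)
pose S := [set x | forall L, 0 < L -> (lam%:E < c%:E * scale_sum alpha W f x L)%E].
have sub1 : [set x | lam < enorm (W_riesz W alpha f x)] `<=` S.
  move=> x /= hx L L0; apply: lt_le_trans (W_riesz_le d_ge1 alpha_lt_n hW mf x L0).
  by rewrite lte_fin.
have sub2 : [set x | (lam%:E < christ_goldberg W alpha f x)%E] `<=` S.
  move=> x /= hx L L0; apply: lt_le_trans hx _.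
  apply: le_trans (christ_goldberg_le alpha_gt0 alpha_lt_n hW mf x L0) _.
  apply: lee_wpmul2r; last by rewrite lee_fin /c ler_peMl ?powR_ge0.
  by apply: nneseries_ge0 => i _ _; apply: adde_ge0; exact: scale_term_ge0.
suff main : (leb S <= bound)%E.
  by split; apply: le_trans main; exact: le_leb.
have int0 : (0 <= \int[leb]_x (enorm (f x) `^ p)%:E)%E.
  by apply: integral_ge0 => x _; rewrite lee_fin powR_ge0.
have fin : (\int[leb]_x (enorm (f x) `^ p)%:E)%E \is a fin_num by rewrite ge0_fin_numE.
set phi := fine (\int[leb]_x (enorm (f x) `^ p)%:E)%E.
have fphi : (\int[leb]_x (enorm (f x) `^ p)%:E = phi%:E)%E by rewrite /phi fineK.
have : 0 <= phi by exact: fine_ge0.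
rewrite le_eqVlt => /predU1P[phi0|phi0].
  (* Here [f] vanishes almost everywhere, so every scale term is 0 and the bound to be proved is 0
     as well. *)
  rewrite (_ : S = set0).
    rewrite measure0 /bound fphi -phi0 poweR_EFin powR0 ?mule0//.
    by rewrite gt_eqF// divr_gt0.
  apply/seteqP; split => // x /(_ 1 ltr01).
  rewrite (@scale_sum_eq0 R n d alpha p W f _ _ p0 hW mf); last by rewrite fphi -phi0.
  by rewrite mule0 ltNge lee_fin (ltW lam0).
pose H := fine (Apq_char p q W).
have HW : (Apq_char p q W <= H%:E)%E.
  by rewrite /H; move: hA; rewrite /Apq; case: (Apq_char p q W) => [r _|//|_]; rewrite ?lexx ?leNye.
have H0 : 0 < H := H_gt0 d_ge1 alpha_gt0 alpha_lt_n p_ge1 p_lt def_q hW HW.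
(* [fine] sends an infinite value to 0; [0 < H] excludes this, so the characteristic is exactly
   [H]. *)
have HE : Apq_char p q W = H%:E.
  by move: H0; rewrite /H; move: hA; rewrite /Apq; case: (Apq_char p q W) => //=; rewrite ltxx.
(* The reducing matrix of the unit cube provides a vector [v] whose weight has finite mass there, as
   [Ainfty_const_ge1] requires. *)
have Kge (K' : R) : 0 < K' -> (sc_Ainfty_char q W <= K'%:E)%E -> 1 <= K'.
  move=> K'0 K'W.
  have [B [c1 [c2 [[_ c10 _ uB] _ hB _]]]] := Apq_reduction d_ge1 alpha_gt0 alpha_lt_n
    p_ge1 p_lt def_q hW HW (fun=> 0) ltr01.
  pose v := invmx B *m ev (Ordinal d_ge1).
  have v0 : v != 0.
    apply/eqP => hv; have := enorm_ev R (Ordinal d_ge1).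
    by rewrite -(mulKVmx uB (ev _)) -/v hv mulmx0 enorm0 => /esym/eqP; rewrite oner_eq0.
  apply: (Ainfty_const_ge1 hW K'0 K'W v0 ltr01).
  by apply: le_lt_trans (hB _) _; rewrite ltry.
have C0 : 0 < weak_const n d alpha p q `^ q by apply: powR_gt0; exact: weak_const_gt0.
have lq0 : 0 < (lam `^ q)^-1 by rewrite invr_gt0 powR_gt0.
have ph0 : 0 < phi `^ (q / p) by exact: powR_gt0.
(* If the scalar characteristic is infinite, so is the bound, since its other factors are
   positive. *)
have [Koo|Koo] := ltP (sc_Ainfty_char q W) +oo%E; last first.
  move: Koo; rewrite leye_eq => /eqP Koo.
  rewrite /bound HE Koo fphi poweR_EFin poweRyr ?gt_eqF//.
  by rewrite -EFinM gt0_muley ?lte_fin ?mulr_gt0// !gt0_mulye ?lte_fin// leey.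
pose K := fine (sc_Ainfty_char q W).
have KW : (sc_Ainfty_char q W <= K%:E)%E.
  by rewrite /K; move: Koo; case: (sc_Ainfty_char q W) => [r _|//|_]; rewrite ?lexx ?leNye.
have K1 : 1 <= K.
  rewrite leNgt; apply/negP => K1.
  (* [Kge] applies to positive bounds, and the sign of [K] is still unknown. The maximum with 1/2 is
     a positive bound, and it can reach 1 only if [K] does. *)
  pose K' := Num.max K (1 / 2).
  have : 1 <= K'.
    apply: Kge; first by rewrite lt_max divr_gt0 ?orbT.
    by apply: le_trans KW _; rewrite lee_fin le_max lexx.
  by rewrite leNgt gt_max K1 /=; lra.
have KE : sc_Ainfty_char q W = K%:E.
  move: K1; rewrite /K; move: Koo; case: (sc_Ainfty_char q W) => //= _.
  by rewrite ler10.
have := weak_type_bound d_ge1 alpha_gt0 alpha_lt_n p_ge1 p_lt def_q hW K1 KW HW mf fphi phi0 lam0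
  (fun x (Sx : S x) => Sx).
rewrite /bound HE KE fphi !poweR_EFin -!EFinM.
by rewrite !mulrA.
Qed.
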